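(* Let $y_0>0$, $x_0,t_0\in\mathbb{R}$, and let $c>0$, $\varepsilon>0$ be arbitrary. Let $u(x,y,t)$ be a $C^\infty$-smooth function on $\{(x,y,t): x,t\in\mathbb{R},\ y\geqslant 0\}$ (smooth up to the boundary $y=0$) satisfying the wave equation $$\frac{\partial^2 u}{\partial t^2}-\frac{\partial^2 u}{\partial x^2}-\frac{\partial^2 u}{\partial y^2}=0$$ and the Dirichlet boundary condition $u|_{y=0}=0$. Then $$u(x_0,y_0,t_0)=\lim_{h\to 0+}\int_U dx\,dt\;K_h(x-x_0,y_0,t-t_0)\,\frac{\partial u}{\partial y}(x,0,t),$$ where the set of integration $U$ (depending on $c$, $\varepsilon$, $x_0$, $y_0$, $t_0$) and the kernel $K_h$ (depending on $c$ and $h>0$) are those defined in the context.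
   Context: For $c>0$ put $D(z):=z\sqrt{\dfrac{c}{c+2z}}$ for $z\geqslant 0$. For $c,\varepsilon>0$ the set $U$ is $$U:=\left\{(x,t)\in\mathbb{R}^2 : |t-t_0|\leqslant y_0,\ |x-x_0|\leqslant D\left(\sqrt{y_0^2-(t-t_0)^2}\right)+\varepsilon\right\}$$ (regarded as a subset of the boundary $\{y=0\}$). For $h>0$, $x\in\mathbb{R}$, $|t|\leqslant y_0$ the kernel is $$K_h(x,y_0,t):=\frac{1}{2\pi^{3/2}\sqrt{h}}\,\mathrm{Re}\left[\frac{1}{\sqrt{c+ix}}\int_0^{\pi/2}ds\,\exp\left(-\frac{1}{4h(c+ix)}\left(x+i\sqrt{y_0^2-t^2}\,\sin s\right)^2\right)\right],$$ where the branch of the square root $\sqrt{c+ix}$ is chosen so that $\mathrm{Re}\sqrt{c+ix}>0$. *)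

(* Defs.v *)
From HB Require Import structures.
From mathcomp Require Import all_boot all_order all_algebra.
From mathcomp Require Import all_classical all_reals all_analysis.
From mathcomp Require Import complex.

Set Implicit Arguments.
Unset Strict Implicit.
Unset Printing Implicit Defensive.

Import Order.TTheory GRing.Theory Num.Theory.
Import numFieldNormedType.Exports.

Local Open Scope classical_set_scope.
Local Open Scope ring_scope.
Local Open Scope complex_scope.

(* A function on the closed half-space {(x, y, t) : 0 <= y} is represented by
   u : R -> R -> R -> R, taking x, y, t in this order; its values for y < 0 are
   arbitrary and nothing below depends on them at points with 0 <= y. *)
Section half_space_derivatives.
Context {R : realType}.
Implicit Types (u : R -> R -> R -> R) (x y t : R).

Definition right_quotient (f : R -> R) (a : R) : R -> R :=
  fun k => k^-1 * (f (a + k) - f a).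

Definition dx u x y t : R := derive1 (fun x' => u x' y t) x.

Definition dt u x y t : R := derive1 (fun t' => u x y t') t.

(* Two-sided derivative inside the half-space, right derivative on y = 0. *)
Definition dy u x y t : R :=
  if 0 < y then derive1 (fun y' => u x y' t) y
  else lim (right_quotient (fun y' => u x y' t) y @ 0^'+).

Definition has_partials u x y t : Prop :=
  [/\ derivable (fun x' => u x' y t) x 1,
      derivable (fun t' => u x y t') t 1 &
      if 0 < y then derivable (fun y' => u x y' t) y 1
      else cvg (right_quotient (fun y' => u x y' t) y @ 0^'+)].

Definition half_space : set (R * R * R) := [set p | 0 <= p.1.2].

Definition continuous_half_space u : Prop :=
  {within half_space, continuous (fun p : R * R * R => u p.1.1 p.1.2 p.2)}.

Fixpoint Ck_half_space (k : nat) u : Prop :=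
  continuous_half_space u /\
  match k with
  | 0%N => True
  | k'.+1 =>
      [/\ forall x y t, 0 <= y -> has_partials u x y t,
          Ck_half_space k' (dx u),
          Ck_half_space k' (dy u) &
          Ck_half_space k' (dt u)]
  end.

Definition smooth_half_space u : Prop := forall k, Ck_half_space k u.

End half_space_derivatives.

Section kernel.
Context {R : realType}.

Definition expc (z : R[i]) : R[i] :=
  (expR (complex.Re z) * cos (complex.Im z)) +i*
  (expR (complex.Re z) * sin (complex.Im z)).

Definition Cintegral d (T : measurableType d)
    (mu : {measure set T -> \bar R}) (A : set T) (f : T -> R[i]) : R[i] :=
  (\int[mu]_(s in A) complex.Re (f s)) +i* (\int[mu]_(s in A) complex.Im (f s)).

(* sqrtc is the branch required in the kernel below; sqrtC, whose values have
   nonnegative imaginary part, is not. *)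
Lemma Re_sqrtc_gt0 (c x : R) : 0 < c -> 0 < complex.Re (sqrtc (c +i* x)).
Proof.
by move=> c0 /=; rewrite sqrtr_gt0 divr_gt0// ltr_wpDl// sqrtr_ge0.
Qed.

Definition D (c z : R) : R := z * Num.sqrt (c / (c + 2 * z)).

Definition U (c eps x0 y0 t0 : R) : set (R * R) :=
  [set p | `|p.2 - t0| <= y0 /\
    `|p.1 - x0| <= D c (Num.sqrt (y0 ^+ 2 - (p.2 - t0) ^+ 2)) + eps].

Definition K (c h x y0 t : R) : R :=
  (2 * (pi : R) `^ (3 / 2) * Num.sqrt h)^-1 *
  complex.Re (
      (sqrtc (c +i* x))^-1 *
      Cintegral lebesgue_measure `[0, (pi / 2 : R)]
        (fun s : R =>
           expc (- ((4 * h)%:C * (c +i* x))^-1 *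
             (x +i* (Num.sqrt (y0 ^+ 2 - t ^+ 2) * sin s)) ^+ 2))).

End kernel.

(* Main.v *)
From HB Require Import structures.
From mathcomp Require Import all_boot all_order all_algebra.
From mathcomp Require Import all_classical all_reals all_analysis.
From mathcomp Require Import ring lra.
Require Import Defs.

(** With [w = c + i x] and [N_h(x, s) = (4 pi h w)^(-1/2) exp (- (x + i s)^2 / (4 h w))],
    the kernel is [K_h = pi^-1 int_0^(pi/2) Re N_h(x, rho sin s) ds] where [rho = sqrt (y0^2 - t^2)].
    Since [i N_x = h N_ss + N_s], the integral [F] of [Re (N_h e^(ikx))] over [|x| <= L] solves
    [h F'' + F' = k F] up to boundary terms that are exponentially small for [s <= L - eps];
    hence [F] tends to [e^(ks)] as [h] tends to [0]. Paired with [cos (w t)], [w^2 = k^2 + b^2], the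
    growth in [k] is compensated by the oscillation in [t]: by a spherical mean identity the
    integral of [K_h] against the mode [cos (k x) cos (w t)] is bounded uniformly in [h], [k], [b]
    and tends to [sin (b y0) / b].

    As [K_h] is even in [x] and [t], the solution may be symmetrized about [(x0, t0)]. The
    [y]-derivative of its (cut off) initial value then has an absolutely convergent double cosine
    series, and by a weighted energy inequality the solution agrees, in a domain of dependence, with
    the resulting superposition of the modes [cos (k x) sin (b y) cos (w t)]. Summing the limits of
    the modes gives the formula on the rectangle [|x - x0| <= y0 + eps], [|t - t0| <= y0]; on
    the rectangle minus [U] the kernel is exponentially small. *)

Set Implicit Arguments.
Unset Strict Implicit.
Unset Printing Implicit Defensive.

Import Order.TTheory GRing.Theory Num.Theory.
Import numFieldNormedType.Exports.

Local Open Scope classical_set_scope.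
Local Open Scope ring_scope.


(** * Continuity and parametric integrals *)

(** The obstacle is that the kernel does not concentrate: inside [U] its modulus reaches the size
    [exp (const / h)], so neither domination nor an approximate-identity argument applies, and the
    limit rests on cancellation between the integrations. The plain bound of the pairing by the
    supremum of the data has a constant that is useless as [h] tends to 0. The series of modes is
    therefore handled in a fixed order: at fixed [h] the plain bound lets the truncation go to
    infinity, a bound per mode uniform in [h] then controls the tail, and only finitely many modes
    are sent to their limits. The uniform bound exists because the transform at frequency [k] grows
    in [s] at the rate [grow h k], which never exceeds [k]. The spherical mean identity holds for
    every rate [mu] once the time frequency is [sqrt (kp^2 + mu^2)]; a smaller rate only raises
    [kp], and [sin (kp y0) / kp] never exceeds [y0] in modulus. Symmetrization removes the sine
    terms in [x] and the initial velocity, so that cosines in [x] and [t] suffice; the Dirichlet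
    condition selects the sines in [y]. *)

Section continuity.
Context {R : realType} {T : topologicalType}.
Implicit Types f g : T -> R.

Lemma contC {U : topologicalType} (k : U) : continuous (fun _ : T => k).
Proof. exact: cst_continuous. Qed.
Lemma contI : continuous (fun x : T => x).
Proof. by move=> x; exact: cvg_id. Qed.
Lemma contD f g : continuous f -> continuous g -> continuous (fun x => f x + g x).
Proof. by move=> cf cg x; apply: cvgD; [exact: cf|exact: cg]. Qed.
Lemma contB f g : continuous f -> continuous g -> continuous (fun x => f x - g x).
Proof. by move=> cf cg x; apply: cvgB; [exact: cf|exact: cg]. Qed.
Lemma contM f g : continuous f -> continuous g -> continuous (fun x => f x * g x).
Proof. by move=> cf cg x; apply: cvgM; [exact: cf|exact: cg]. Qed.
Lemma contN f : continuous f -> continuous (fun x => - f x).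
Proof. by move=> cf x; apply: cvgN; exact: cf. Qed.
Lemma cont_comp1 (g : R -> R) f : continuous g -> continuous f -> continuous (fun x => g (f x)).
Proof. by move=> cg cf x; apply: (@continuous_comp _ _ _ f g); [exact: cf|exact: cg]. Qed.
Lemma cont_comp {U V : topologicalType} (g : U -> V) (a : T -> U) :
  continuous g -> continuous a -> continuous (fun x => g (a x)).
Proof. by move=> cg ca x; apply: (@continuous_comp _ _ _ a g); [exact: ca|exact: cg]. Qed.
Lemma contX f n : continuous f -> continuous (fun x => f x ^+ n).
Proof.
move=> cf; elim: n => [|n IH].
  by under eq_fun do rewrite expr0; exact: contC.
by under eq_fun do rewrite exprS; exact: contM.
Qed.
Lemma contV f : (forall x, f x != 0) -> continuous f -> continuous (fun x => (f x)^-1).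
Proof. by move=> f0 cf x; apply: cvgV => //; exact: cf. Qed.
Lemma cont_expR f : continuous f -> continuous (fun x => expR (f x)).
Proof. exact/cont_comp1/continuous_expR. Qed.
Lemma cont_sin f : continuous f -> continuous (fun x => sin (f x)).
Proof. exact/cont_comp1/continuous_sin. Qed.
Lemma cont_cos f : continuous f -> continuous (fun x => cos (f x)).
Proof. exact/cont_comp1/continuous_cos. Qed.
Lemma cont_sqrt f : continuous f -> continuous (fun x => Num.sqrt (f x)).
Proof. exact/cont_comp1/sqrt_continuous. Qed.
Lemma cont_atan f : continuous f -> continuous (fun x => atan (f x)).
Proof. by apply: cont_comp1 => x; exact: continuous_atan. Qed.
Lemma cont_norm f : continuous f -> continuous (fun x => `|f x|).
Proof. by apply: cont_comp1; exact: norm_continuous. Qed.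
Lemma cont_ln f : (forall x, 0 < f x) -> continuous f -> continuous (fun x => ln (f x)).
Proof.
move=> f0 cf x; apply: (@cvg_comp _ _ _ f (@ln R) (nbhs x) (nbhs (f x))); first exact: cf.
exact: (continuous_ln (f0 x)).
Qed.
Lemma cont_max f g : continuous f -> continuous g -> continuous (fun x => Num.max (f x) (g x)).
Proof. by move=> cf cg x; apply: continuous_max; [exact: cf|exact: cg]. Qed.
Lemma cont_min f g : continuous f -> continuous g -> continuous (fun x => Num.min (f x) (g x)).
Proof. by move=> cf cg x; apply: continuous_min; [exact: cf|exact: cg]. Qed.
Lemma cont_fst {V W : topologicalType} (a : T -> V * W) :
  continuous a -> continuous (fun x => (a x).1).
Proof. by move=> ca x; apply: (@continuous_comp _ _ _ a fst); [exact: ca|exact: cvg_fst]. Qed.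
Lemma cont_snd {V W : topologicalType} (a : T -> V * W) :
  continuous a -> continuous (fun x => (a x).2).
Proof. by move=> ca x; apply: (@continuous_comp _ _ _ a snd); [exact: ca|exact: cvg_snd]. Qed.
Lemma cont_fst_id {V W : topologicalType} : continuous (@fst V W).
Proof. by move=> x; exact: cvg_fst. Qed.
Lemma cont_snd_id {V W : topologicalType} : continuous (@snd V W).
Proof. by move=> x; exact: cvg_snd. Qed.
Lemma cont_pair {V W : topologicalType} (a : T -> V) (b : T -> W) :
  continuous a -> continuous b -> continuous (fun x => (a x, b x)).
Proof. by move=> ca cb x; apply: cvg_pair; [exact: ca|exact: cb]. Qed.
Lemma cont_comp2 {V W : topologicalType} (g : V -> W -> R) (a : T -> V) (b : T -> W) :
  continuous (fun p => g p.1 p.2) ->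
  continuous a -> continuous b -> continuous (fun x => g (a x) (b x)).
Proof.
move=> cg ca cb x.
apply: (@continuous_comp _ _ _ (fun x => (a x, b x)) (fun p => g p.1 p.2)).
  exact: cont_pair.
exact: cg.
Qed.
Lemma cont_comp3 {V W Z : topologicalType} (g : V -> W -> Z -> R) (a : T -> V) (b : T -> W)
   (d : T -> Z) :
  continuous (fun p => g p.1.1 p.1.2 p.2) ->
  continuous a -> continuous b -> continuous d ->
  continuous (fun x => g (a x) (b x) (d x)).
Proof.
move=> cg ca cb cd x.
apply: (@continuous_comp _ _ _ (fun x => (a x, b x, d x)) (fun p => g p.1.1 p.1.2 p.2)).
  by apply: cont_pair => //; exact: cont_pair.
exact: cg.
Qed.
Lemma cont_sum (I : Type) (r : seq I) (P : pred I) (F : I -> T -> R) :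
  (forall i, continuous (F i)) -> continuous (fun x => \sum_(i <- r | P i) F i x).
Proof.
move=> cF; elim: r => [|i r IH]; first by under eq_fun do rewrite big_nil; exact: contC.
by under eq_fun do rewrite big_cons; case: (P i) => //; exact: contD.
Qed.
End continuity.

Ltac ctn_leaf := match goal with
  | H : ?P |- ?P => exact H
  | |- continuous fst => exact: cont_fst_id
  | |- continuous snd => exact: cont_snd_id
  end.
Ltac ctn_step :=
  lazymatch goal with
  | |- continuous (fun _ => ?k) => exact: contC
  | |- continuous (fun x => x) => exact: contI
  | |- continuous (fun x => @?f x + @?g x) => refine (@contD _ _ f g _ _)
  | |- continuous (fun x => - @?f x) => refine (@contN _ _ f _)
  | |- continuous (fun x => @?f x * @?g x) => refine (@contM _ _ f g _ _)
  | |- continuous (fun x => @?f x ^+ ?n) => refine (@contX _ _ f n _)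
  | |- continuous (fun x => (@?f x)^-1) => first [ ctn_leaf | refine (@contV _ _ f _ _) ]
  | |- continuous (fun x => expR (@?f x)) => refine (@cont_expR _ _ f _)
  | |- continuous (fun x => sin (@?f x)) => refine (@cont_sin _ _ f _)
  | |- continuous (fun x => cos (@?f x)) => refine (@cont_cos _ _ f _)
  | |- continuous (fun x => Num.sqrt (@?f x)) => refine (@cont_sqrt _ _ f _)
  | |- continuous (fun x => `|@?f x|) => refine (@cont_norm _ _ f _)
  | |- continuous (fun x => atan (@?f x)) => refine (@cont_atan _ _ f _)
  | |- continuous (fun x => Num.max (@?f x) (@?g x)) => refine (@cont_max _ _ f g _ _)
  | |- continuous (fun x => Num.min (@?f x) (@?g x)) => refine (@cont_min _ _ f g _ _)
  | |- continuous (fun x => (@?f x).1) => refine (@cont_fst _ _ _ f _)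
  | |- continuous (fun x => (@?f x).2) => refine (@cont_snd _ _ _ f _)
  | |- continuous (fun x => (@?f x, @?g x)) => refine (@cont_pair _ _ _ f g _ _)
  | |- _ => first [ ctn_leaf | match goal with
    | H : continuous ?g |- continuous (fun x => ?g (@?a x)) => refine (@cont_comp _ _ _ g a H _)
    | H : continuous (fun p => ?g (fst p) (snd p)) |- continuous (fun x => ?g (@?a x) (@?b x)) =>
        refine (@cont_comp2 _ _ _ _ g a b H _ _)
    | H : continuous (fun p => ?g (fst (fst p)) (snd (fst p)) (snd p))
        |- continuous (fun x => ?g (@?a x) (@?b x) (@?d x)) => refine (@cont_comp3 _ _ _ _ _ g a b d H _ _ _)
    | H : _ |- continuous (fun x => ?g (@?a x)) => refine (@cont_comp _ _ _ g a H _)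
    | H : _ |- continuous (fun x => ?g (@?a x) (@?b x)) => refine (@cont_comp2 _ _ _ _ g a b H _ _)
    | H : _ |- continuous (fun x => ?g (@?a x) (@?b x) (@?d x)) => refine (@cont_comp3 _ _ _ _ _ g a b d H _ _ _)
    | H : _ |- continuous (?g ?q) => refine (@cont_comp2 _ _ _ _ g (fun=> q) (fun x => x) H _ _)
    | H : _ |- continuous (?g ?p ?q) => refine (@cont_comp3 _ _ _ _ _ g (fun=> p) (fun=> q) (fun x => x) H _ _ _)
    end ]
  end.
Ltac ctn := cbn beta; repeat first [ ctn_step | assumption ].

Definition Int {R : realType} (a b : R) (f : R -> R) : R :=
  \int[lebesgue_measure]_(x in `[a, b]) f x.

Section Int.
Context {R : realType}.
Implicit Types (f g F : R -> R) (a b k : R).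
Local Notation mu := (@lebesgue_measure R).

Lemma Int_int f a b : continuous f -> mu.-integrable `[a, b] (EFin \o f).
Proof.
move=> cf; apply: continuous_compact_integrable; first exact: segment_compact.
exact: continuous_subspaceT.
Qed.

Lemma eq_Int f g a b : (forall x, a <= x <= b -> f x = g x) -> Int a b f = Int a b g.
Proof.
move=> fg; apply: eq_Rintegral => x; rewrite inE /= in_itv /= => xab; exact: fg.
Qed.

Lemma IntD f g a b : continuous f -> continuous g ->
  Int a b (fun x => f x + g x) = Int a b f + Int a b g.
Proof. by move=> cf cg; apply: RintegralD => //; exact: Int_int. Qed.

Lemma IntB f g a b : continuous f -> continuous g ->
  Int a b (fun x => f x - g x) = Int a b f - Int a b g.
Proof. by move=> cf cg; apply: RintegralB => //; exact: Int_int. Qed.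

Lemma IntZ k f a b : continuous f -> Int a b (fun x => k * f x) = k * Int a b f.
Proof. by move=> cf; apply: RintegralZl => //; exact: Int_int. Qed.

Lemma IntN f a b : continuous f -> Int a b (fun x => - f x) = - Int a b f.
Proof. by move=> cf; rewrite -mulN1r -IntZ//; apply: eq_Int => x _; rewrite mulN1r. Qed.

Lemma Int_cst k a b : a <= b -> Int a b (fun _ => k) = k * (b - a).
Proof.
move=> ab; rewrite /Int Rintegral_cst//= lebesgue_measure_itv/=.
move: ab; rewrite le_eqVlt => /predU1P[->|ab]; last by rewrite lte_fin ab.
by rewrite ltxx subrr.
Qed.

Lemma Int0 a b : Int a b (fun _ => 0) = 0.
Proof. by rewrite /Int Rintegral_cst// mul0r. Qed.

Lemma le_Int f g a b : continuous f -> continuous g ->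
  (forall x, a <= x <= b -> f x <= g x) -> Int a b f <= Int a b g.
Proof.
move=> cf cg fg; apply: (le_Rintegral _ (Int_int a b cf) (Int_int a b cg)) => //.
Qed.

Lemma Int_ge0 f a b : (forall x, a <= x <= b -> 0 <= f x) -> 0 <= Int a b f.
Proof. by move=> f0; apply: Rintegral_ge0 => x /=; rewrite in_itv/=; exact: f0. Qed.

Lemma ler_norm_Int f a b : continuous f -> `|Int a b f| <= Int a b (fun x => `|f x|).
Proof. by move=> cf; apply: le_normr_Rintegral => //; exact: Int_int. Qed.

Lemma ler_Int f g a b : continuous f -> continuous g ->
  (forall x, a <= x <= b -> `|f x| <= g x) -> `|Int a b f| <= Int a b g.
Proof.
move=> cf cg fg; apply: (le_trans (ler_norm_Int _ _ cf)).
by apply: le_Int => //; exact: cont_norm.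
Qed.

Lemma Int_bound f a b k : a <= b -> continuous f ->
  (forall x, a <= x <= b -> `|f x| <= k) -> `|Int a b f| <= k * (b - a).
Proof.
move=> ab cf fk; rewrite -Int_cst//; apply: ler_Int => //; exact: contC.
Qed.

Lemma Int_sum (I : Type) (r : seq I) (P : pred I) (F : I -> R -> R) a b :
  (forall i, continuous (F i)) ->
  Int a b (fun x => \sum_(i <- r | P i) F i x) = \sum_(i <- r | P i) Int a b (F i).
Proof.
move=> cF; elim: r => [|i r IH].
  by under eq_Int do rewrite big_nil; rewrite Int0 big_nil.
under eq_Int do rewrite big_cons.
rewrite big_cons; case: (P i) => //; rewrite IntD ?IH//; exact: cont_sum.
Qed.

(** Compactness of the segment in near-covering form: a condition that holds near each pair of a
    point of the segment and [p] holds near [p] for the whole segment at once. Uniform continuity on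
    segments is drawn from it. *)
Lemma tube {T : topologicalType} (a b : R) (p : T) (P : T -> R -> Prop) :
  (forall y, a <= y <= b -> \forall y' \near y & p' \near p, P p' y') ->
  \forall p' \near p, forall y, a <= y <= b -> P p' y.
Proof.
move=> H; have /compact_near_coveringP/(_ T (nbhs p) P _) := @segment_compact R a b.
have /[swap] /[apply] : forall x : R, `[a, b]%classic x ->
    \forall x' \near x & i \near nbhs p, P i x'.
  by move=> x /=; rewrite in_itv/=; exact: H.
move=> N; apply: filterS N => p' N y yab; apply: N => /=; by rewrite in_itv.
Qed.

Lemma tube_norm {T : topologicalType} (a b : R) (p : T) (g : T -> R -> R) (e : R) : 0 < e ->
  continuous (fun p : T * R => g p.1 p.2) ->
  \forall p' \near p, forall y, a <= y <= b -> `|g p' y - g p y| < e.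
Proof.
move=> e0 cg; apply: tube => y _.
have ch : continuous (fun q : T * R => g q.1 q.2 - g p q.2) by ctn.
have /cvgr_dist_lt/(_ _ e0) := ch (p, y).
rewrite /= subrr => -[[A B]] /= [NA NB] AB.
exists (B, A); first by split.
move=> [y' p'] [/= By Ap].
by have := AB (p', y') (conj Ap By) => /=; rewrite sub0r normrN.
Qed.

Lemma cont_Int {T : topologicalType} (g : T -> R -> R) a b : a <= b ->
  continuous (fun p : T * R => g p.1 p.2) -> continuous (fun p => Int a b (g p)).
Proof.
move=> ab cg p; apply/cvgrPdist_lt => e e0.
have cgp q : continuous (g q) by ctn.
have e'0 : 0 < e / (b - a + 1) by rewrite divr_gt0// ltr_wpDl// subr_ge0.
have := @tube_norm _ a b p g _ e'0 cg; apply: filterS => q N.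
rewrite distrC -IntB//.
apply: (@le_lt_trans _ _ (e / (b - a + 1) * (b - a))).
  apply: Int_bound => //; first exact: contB.
  by move=> y /N/ltW.
by rewrite mulrAC ltr_pdivrMr ?ltr_wpDl ?subr_ge0// ltr_pM2l// ltrDl.
Qed.

Lemma is_derive_Int (f f' : R -> R -> R) a b (x : R) : a <= b ->
  continuous (fun p : R * R => f p.1 p.2) ->
  continuous (fun p : R * R => f' p.1 p.2) ->
  (forall (z y : R), a <= y <= b -> is_derive z 1 (f^~ y) (f' z y)) ->
  is_derive x 1 (fun x => Int a b (f x)) (Int a b (f' x)).
Proof.
move=> ab cf cf' H.
have cfx q : continuous (f q) by ctn.
have cfx' q : continuous (f' q) by ctn.
(* On []x - d, x + d[] the derivative stays within 1 of its values at [x], so [|f' x y| + 1] serves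
   as dominating function. *)
have [d /= d0 N] := @tube_norm _ a b x f' _ ltr01 cf'.
have xI : `]x - d, x + d[%classic x by rewrite /= in_itv/= ltrBlDr !ltrDl d0.
have mB : measurable (`[a, b]%classic : set (measurableTypeR R)) by [].
have H1 (z : R) : `]x - d, x + d[%classic z -> mu.-integrable `[a, b] (EFin \o f z).
  by move=> _; exact: Int_int.
have H2 (z y : R) : `]x - d, x + d[%classic z -> `[a, b]%classic y -> derivable (f^~ y) z 1.
  by move=> _ /=; rewrite in_itv/= => /(H z) [].
have cG : continuous (fun y => `|f' x y| + 1) by ctn; exact: cfx'.
have H3 (z y : R) : `]x - d, x + d[%classic z -> `[a, b]%classic y ->
    `|partial1of2 f z y| <= `|f' x y| + 1.
  rewrite /= !in_itv/= => zd yab; rewrite partial1of2E (@derive_val _ _ _ _ _ _ _ (H z y yab)).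
  have /ltW h : `|f' z y - f' x y| < 1.
    by apply: N => //; rewrite /ball_/= ltr_norml; apply/andP; lra.
  by rewrite -lerBlDl; exact: le_trans (lerB_dist _ _) h.
have G0 y : 0 <= `|f' x y| + 1 by rewrite addr_ge0.
apply: DeriveDef.
  exact: (@derivable_under_integral _ _ _ _ _ _ mB _ _ _ xI H1 H2 _ G0 (Int_int _ _ cG) H3).
rewrite -derive1E (@differentiation_under_integral _ _ _ _ _ _ mB _ _ _ xI H1 H2 _ G0 (Int_int _ _ cG) H3).
apply: eq_Int => y yab; rewrite partial1of2E; exact: (@derive_val _ _ _ _ _ _ _ (H x y yab)).
Qed.
End Int.

Section Int2.
Context {R : realType}.
Implicit Types (f g F : R -> R) (a b k : R).
Local Notation mu := (@lebesgue_measure R).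

Lemma Int_FTC2 F f a b : a <= b -> continuous f -> {within `[a, b], continuous F} ->
  (forall x : R, a < x < b -> is_derive x 1 F (f x)) ->
  Int a b f = F b - F a.
Proof.
rewrite le_eqVlt => /predU1P[->|ab] cf cF H.
  rewrite subrr; apply/eqP; rewrite -normr_le0.
  have /(_ `|f b|) := @Int_bound R f b b _ (lexx _) cf.
  rewrite subrr mulr0; apply => x xb.
  by have -> : x = b by apply/le_anti; rewrite andbC.
rewrite /Int /Rintegral (@continuous_FTC2 _ f F) //.
- exact: continuous_subspaceT.
- have [_ cFa cFb] := (continuous_within_itvP F ab).1 cF.
  split => // x; rewrite in_itv/= => /H; exact: @ex_derive.
- by move=> x; rewrite in_itv/= => /H; rewrite derive1E => h; rewrite derive_val.
Qed.

Lemma derive_within F (f : R -> R) a b :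
  (forall x : R, a <= x <= b -> is_derive x 1 F (f x)) -> {within `[a, b], continuous F}.
Proof.
move=> H; apply: derivable_within_continuous => x; rewrite in_itv/= => /H; exact: @ex_derive.
Qed.

Lemma Int_FTC F f a b : a <= b -> continuous f ->
  (forall x : R, a <= x <= b -> is_derive x 1 F (f x)) ->
  Int a b f = F b - F a.
Proof.
move=> ab cf H; apply: Int_FTC2 => //; first exact: derive_within H.
by move=> x /andP[ax xb]; apply: H; rewrite !ltW.
Qed.

Lemma Int_FTC1 f a (x : R) : continuous f -> a < x ->
  is_derive x 1 (fun x => Int a x f) (f x).
Proof.
move=> cf ax.
have xx1 : x < x + 1 by rewrite ltrDl.
have [D E] := continuous_FTC1_closed xx1 (Int_int _ _ cf) ax (cf x).
have := DeriveDef D (etrans (esym (derive1E _ _)) E); exact.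
Qed.

Lemma antiderivative f a : continuous f ->
  exists F, forall x : R, a <= x -> is_derive x 1 F (f x).
Proof.
(* Starting the integral at [a - 1] makes [a] an interior point, so that the derivative there is
   two-sided. *)
move=> cf; exists (fun x => Int (a - 1) x f) => x ax; apply: Int_FTC1 => //; lra.
Qed.

(** Both sides are increments of one primitive of [f]. That primitive is differentiable from [g a]
    on, and the last hypothesis keeps the values of [g] in this range. *)
Lemma Int_subst f g (g' : R -> R) a b : a <= b -> continuous f -> continuous g ->
  continuous g' ->
  (forall x : R, is_derive x 1 g (g' x)) ->
  (forall x, a <= x <= b -> g a <= g x) ->
  Int (g a) (g b) f = Int a b (fun x => f (g x) * g' x).
Proof.
move=> ab cf cg cg' dg gle.
have [F HF] := @antiderivative f (g a) cf.
have gab : g a <= g b by apply: gle; rewrite lexx ab.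
have cfg : continuous (fun x => f (g x) * g' x) by ctn.
have H1 (x : R) : g a <= x <= g b -> is_derive x 1 F (f x) by case/andP => + _; exact: HF.
have H2 (x : R) : a <= x <= b -> is_derive x 1 (F \o g) (f (g x) * g' x).
  by move=> xab; apply: is_derive1_comp; exact/HF/gle.
by rewrite (Int_FTC gab cf H1) (Int_FTC ab cfg H2).
Qed.

Lemma Int_opp f L : 0 <= L -> continuous f ->
  Int (- L) L (fun x => f (- x)) = Int (- L) L f.
Proof.
move=> L0 cf.
have LL : - L <= L by lra.
have [F HF] := @antiderivative f (- L) cf.
have H1 (x : R) : - L <= x <= L -> is_derive x 1 F (f x) by case/andP => + _; exact: HF.
have cfN : continuous (fun x => f (- x)) by ctn.
have H2 (x : R) : - L <= x <= L -> is_derive x 1 (fun x => - F (- x)) (f (- x)).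
  move=> xab; have HF' : is_derive (- x) 1 F (f (- x)) by apply: HF; case/andP: xab; lra.
  have := is_deriveN (is_derive1_comp HF' (is_deriveNid x 1)).
  by move/is_derive_eq; apply; rewrite mulrN1 opprK.
by rewrite (Int_FTC LL cf H1) (Int_FTC LL cfN H2) !opprK addrC.
Qed.

Lemma Int_shift f a b k : a <= b -> continuous f ->
  Int a b (fun x => f (k + x)) = Int (k + a) (k + b) f.
Proof.
move=> ab cf.
have ck : continuous (fun x : R => k + x) by ctn.
have dk (x : R) : is_derive x 1 (fun x => k + x) 1.
  by have := is_deriveD (is_derive_cst k x 1) (is_derive_id x 1); rewrite add0r.
have le (x : R) : a <= x <= b -> k + a <= k + x by case/andP => ax _; rewrite lerD2l.
have c1' : continuous (fun _ : R => 1 : R) by ctn.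
rewrite (Int_subst ab cf ck c1' dk le).
by apply: eq_Int => x _; rewrite mulr1.
Qed.

Lemma Int_split f a b k : a <= b -> b <= k -> continuous f ->
  Int a k f = Int a b f + Int b k f.
Proof.
move=> ab bk cf; have [F HF] := @antiderivative f a cf.
have H c d : a <= c -> c <= d -> Int c d f = F d - F c.
  by move=> ac cd; apply: Int_FTC => // x /andP[cx _]; apply: HF; lra.
by rewrite !H//; [lra|exact: le_trans bk].
Qed.

Local Notation mu2 := (mu \x mu)%E.

(** The sigma-algebra here is generated by rectangles, so continuity does not give measurability at
    once. Rounding the first coordinate down to a multiple of [1 / (n + 1)] makes preimages
    countable unions of rectangles, and [f] is the pointwise limit of the rounded functions. *)
Lemma cont_measurable2 (f : R * R -> R) : continuous f ->
  measurable_fun [set: (measurableTypeR R * measurableTypeR R)%type] f.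
Proof.
move=> cf.
pose h n (p : R * R) := f ((Num.floor (n.+1%:R * p.1))%:~R / n.+1%:R, p.2).
have n0 n : 0 < n.+1%:R :> R by [].
apply: (@measurable_realfun.measurable_fun_cvg _ _ _ _ h).
- move=> n _ /= B mB; rewrite setTI.
  have -> : h n @^-1` B = \bigcup_(z : int)
     (`[z%:~R / n.+1%:R, (z + 1)%:~R / n.+1%:R[ `*` ((fun y => f (z%:~R / n.+1%:R, y)) @^-1` B)).
    apply/seteqP; split => [[x y] /= Bh|[x y] [z _ [/=]]].
      exists (Num.floor (n.+1%:R * x)) => //; split => //=.
      by rewrite in_itv/= ler_pdivrMr// ltr_pdivlMr// mulrC floor_le floorD1_gt.
    rewrite in_itv/= ler_pdivrMr// ltr_pdivlMr// /h /= => /andP[zx xz] By.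
    by rewrite (@floor_def _ _ z)// mulrC zx.
  apply: countable_bigcupT_measurable => // z.
  apply: measurableX => //=.
  have cz : continuous (fun y : R => f (z%:~R / n.+1%:R, y)).
    by ctn.
  by have := measurable_realfun.continuous_measurable_fun cz measurableT mB; rewrite setTI.
- suff H (x y : R) : h n (x, y) @[n --> \oo] --> f (x, y) by move=> [x y] _; exact: H.
  rewrite /h /=.
  suff hx : (Num.floor (n.+1%:R * x))%:~R / n.+1%:R @[n --> \oo] --> (x : R).
    have hp : ((Num.floor (n.+1%:R * x))%:~R / n.+1%:R, y) @[n --> \oo] --> (x, y).
      exact: (@cvg_pair nat R R \oo (nbhs x) (nbhs y) _ _ _ _ _ hx (cvg_cst y)).
    exact: (cvg_comp _ _ hp (cf (x, y))).
  apply/cvgrPdist_le => e e0; near=> n.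
  rewrite -(ler_pM2l (n0 n)) -{1}(gtr0_norm (n0 n)) -normrM mulrBr mulrCA divff ?mulr1 ?gt_eqF//.
  rewrite ger0_norm ?subr_ge0 ?floor_le//.
  apply: (@le_trans _ _ 1); first by rewrite lerBlDl -intrD1 ltW// floorD1_gt.
  rewrite -ler_pdivrMl// mulr1 ltW//; near: n; exact: (near_infty_natSinv_lt (PosNum e0)).
Unshelve. all: by end_near. Qed.
End Int2.

Section Fubini.
Context {R : realType}.
Local Notation mu := (@lebesgue_measure R).
Local Notation mu2 := (mu \x mu)%E.

Definition box (a b c d : R) : set (measurableTypeR R * measurableTypeR R) :=
  `[a, b]%classic `*` `[c, d]%classic.

Lemma measurable_box a b c d : measurable (box a b c d).
Proof. exact: measurableX. Qed.

Lemma box_measure a b c d : (mu2 (box a b c d) < +oo)%E.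
Proof.
rewrite product_measure1E//=.
by rewrite !lebesgue_measure_itv/=; case: ifP => _; case: ifP => _; rewrite -?EFinB ?mul0e ?mule0 ?ltry.
Qed.

Lemma bounded_integrable2 (f : R * R -> R) (E : set (measurableTypeR R * measurableTypeR R)) a b c d k :
  measurable E -> E `<=` box a b c d ->
  measurable_fun E f -> (forall p, E p -> `|f p| <= k) ->
  mu2.-integrable E (EFin \o f).
Proof.
move=> mE EB mf fk.
apply: (@measurable_bounded_integrable _ _ _ mu2 f E mE) => //.
  apply: (le_lt_trans _ (box_measure a b c d)).
  by rewrite le_measure ?inE//; exact: measurable_box.
exists k; split; first exact: num_real.
by move=> x kx p Ep; exact: (le_trans (fk _ Ep) (ltW kx)).
Qed.

Lemma Rintegral_box (f : R * R -> R) a b c d k :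
  continuous f -> (forall p, box a b c d p -> `|f p| <= k) -> a <= b -> c <= d ->
  (\int[mu2]_(p in box a b c d) f p = Int a b (fun x => Int c d (fun y => f (x, y)))) /\
  (\int[mu2]_(p in box a b c d) f p = Int c d (fun y => Int a b (fun x => f (x, y)))).
Proof.
move=> cf fk ab cd.
have mf := measurable_funTS (D := box a b c d) (cont_measurable2 cf).
have If := bounded_integrable2 (measurable_box _ _ _ _) (@subset_refl _ _) mf fk.
have mB := measurable_box a b c d.
pose F := ((EFin \o f) \_ (box a b c d)).
have IF : mu2.-integrable setT F.
  by apply/(integrable_restrict _ mB); rewrite ?setTI.
have -> : \int[mu2]_(p in box a b c d) f p = fine (\int[mu2]_p F p)%E.
  by rewrite /Rintegral [in LHS]integral_mkcond.
have cx (x : R) : continuous (fun y : R => f (x, y)) by ctn.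
have cy (y : R) : continuous (fun x : R => f (x, y)) by ctn.
split.
  rewrite -(integral12_prod_meas1 IF) /Int [RHS]Rintegral_mkcond.
  congr fine; apply: eq_integral => x _ /=.
  rewrite patchE; case: ifPn => [|/negP] /[!inE] /= xab.
    rewrite /Rintegral fineK; last exact: (integrable_fin_num _ (Int_int c d (cx x))).
    rewrite /fubini_F [RHS]integral_mkcond; apply: eq_integral => y _.
    by rewrite /F !patchE/= /box in_setX/= mem_set//= .
  rewrite /fubini_F integral0_eq// => y _; rewrite /F patchE /box in_setX/=.
  by rewrite memNset.
rewrite -(integral21_prod_meas1 IF) /Int [RHS]Rintegral_mkcond.
congr fine; apply: eq_integral => y _ /=.
rewrite patchE; case: ifPn => [|/negP] /[!inE] /= yab.
  rewrite /Rintegral fineK; last exact: (integrable_fin_num _ (Int_int a b (cy y))).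
  rewrite /fubini_G [RHS]integral_mkcond; apply: eq_integral => x _.
  by rewrite /F !patchE/= /box in_setX/= (@mem_set _ `[c, d]%classic y yab) andbT.
rewrite /fubini_G integral0_eq// => x _; rewrite /F patchE /box in_setX/=.
by rewrite (@memNset _ `[c, d]%classic y yab) andbF.
Qed.

Lemma cont_bound (f : R -> R) a b : continuous f ->
  exists2 k, 0 <= k & forall x, a <= x <= b -> `|f x| <= k.
Proof.
move=> cf; have [ab|ba] := leP a b; last first.
  by exists 0 => // x /andP[ax xb]; move: (le_lt_trans (le_trans ax xb) ba); rewrite ltxx.
have [c _ H] := EVT_max ab (continuous_subspaceT (cont_norm cf)).
by exists `|f c| => // x xab; apply: H; rewrite in_itv.
Qed.

Lemma cont_bound2 (f : R -> R -> R) a b c d : continuous (fun p => f p.1 p.2) ->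
  exists2 k, 0 <= k & forall x y, a <= x <= b -> c <= y <= d -> `|f x y| <= k.
Proof.
move=> cf.
have [ab|ba] := leP a b; last first.
  by exists 0 => // x y /andP[ax xb]; move: (le_lt_trans (le_trans ax xb) ba); rewrite ltxx.
have [cd|dc] := leP c d; last first.
  by exists 0 => // x y _ /andP[ax xb]; move: (le_lt_trans (le_trans ax xb) dc); rewrite ltxx.
have [|||p _ H] := @compact_EVT_max _ R (fun p => `|f p.1 p.2|) (`[a, b]%classic `*` `[c, d]%classic).
- by exists (a, c); split; rewrite /= in_itv/= lexx.
- by apply: compact_setX; exact: segment_compact.
- exact/continuous_subspaceT/cont_norm.
exists `|f p.1 p.2| => // x y xab ycd; apply: (H (x, y)).
by rewrite inE; split; rewrite /= in_itv.
Qed.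

Lemma Int_swap (f : R -> R -> R) a b c d : a <= b -> c <= d ->
  continuous (fun p => f p.1 p.2) ->
  Int a b (fun x => Int c d (f x)) = Int c d (fun y => Int a b (f^~ y)).
Proof.
move=> ab cd cf; have [k _ fk] := @cont_bound2 f a b c d cf.
have [|<- <- //] := @Rintegral_box (fun p => f p.1 p.2) a b c d k cf _ ab cd.
by move=> [x y] [/=]; rewrite !in_itv/=; exact: fk.
Qed.
End Fubini.

Section derivatives.
Context {R : realType}.
Implicit Types (f g : R -> R) (x a b : R).
Lemma derC x (k : R) : is_derive x 1 (fun _ : R => k) 0.
Proof. exact: is_derive_cst. Qed.
Lemma derI x : is_derive x 1 (fun x : R => x) 1.
Proof. exact: is_derive_id. Qed.
Lemma derD f g x a b : is_derive x 1 f a -> is_derive x 1 g b ->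
  is_derive x 1 (fun x => f x + g x) (a + b).
Proof. by move=> *; exact: is_deriveD. Qed.
Lemma derB f g x a b : is_derive x 1 f a -> is_derive x 1 g b ->
  is_derive x 1 (fun x => f x - g x) (a - b).
Proof. by move=> *; exact: is_deriveB. Qed.
Lemma derN f x a : is_derive x 1 f a -> is_derive x 1 (fun x => - f x) (- a).
Proof. by move=> *; exact: is_deriveN. Qed.
Lemma derM f g x a b : is_derive x 1 f a -> is_derive x 1 g b ->
  is_derive x 1 (fun x => f x * g x) (a * g x + f x * b).
Proof.
move=> df dg; have := is_deriveM df dg; move/is_derive_eq; apply.
by transitivity (f x * b + g x * a) => //; ring.
Qed.
Lemma derX f n x a : is_derive x 1 f a ->
  is_derive x 1 (fun x => f x ^+ n) (n%:R * f x ^+ n.-1 * a).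
Proof. by move=> df; have := is_deriveX n df; rewrite exprfctE. Qed.
Lemma der_sqr f x a : is_derive x 1 f a -> is_derive x 1 (fun x => f x ^+ 2) (2 * f x * a).
Proof. exact: derX. Qed.
Lemma derV f x a : f x != 0 -> is_derive x 1 f a ->
  is_derive x 1 (fun x => (f x)^-1) (- a / f x ^+ 2).
Proof.
move=> f0 df; have := is_deriveV f0 df; move/is_derive_eq; apply.
by transitivity (- f x ^- 2 * a) => //; rewrite -exprVn; ring.
Qed.
Lemma der_comp g f x a b : is_derive (f x) 1 g b -> is_derive x 1 f a ->
  is_derive x 1 (fun x => g (f x)) (b * a).
Proof. exact: is_derive1_comp. Qed.
Lemma der_sin f x a : is_derive x 1 f a -> is_derive x 1 (fun x => sin (f x)) (cos (f x) * a).
Proof. by move=> df; apply: der_comp (is_derive_sin _) df. Qed.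
Lemma der_cos f x a : is_derive x 1 f a -> is_derive x 1 (fun x => cos (f x)) (- sin (f x) * a).
Proof. by move=> df; apply: der_comp (is_derive_cos _) df. Qed.
Lemma der_expR f x a : is_derive x 1 f a -> is_derive x 1 (fun x => expR (f x)) (expR (f x) * a).
Proof. by move=> df; apply: der_comp (is_derive_expR _) df. Qed.
Lemma der_atan f x a : is_derive x 1 f a ->
  is_derive x 1 (fun x => atan (f x)) ((1 + f x ^+ 2)^-1 * a).
Proof. by move=> df; apply: der_comp (is_derive1_atan _) df. Qed.
Lemma der_ln f x a : 0 < f x -> is_derive x 1 f a ->
  is_derive x 1 (fun x => ln (f x)) ((f x)^-1 * a).
Proof. by move=> f0 df; apply: der_comp (is_derive1_ln f0) df. Qed.
Lemma der_sqrt f x a : 0 < f x -> is_derive x 1 f a ->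
  is_derive x 1 (fun x => Num.sqrt (f x)) ((2 * Num.sqrt (f x))^-1 * a).
Proof. by move=> f0 df; apply: der_comp (is_derive1_sqrt f0) df. Qed.
Lemma der_eq f x a b : is_derive x 1 f a -> a = b -> is_derive x 1 f b.
Proof. by move=> h <-. Qed.
End derivatives.

Ltac der1 := first [ eassumption | lazymatch goal with
  | |- is_derive _ _ (fun _ => ?k) _ => notypeclasses refine (derC _ _)
  | |- is_derive _ _ (fun x => x) _ => notypeclasses refine (derI _)
  | |- is_derive _ _ (fun x => @?f x - @?g x) _ => notypeclasses refine (@derB _ f g _ _ _ _ _); der1
  | |- is_derive _ _ (fun x => @?f x + @?g x) _ => notypeclasses refine (@derD _ f g _ _ _ _ _); der1
  | |- is_derive _ _ (fun x => - @?f x) _ => notypeclasses refine (@derN _ f _ _ _); der1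
  | |- is_derive _ _ (fun x => @?f x * @?g x) _ => notypeclasses refine (@derM _ f g _ _ _ _ _); der1
  | |- is_derive _ _ (fun x => @?f x ^+ 2) _ => notypeclasses refine (@der_sqr _ f _ _ _); der1
  | |- is_derive _ _ (fun x => @?f x ^+ ?n) _ => notypeclasses refine (@derX _ f n _ _ _); der1
  | |- is_derive _ _ (fun x => (@?f x)^-1) _ => notypeclasses refine (@derV _ f _ _ _ _); [|der1]
  | |- is_derive _ _ (fun x => sin (@?f x)) _ => notypeclasses refine (@der_sin _ f _ _ _); der1
  | |- is_derive _ _ (fun x => cos (@?f x)) _ => notypeclasses refine (@der_cos _ f _ _ _); der1
  | |- is_derive _ _ (fun x => expR (@?f x)) _ => notypeclasses refine (@der_expR _ f _ _ _); der1
  | |- is_derive _ _ (fun x => atan (@?f x)) _ => notypeclasses refine (@der_atan _ f _ _ _); der1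
  | |- is_derive _ _ (fun x => ln (@?f x)) _ => notypeclasses refine (@der_ln _ f _ _ _ _); [|der1]
  | |- is_derive _ _ (fun x => Num.sqrt (@?f x)) _ => notypeclasses refine (@der_sqrt _ f _ _ _ _); [|der1]
  | |- is_derive _ _ (fun x => ?g (@?f x)) _ =>
     lazymatch goal with
     | H : is_derive _ _ g _ |- _ => notypeclasses refine (@der_comp _ g f _ _ _ H _); der1
     | H : forall z, is_derive z _ g _ |- _ => notypeclasses refine (@der_comp _ g f _ _ _ (H _) _); der1
     end
  end ].
Ltac der := notypeclasses refine (@der_eq _ _ _ _ _ _ _); [der1 | cbn beta].

(** * Spherical mean of a plane wave *)

Section sphere.
Context {R : realType}.
Variables (Y k : R).
Hypotheses (Y0 : 0 < Y) (k0 : 0 < k).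
Let P : R := pi / 2.
Let w (m : R) := Num.sqrt (k ^+ 2 + m ^+ 2).

Let P0 : - P <= P.
Proof. by have := pi_ge0 R; rewrite /P; lra. Qed.
Let kk m : 0 < k ^+ 2 + m ^+ 2.
Proof. by rewrite ltr_wpDr ?sqr_ge0 ?exprn_gt0. Qed.
Let w0 m : 0 < w m.
Proof. by rewrite sqrtr_gt0. Qed.
Let cw : continuous w.
Proof. by rewrite /w; ctn. Qed.

(** Value of [cos (w t) exp (m z)] at the point [Y (sin p, cos p sin s, cos p cos s)] of a
    half-sphere, with [t] and [z] the first two coordinates, times the area density [cos p]. This
    wave is an eigenfunction of the Laplacian for [m^2 - w^2 = - k^2], whatever [m] is. *)
Let f (m p s : R) := cos p * cos (w m * (Y * sin p)) * expR (m * (Y * cos p * sin s)).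
Let f' (m p s : R) := (w m)^-1 * (cos p * (Y * cos p * sin s * w m * cos (w m * (Y * sin p)) -
   Y * sin p * m * sin (w m * (Y * sin p))) * expR (m * (Y * cos p * sin s))).
(** [Pp] is a [p]-derivative and [Qs] an [s]-derivative of functions carrying a factor [cos p],
    respectively [cos s], which vanishes at both ends; their sum is [w * f']. *)
Let Pp (m p s : R) := - sin p * sin s * (sin (w m * (Y * sin p)) * expR (m * (Y * cos p * sin s)))
  + cos p * sin s * ((w m * Y * cos p * cos (w m * (Y * sin p)) - m * Y * sin p * sin s * sin (w m * (Y * sin p)))
     * expR (m * (Y * cos p * sin s))).
Let Qs (m p s : R) := sin p * sin s * (sin (w m * (Y * sin p)) * expR (m * (Y * cos p * sin s)))
  - sin p * cos s * (m * Y * cos p * cos s * sin (w m * (Y * sin p)) * expR (m * (Y * cos p * sin s))).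

Let S m := Int (- P) P (fun p => Int (- P) P (f m p)).

Let dS (m : R) : is_derive m 1 S 0.
Proof.
have cf : continuous (fun q : R * R * R => f q.1.1 q.1.2 q.2) by rewrite /f; ctn.
have cf' : continuous (fun q : R * R * R => f' q.1.1 q.1.2 q.2).
  by rewrite /f'; ctn => q; rewrite gt_eqF.
have cPp : continuous (fun q : R * R => Pp m q.1 q.2) by rewrite /Pp; ctn.
have cQs : continuous (fun q : R * R => Qs m q.1 q.2) by rewrite /Qs; ctn.
have cfi : continuous (fun q : R * R => Int (- P) P (f q.1 q.2)).
  by apply: (@cont_Int _ _ (fun q s => f q.1 q.2 s)) => //; ctn.
have cfi' : continuous (fun q : R * R => Int (- P) P (f' q.1 q.2)).
  by apply: (@cont_Int _ _ (fun q s => f' q.1 q.2 s)) => //; ctn.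
have dw (z : R) : is_derive z 1 w (z / w z).
  by have := w0 z; rewrite /w => w0z; der => //; field; rewrite gt_eqF.
apply: (@der_eq _ _ _ (Int (- P) P (fun p => Int (- P) P (f' m p)))).
  apply: (@is_derive_Int _ (fun z p => Int (- P) P (f z p)) (fun z p => Int (- P) P (f' z p))) => // z p _.
  have cfp : continuous (fun q : R * R => f q.1 p q.2) by ctn.
  have cfp' : continuous (fun q : R * R => f' q.1 p q.2) by ctn.
  apply: (@is_derive_Int _ (fun z s => f z p s) (fun z s => f' z p s)) => //.
  move=> {}z s _; have dwz := dw z; rewrite /f /f'; der.
  by field; rewrite gt_eqF.
transitivity ((w m)^-1 * (Int (- P) P (fun p => Int (- P) P (Pp m p)) +
                          Int (- P) P (fun p => Int (- P) P (Qs m p)))).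
  have cp1 : continuous (fun p => Int (- P) P (Pp m p)) by apply: (@cont_Int _ _ (Pp m)).
  have cq1 : continuous (fun p => Int (- P) P (Qs m p)) by apply: (@cont_Int _ _ (Qs m)).
  rewrite -IntD// -IntZ//; last by ctn.
  apply: eq_Int => p _.
  have cpp : continuous (Pp m p) by ctn.
  have cqq : continuous (Qs m p) by ctn.
  rewrite -IntD// -IntZ//; last by ctn.
  apply: eq_Int => s _; rewrite /f' /Pp /Qs.
  congr (_ * _).
  have cs : sin s ^+ 2 = 1 - cos s ^+ 2 by rewrite -(cos2Dsin2 s); ring.
  transitivity ((cos p * (Y * cos p * sin s * w m * cos (w m * (Y * sin p))) -
     cos p * Y * sin p * m * (sin s ^+ 2 + cos s ^+ 2) * sin (w m * (Y * sin p))) * expR (m * (Y * cos p * sin s))).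
    by rewrite cs; ring.
  by ring.
have -> : Int (- P) P (fun p => Int (- P) P (Qs m p)) = 0.
  rewrite -[RHS](Int0 (- P) P); apply: eq_Int => p _.
  have cq : continuous (Qs m p) by ctn.
  have dq (s : R) : - P <= s <= P -> is_derive s 1
      (fun s => - (sin p * cos s * (sin (w m * (Y * sin p)) * expR (m * (Y * cos p * sin s))))) (Qs m p s).
    by move=> _; rewrite /Qs; der; ring.
  by rewrite (Int_FTC P0 cq dq) cosN cos_pihalf; ring.
rewrite Int_swap//.
rewrite (_ : Int _ _ _ = 0) ?addr0 ?mulr0//.
rewrite -[RHS](Int0 (- P) P); apply: eq_Int => s _.
have cq : continuous (Pp m^~ s) by ctn.
have dq (p : R) : - P <= p <= P -> is_derive p 1
    (fun p => cos p * sin s * (sin (w m * (Y * sin p)) * expR (m * (Y * cos p * sin s)))) (Pp m p s).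
  by move=> _; rewrite /Pp; der; ring.
by rewrite (Int_FTC P0 cq dq) cosN cos_pihalf; ring.
Qed.

(** The mean does not depend on [m], since its derivative is the integral of a divergence without
    boundary terms; at [m = 0] the integrand is free of [s] and has an elementary primitive in
    [p]. *)
Lemma sphere_mode m :
  Int (- (pi / 2)) (pi / 2) (fun p => Int (- (pi / 2)) (pi / 2) (fun s =>
   cos p * cos (Num.sqrt (k ^+ 2 + m ^+ 2) * (Y * sin p)) * expR (m * (Y * cos p * sin s))))
  = 2 * pi * (sin (k * Y) / (k * Y)).
Proof.
transitivity (S m); first by [].
rewrite (is_derive_0_is_cst m 0 dS) /S /f /w expr0n/= addr0 sqrtr_sqr gtr0_norm//.
transitivity (Int (- P) P (fun p => pi * (cos p * cos (k * (Y * sin p))))).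
  apply: eq_Int => p _.
  transitivity (Int (- P) P (fun=> cos p * cos (k * (Y * sin p)))).
    by apply: eq_Int => s _; rewrite mul0r expR0 mulr1.
  by rewrite Int_cst// /P mulrC; congr (_ * _); lra.
rewrite IntZ; last by ctn.
have cq : continuous (fun p => cos p * cos (k * (Y * sin p))) by ctn.
have dq (p : R) : - P <= p <= P -> is_derive p 1
    (fun p => sin (k * (Y * sin p)) / (k * Y)) (cos p * cos (k * (Y * sin p))).
  by move=> _; der; field; rewrite !gt_eqF.
rewrite (Int_FTC P0 cq dq) sinN sin_pihalf !mulrN !mulr1 sinN; lra.
Qed.
End sphere.

(** * A singularly perturbed ordinary differential equation *)

Section ode.
Context {R : realType}.
Implicit Types (f df F : R -> R) (a b h k : R).

Lemma mvt_bound f df a b (C : R) : a <= b ->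
  (forall x : R, a <= x <= b -> is_derive x 1 f (df x)) ->
  (forall x, a <= x <= b -> `|df x| <= C) -> `|f b - f a| <= C * (b - a).
Proof.
move=> ab H HC.
have [|c cab ->] := @MVT_segment R f df a b ab _ (derive_within H).
  by move=> x /subset_itv_oo_cc; rewrite in_itv/=; exact: H.
by rewrite normrM (ger0_norm (_ : 0 <= b - a)) ?subr_ge0// ler_wpM2r ?subr_ge0// HC// -in_itv.
Qed.

Lemma le_of_derive_le f df a b (C : R) : a <= b ->
  (forall x : R, a <= x <= b -> is_derive x 1 f (df x)) ->
  (forall x, a <= x <= b -> df x <= C) -> f b - f a <= C * (b - a).
Proof.
move=> ab H HC.
have [|c cab ->] := @MVT_segment R f df a b ab _ (derive_within H).
  by move=> x /subset_itv_oo_cc; rewrite in_itv/=; exact: H.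
by rewrite ler_wpM2r ?subr_ge0// HC// -in_itv.
Qed.

Lemma expR_lip a b M : a <= M -> b <= M -> `|expR a - expR b| <= expR M * `|a - b|.
Proof.
wlog ab : a b / a <= b.
  move=> H aM bM; have [/H|/ltW/H] := leP a b; first exact.
  by rewrite distrC (distrC a); apply.
move=> _ bM; rewrite distrC (distrC a) (ger0_norm (_ : 0 <= b - a)) ?subr_ge0//.
apply: (@mvt_bound expR expR) => // x /andP[_ xb].
 rewrite gtr0_norm ?expR_gt0// ler_expR; exact: le_trans bM.
Qed.

Variables (F F1 F2 r : R -> R) (h kap Y rho : R).
Hypotheses (h0 : 0 < h) (Y0 : 0 < Y).
Hypothesis dF : forall s : R, 0 <= s <= Y -> is_derive s 1 F (F1 s).
Hypothesis dF1 : forall s : R, 0 <= s <= Y -> is_derive s 1 F1 (F2 s).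
Hypothesis Fode : forall s : R, 0 <= s <= Y -> h * F2 s + F1 s - kap * F s = r s.
Hypothesis rrho : forall s : R, 0 <= s <= Y -> `|r s| <= rho.

Let rho0 : 0 <= rho.
Proof. by apply: (le_trans (normr_ge0 (r 0))); apply: rrho; rewrite lexx ltW. Qed.

(** The operator factors as [h (d/ds - mu) (d/ds + nu)], which leaves two first-order equations, the
    first one for [G = F' + nu F]. The amplitude [al] belongs to the solution [exp (mu s)], and [E]
    bounds the propagator of the first factor run backwards. *)
Lemma ode_factor mu nu E : nu = mu + h^-1 -> kap = h * mu * nu -> 0 <= nu ->
  0 < mu + nu ->
  (forall s t, 0 <= s -> s <= t -> t <= Y -> expR (mu * (s - t)) <= E) ->
  exists2 al : R, `|al - (F1 0 + nu * F 0) / (mu + nu)| <= E * (rho * Y / h) / (mu + nu) &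
   forall s : R, 0 <= s <= Y ->
    `|F s - (al * expR (mu * s) + (F 0 - al) * expR (- nu * s))| <= E * (rho * Y ^+ 2 / h).
Proof.
move=> nuE kapE nu0 mn0 HE.
pose G s := F1 s + nu * F s.
(* Anchoring [G] at the right end [Y] integrates the growing factor in its stable direction: forcing
   errors are multiplied by [exp (mu (s - t))] with [s <= t] only. *)
pose Gi := G Y * expR (- mu * Y).
have dG (s : R) : 0 <= s <= Y ->
    is_derive s 1 (fun s => G s * expR (- mu * s)) (expR (- mu * s) * (r s / h)).
  move=> sY; have d0 := dF sY; have d1' := dF1 sY; rewrite /G; der.
  rewrite -Fode// kapE nuE; field; by rewrite gt_eqF.
have E0 : 0 <= E.
  by apply: le_trans (HE 0 0 (lexx _) (lexx _) (ltW Y0)); exact: expR_ge0.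
have HG s : 0 <= s <= Y -> `|G s - Gi * expR (mu * s)| <= E * (rho * Y / h).
  move=> /andP[s0 sY].
  have : `|Gi - G s * expR (- mu * s)| <= (E * expR (- mu * s) * (rho / h)) * (Y - s).
    apply: (@mvt_bound (fun s => G s * expR (- mu * s)) _ _ _ _ sY) => x /andP[sx xY].
      by apply: dG; rewrite xY (le_trans s0 sx).
    rewrite normrM gtr0_norm ?expR_gt0//; apply: ler_pM; rewrite ?expR_ge0 ?normr_ge0//.
      rewrite -ler_pdivrMr ?expR_gt0// -expRN -expRD.
      have -> : - mu * x - - mu * s = mu * (s - x) by ring.
      exact: HE.
    by rewrite normrM (gtr0_norm (_ : 0 < h^-1)) ?invr_gt0// ler_pM2r ?invr_gt0// rrho// xY (le_trans s0 sx).
  rewrite -(ler_pM2r (expR_gt0 (mu * s))) => H.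
  rewrite distrC.
  have e1 : expR (- mu * s) * expR (mu * s) = 1 by rewrite -expRD mulNr addNr expR0.
  have -> : Gi * expR (mu * s) - G s = (Gi - G s * expR (- mu * s)) * expR (mu * s).
    by rewrite mulrBl -(mulrA (G s)) e1 mulr1.
  rewrite normrM (gtr0_norm (expR_gt0 _)); apply: (le_trans H).
  rewrite [X in X <= _](_ : _ = E * (rho * (Y - s) / h) * (expR (- mu * s) * expR (mu * s))); last by ring.
  rewrite e1 mulr1 ler_wpM2l// ler_wpM2r ?invr_ge0 ?(ltW h0)// ler_wpM2l//; lra.
exists (Gi / (mu + nu)).
  rewrite -mulrBl normrM (gtr0_norm (_ : 0 < (mu + nu)^-1)) ?invr_gt0// ler_pM2r ?invr_gt0//.
  have := HG 0; rewrite lexx ltW//= mulr0 expR0 mulr1 distrC; exact.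
move=> s /andP[s0 sY]; set al := _ / _.
(* The second factor is damped, so it is integrated forwards from 0, where [g] vanishes. *)
pose g s := F s - (al * expR (mu * s) + (F 0 - al) * expR (- nu * s)).
have : `|g s * expR (nu * s) - g 0 * expR (nu * 0)| <= (expR (nu * s) * (E * (rho * Y / h))) * (s - 0).
  apply: (@mvt_bound (fun s => g s * expR (nu * s)) (fun s => expR (nu * s) * (G s - Gi * expR (mu * s)))) => //.
    move=> x /andP[x0 xs]; have xY : 0 <= x <= Y by rewrite x0 (le_trans xs).
    have d0 := dF xY; rewrite /g /G /al; der.
    by field; rewrite gt_eqF.
  move=> x /andP[x0 xs]; rewrite normrM gtr0_norm ?expR_gt0// ler_pM ?expR_ge0//.
    by rewrite ler_expR ler_wpM2l.
  by apply: HG; rewrite x0 (le_trans xs).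
rewrite {2}/g !mulr0 expR0 !mulr1 [al + _]addrC subrK subrr subr0 subr0.
rewrite normrM (gtr0_norm (expR_gt0 _)) mulrC -mulrA ler_pM2l ?expR_gt0// => H.
apply: (le_trans H).
rewrite [X in _ <= X](_ : _ = E * (rho * Y / h) * Y); last by ring.
by rewrite ler_wpM2l// mulr_ge0// divr_ge0 ?mulr_ge0 ?(ltW h0) ?(ltW Y0).
Qed.

(** For a negative coefficient the equation is a damped oscillator with energy [h F'^2 + k F^2]. The
    friction contributes [- 2 F'^2], which absorbs the forcing up to [r^2 / 2]. *)
Lemma ode_energy k s : 0 < k -> kap = - k -> 0 <= s <= Y ->
  k * F s ^+ 2 <= h * F1 0 ^+ 2 + k * F 0 ^+ 2 + rho ^+ 2 * Y / 2.
Proof.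
move=> k0 kapE /andP[s0 sY].
pose En s := h * F1 s ^+ 2 + k * F s ^+ 2.
have : En s - En 0 <= rho ^+ 2 / 2 * (s - 0).
  apply: (@le_of_derive_le En (fun s => 2 * F1 s * (r s - F1 s))) => //.
    move=> x /andP[x0 xs]; have xY : 0 <= x <= Y by rewrite x0 (le_trans xs).
    have d0 := dF xY; have d1' := dF1 xY; rewrite /En; der.
    by rewrite -Fode// kapE; ring.
  move=> x /andP[x0 xs]; have xY : 0 <= x <= Y by rewrite x0 (le_trans xs).
  have : r x ^+ 2 <= rho ^+ 2 by rewrite -real_normK ?num_real// ler_pXn2r ?nnegrE// rrho.
  by have := sqr_ge0 (r x - 2 * F1 x); nra.
rewrite /En subr0 => H.
have : 0 <= h * F1 s ^+ 2 by rewrite mulr_ge0 ?sqr_ge0// ltW.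
have : rho ^+ 2 / 2 * s <= rho ^+ 2 * Y / 2 by have := sqr_ge0 rho; nra.
by lra.
Qed.

(* The positive root of [h mu^2 + mu = k]: the growth rate replacing [k]. *)
Definition grow (h k : R) := (Num.sqrt (1 + 4 * h * k) - 1) / (2 * h).

Lemma growE h' k : 0 < h' -> 0 <= 1 + 4 * h' * k -> h' * grow h' k ^+ 2 + grow h' k = k.
Proof.
move=> h'0 H; rewrite /grow.
set q := Num.sqrt _; have : q ^+ 2 = 1 + 4 * h' * k by rewrite sqr_sqrtr.
move=> qE; apply/eqP; rewrite -subr_eq0; apply/eqP.
transitivity ((q ^+ 2 - 1 - 4 * h' * k) / (4 * h')); first by field; rewrite gt_eqF.
by rewrite qE (_ : _ - _ - _ = 0) ?mul0r//; ring.
Qed.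

Lemma grow_ge0 k : 0 <= k -> 0 <= grow h k.
Proof.
move=> k0; apply: divr_ge0; last by rewrite mulr_ge0// ltW.
rewrite subr_ge0 -[X in X <= _]sqrtr1 ler_sqrt.
  by rewrite lerDl !mulr_ge0// ltW.
by rewrite addr_ge0// !mulr_ge0// ltW.
Qed.

Lemma grow_le k : 0 <= k -> grow h k <= k.
Proof.
move=> k0; have H : 0 <= 1 + 4 * h * k by rewrite addr_ge0// !mulr_ge0// ltW.
by rewrite -[X in _ <= X](growE h0 H) lerDr mulr_ge0 ?sqr_ge0 ?(ltW h0).
Qed.

(** The constants are free of [kap]: as [mu] is nonnegative the propagator bound is 1, and as
    [mu + nu >= 1 / h] the quotient defining the amplitude leaves only a factor [h] in front of
    [F1 0] and cancels the [1 / h] of the forcing. *)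
Lemma ode_growth : 0 <= kap ->
  exists2 al : R, `|al| <= `|F 0| + h * `|F1 0| + rho * Y &
   forall s : R, 0 <= s <= Y ->
    `|F s - al * expR (grow h kap * s)| <= `|F 0| + `|al| + rho * Y ^+ 2 / h.
Proof.
move=> k0; set mu := grow h kap.
have mu0 : 0 <= mu by exact: grow_ge0.
have H : 0 <= 1 + 4 * h * kap by rewrite addr_ge0// !mulr_ge0// ltW.
pose nu := mu + h^-1.
have hi : 0 < h^-1 by rewrite invr_gt0.
have nu0 : 0 < nu by rewrite /nu; lra.
have mn : h^-1 <= mu + nu by rewrite /nu; lra.
have mn0 : 0 < mu + nu by lra.
have kE : kap = h * mu * nu.
  by rewrite -{1}(growE h0 H) -/mu /nu; field; rewrite gt_eqF.
have nuE : nu = mu + h^-1 by [].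
clearbody nu; clearbody mu.
have [|||||al al1 al2] := @ode_factor mu nu 1 => //.
- exact: ltW.
- move=> s t _ st _; by rewrite -expR0 ler_expR mulr_ge0_le0// subr_le0.
exists al.
  rewrite -(subrK ((F1 0 + nu * F 0) / (mu + nu)) al) addrC (le_trans (ler_normD _ _))//.
  apply: lerD.
    rewrite normrM (gtr0_norm (_ : 0 < (mu + nu)^-1)) ?invr_gt0// ler_pdivrMr//.
    have a1 : `|nu * F 0| <= `|F 0| * (mu + nu).
      by rewrite normrM (gtr0_norm nu0) mulrC ler_wpM2l//; lra.
    have a2 : `|F1 0| <= h * `|F1 0| * (mu + nu).
      rewrite mulrAC ler_peMl//.
      have : h * h^-1 <= h * (mu + nu) by rewrite ler_pM2l.
      by rewrite divff ?gt_eqF.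
    have a3 := ler_normD (F1 0) (nu * F 0); rewrite mulrDl; lra.
  apply: (le_trans al1); rewrite mul1r ler_pdivrMr// ler_wpM2l//; first by rewrite mulr_ge0// ltW.
move=> s sY; have := al2 s sY; rewrite mul1r => Hs.
have -> : F s - al * expR (mu * s) = (F s - (al * expR (mu * s) + (F 0 - al) * expR (- nu * s))) +
   (F 0 - al) * expR (- nu * s) by ring.
rewrite (le_trans (ler_normD _ _))// addrC lerD//.
rewrite normrM (gtr0_norm (expR_gt0 _)) (@le_trans _ _ `|F 0 - al|) ?ler_normB//.
rewrite ler_piMr// -expR0 ler_expR mulNr oppr_le0 mulr_ge0//; first exact: ltW.
by case/andP: sY.
Qed.

(** Here the coefficient is fixed and may have either sign: [mu] differs from [kap] by [h mu^2], and
    the amplitude differs from 1 by terms of the order of the last factor. The quotient [rho / h] in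
    that factor is the reason why the boundary terms have to be [o(h)]. *)
Lemma ode_cvg s : h <= 1 -> 4 * h * `|kap| <= 3 / 4 -> 0 <= s <= Y ->
  `|F s - expR (kap * s)| <=
   (Y ^+ 2 + 2 * (2 * Y + 4 + 4 * `|kap|) + 4 * kap ^+ 2 * Y + 1) * expR (2 * `|kap| * Y) ^+ 2 *
     (rho / h + h * `|F1 0| + `|F 0 - 1| + h).
Proof.
move=> h1 hk /andP[s0 sY].
set q := Num.sqrt (1 + 4 * h * kap).
have hk4 : 4 * h * `|kap| = `|4 * h * kap| by rewrite normrM ger0_norm// mulr_ge0// ltW.
have hkb : - (3 / 4) <= 4 * h * kap <= 3 / 4.
  by rewrite -ler_norml -hk4.
(* The smallness of [h] keeps the discriminant above 1/4, so even for negative [kap] the roots are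
   real, [mu] is at most [2 |kap|] in modulus and [nu] has order [1 / h]. *)
have q0 : 1 / 2 <= q.
  rewrite /q (_ : 1 / 2 = Num.sqrt ((1 / 2) ^+ 2)); last by rewrite sqrtr_sqr ger0_norm.
  by rewrite ler_sqrt; case/andP: hkb; lra.
have qE : q ^+ 2 = 1 + 4 * h * kap by rewrite sqr_sqrtr//; case/andP: hkb; lra.
have qp : 0 < q by lra.
set mu := grow h kap.
have muE : h * mu ^+ 2 + mu = kap by apply: growE => //; case/andP: hkb; lra.
have qmu : 2 * h * mu = q - 1 by rewrite /mu /grow -/q; field; rewrite gt_eqF.
have muq : mu * (q + 1) = 2 * kap.
  have : 2 * h * (mu * (q + 1)) = 2 * h * (2 * kap).
    transitivity (2 * h * mu * (q + 1)); first by ring.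
    by rewrite qmu; transitivity (q ^+ 2 - 1); [ring|rewrite qE; ring].
  by move/mulfI; apply; rewrite gt_eqF// mulr_gt0.
have mu2 : `|mu| <= 2 * `|kap|.
  have : `|mu| * (q + 1) = 2 * `|kap|.
    rewrite -[X in _ * X](@ger0_norm _ (q + 1)); last by lra.
    by rewrite -normrM muq normrM ger0_norm.
  by have := normr_ge0 mu; nra.
pose nu := mu + h^-1.
have hi : 0 < h^-1 by rewrite invr_gt0.
have hhi : h * h^-1 = 1 by rewrite divff// gt_eqF.
have hnu : h * nu = 1 + h * mu by rewrite /nu mulrDr hhi; ring.
have hmn : h * (mu + nu) = q by rewrite /nu; transitivity (2 * h * mu + h * h^-1); [ring|rewrite qmu hhi; ring].
have nu0 : 0 <= nu.
  have : 0 <= h * nu by rewrite hnu; lra.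
  by rewrite pmulr_rge0.
have mn0 : 0 < mu + nu.
  have : 0 < h * (mu + nu) by rewrite hmn; lra.
  by rewrite pmulr_rgt0.
set E := expR (2 * `|kap| * Y).
have E0 : 0 <= E by exact: expR_ge0.
have E1 : 1 <= E.
  by rewrite -expR0 ler_expR !mulr_ge0// ltW.
have kE : kap = h * mu * nu.
  by rewrite -{1}muE /nu; field; rewrite gt_eqF.
have nuE : nu = mu + h^-1 by [].
have Emu : expR (mu * s) <= E.
  by rewrite ler_expR (le_trans (ler_norm _))// normrM ler_pM// ger0_norm.
have Emu' a b : 0 <= a -> a <= b -> b <= Y -> expR (mu * (a - b)) <= E.
  move=> a0 ab bY; rewrite ler_expR.
  apply: (le_trans (ler_norm _)); rewrite normrM ler_pM// distrC ger0_norm ?subr_ge0//; lra.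
have H2 : `|expR (mu * s) - expR (kap * s)| <= E * (4 * h * kap ^+ 2 * Y).
  have k2 : `|kap| <= 2 * `|kap| by have := normr_ge0 kap; lra.
  apply: (le_trans (@expR_lip (mu * s) (kap * s) (2 * `|kap| * Y) _ _)).
  - by rewrite (le_trans (ler_norm _))// normrM ler_pM// ger0_norm.
  - by rewrite (le_trans (ler_norm _))// normrM ler_pM// ger0_norm.
  rewrite ler_wpM2l//.
  rewrite -mulrBl normrM (ger0_norm s0) ler_pM//.
  rewrite -[X in _ - X]muE (_ : mu - _ = - (h * mu ^+ 2)); last by ring.
  rewrite normrN ger0_norm; last by apply: mulr_ge0; [exact: ltW|exact: sqr_ge0].
  rewrite (_ : 4 * h * kap ^+ 2 = h * (2 * `|kap|) ^+ 2); last by rewrite exprMn real_normK ?num_real//; ring.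
  by rewrite ler_pM2l// -real_normK ?num_real// ler_pXn2r ?nnegrE// mulr_ge0.
clearbody E; clearbody nu; clearbody mu; clearbody q.
have [//|//|//|//|//|al al1 al2] := @ode_factor mu nu E.
have {al2} := al2 s _; rewrite s0 sY => /(_ isT) H.
have Enu : expR (- nu * s) <= 1.
  by rewrite -expR0 ler_expR mulNr oppr_le0 mulr_ge0.
have e0 : 0 < expR (mu * s) by exact: expR_gt0.
have en0 : 0 < expR (- nu * s) by exact: expR_gt0.
have rh0 : 0 <= rho / h by rewrite divr_ge0// ltW.
have rrh : rho <= rho / h.
  by rewrite ler_pdivlMr// ler_piMr.
have H1 : `|al - 1| <= 2 * E * rho * Y + (2 * h * `|F1 0| + 4 * `|F 0 - 1| + 4 * h * `|kap|).
  have -> : al - 1 = (al - (F1 0 + nu * F 0) / (mu + nu)) + ((F1 0 + nu * F 0) / (mu + nu) - 1) by ring.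
  apply: (le_trans (ler_normD _ _)); apply: lerD.
    apply: (le_trans al1).
    rewrite (_ : E * (rho * Y / h) / (mu + nu) = E * rho * Y / q); last first.
      by rewrite -hmn; field; rewrite !gt_eqF.
    rewrite ler_pdivrMr//.
    have : 0 <= E * rho * Y by rewrite !mulr_ge0// ltW.
    by nra.
  rewrite (_ : _ - 1 = (h * F1 0 + (h * nu) * (F 0 - 1) - h * mu) / q); last first.
    rewrite -hmn; field; rewrite !gt_eqF//.
  rewrite normrM (ger0_norm (_ : 0 <= q^-1)) ?invr_ge0 ?(ltW qp)//.
  rewrite ler_pdivrMr//.
  have hnu2 : 0 <= h * nu <= 2.
    rewrite hnu; have : h * mu <= h * (2 * `|kap|) by rewrite ler_pM2l// (le_trans (ler_norm _)).
    have : 0 <= q by lra.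
    lra.
  have : `|h * F1 0 + (h * nu) * (F 0 - 1) - h * mu| <= h * `|F1 0| + 2 * `|F 0 - 1| + h * (2 * `|kap|).
    rewrite (le_trans (ler_normB _ _))// lerD//; last first.
      by rewrite normrM (gtr0_norm h0) ler_pM2l.
    rewrite (le_trans (ler_normD _ _))// lerD//; first by rewrite normrM (gtr0_norm h0).
    rewrite normrM ler_wpM2r// ger0_norm; by case/andP: hnu2.
  have := normr_ge0 (F 0 - 1); have := normr_ge0 kap; have := normr_ge0 (F1 0) => f10 k0 f0.
  have : 0 <= h * `|F1 0| by rewrite mulr_ge0// ltW.
  have : 0 <= h * `|kap| by rewrite mulr_ge0// ltW.
  by nra.
have EE : E <= E ^+ 2 by rewrite expr2 ler_peMl.
have H3 : `|F s - expR (kap * s)| <= E * (rho * Y ^+ 2 / h) + `|al - 1| * E +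
    E * (4 * h * kap ^+ 2 * Y) + (`|F 0 - 1| + `|al - 1|).
  have -> : F s - expR (kap * s) = (F s - (al * expR (mu * s) + (F 0 - al) * expR (- nu * s))) +
    (al - 1) * expR (mu * s) + (expR (mu * s) - expR (kap * s)) + ((F 0 - 1) - (al - 1)) * expR (- nu * s).
    by ring.
  rewrite (le_trans (ler_normD _ _))// lerD//.
    rewrite (le_trans (ler_normD _ _))// lerD//.
    rewrite (le_trans (ler_normD _ _))// lerD//.
    by rewrite normrM (gtr0_norm e0) ler_wpM2l.
  rewrite normrM (gtr0_norm en0) (@le_trans _ _ `|F 0 - 1 - (al - 1)|) ?ler_normB//.
  by rewrite ler_piMr.
apply: (le_trans H3).
move: H1; set A := `|al - 1|; set f0 := `|F 0 - 1|; set f1 := `|F1 0|; set kk := `|kap| => H1.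
have A0 : 0 <= A by exact: normr_ge0.
have f00 : 0 <= f0 by exact: normr_ge0.
have kk0 : 0 <= kk by exact: normr_ge0.
have f10 : 0 <= f1 by exact: normr_ge0.
have hf1 : 0 <= h * f1 by rewrite mulr_ge0// ltW.
clearbody A f0 f1 kk.
set T := rho / h + h * f1 + f0 + h.
have TE : T = rho / h + h * f1 + f0 + h by [].
clearbody T.
have T0 : 0 <= T by rewrite TE !addr_ge0 ?(ltW h0).
have Trh : rho / h <= T by rewrite TE -!addrA lerDl !addr_ge0 ?(ltW h0).
have Tf : f0 <= T by rewrite TE addrAC lerDr !addr_ge0 ?(ltW h0).
have Th : h <= T by rewrite TE lerDr !addr_ge0.
have E00 : 0 <= E by apply: le_trans E1.
have Y00 := ltW Y0.
have b1 : E * (rho * Y ^+ 2 / h) <= Y ^+ 2 * E ^+ 2 * T.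
  rewrite (_ : E * _ = Y ^+ 2 * E * (rho / h)); last by ring.
  apply: ler_pM => //; first by rewrite mulr_ge0 ?sqr_ge0.
  by rewrite ler_wpM2l ?sqr_ge0.
have b2 : A <= (2 * Y + 4 + 4 * kk) * E * T.
  apply: (le_trans H1).
  have t1 : 2 * E * rho * Y <= 2 * Y * E * T.
    rewrite (_ : 2 * E * rho * Y = 2 * Y * E * rho); last by ring.
    by apply: ler_wpM2l; [rewrite !mulr_ge0|exact: le_trans Trh].
  have t2 : 2 * h * f1 + 4 * f0 + 4 * h * kk <= (4 + 4 * kk) * T.
    have k1 : 0 <= kk * (rho / h + h * f1 + f0) by rewrite mulr_ge0// !addr_ge0.
    rewrite TE -subr_ge0 (_ : _ - _ = 4 * (kk * (rho / h + h * f1 + f0)) + 4 * (rho / h) + 2 * (h * f1) + 4 * h); last by ring.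
    have hh0 := ltW h0.
    by do 3?apply: addr_ge0; apply: mulr_ge0.
  have t3 : (4 + 4 * kk) * T <= (4 + 4 * kk) * E * T.
    by rewrite ler_wpM2r// ler_peMr// addr_ge0// mulr_ge0.
  rewrite (_ : (2 * Y + 4 + 4 * kk) * E * T = 2 * Y * E * T + (4 + 4 * kk) * E * T); last by ring.
  exact: lerD t1 (le_trans t2 t3).
have b3 : E * (4 * h * kap ^+ 2 * Y) <= 4 * kap ^+ 2 * Y * E ^+ 2 * T.
  rewrite (_ : E * _ = 4 * kap ^+ 2 * Y * E * h); last by ring.
  have kY : 0 <= 4 * kap ^+ 2 * Y by apply: mulr_ge0 => //; apply: mulr_ge0 => //; exact: sqr_ge0.
  have q1 : 0 <= 4 * kap ^+ 2 * Y * E := mulr_ge0 kY E00.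
  have q2 : 4 * kap ^+ 2 * Y * E <= 4 * kap ^+ 2 * Y * E ^+ 2 := ler_wpM2l kY EE.
  exact: (ler_pM q1 (ltW h0) q2 Th).
have b4 : A * E <= (2 * Y + 4 + 4 * kk) * E ^+ 2 * T.
  rewrite (_ : _ * E ^+ 2 * T = (2 * Y + 4 + 4 * kk) * E * T * E); last by ring.
  by rewrite ler_wpM2r.
have b5 : A <= (2 * Y + 4 + 4 * kk) * E ^+ 2 * T.
  apply: (le_trans _ b4); rewrite ler_peMr//.
have b6 : f0 <= E ^+ 2 * T.
  apply: (@le_trans _ _ T) => //; rewrite ler_peMl//; exact: le_trans EE.
rewrite (_ : (Y ^+ 2 + _ + _ + 1) * E ^+ 2 * T = Y ^+ 2 * E ^+ 2 * T + (2 * Y + 4 + 4 * kk) * E ^+ 2 * T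
  + 4 * kap ^+ 2 * Y * E ^+ 2 * T + (E ^+ 2 * T + (2 * Y + 4 + 4 * kk) * E ^+ 2 * T)); last by ring.
exact: lerD (lerD (lerD b1 b4) b3) (lerD b6 b5).
Qed.
End ode.

(** * The kernel *)

Section kernel_pde.
Context {R : realType}.
Variable c : R.
Hypothesis c0 : 0 < c.
Implicit Types (h x s k L : R).

(** [kR] and [kT] are the logarithm of the modulus and the argument of
    [w^(-1/2) exp (- (x + i s)^2 / (4 h w))]. Their first terms come from [w^(-1/2)] in the branch
    with positive real part. *)
Definition kR h x s : R :=
  - (1 / 4 * ln (c ^+ 2 + x ^+ 2)) - (x ^+ 2 * (c + 2 * s) - s ^+ 2 * c) / (4 * h * (c ^+ 2 + x ^+ 2)).
Definition kT h x s : R :=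
  - (1 / 2 * atan (x / c)) - (2 * x * s * c - x * (x ^+ 2 - s ^+ 2)) / (4 * h * (c ^+ 2 + x ^+ 2)).
Definition kA h : R := (Num.sqrt (4 * pi * h))^-1.
(* Real and imaginary parts of
   [(4 pi h w)^(-1/2) exp (- (x + i s)^2 / (4 h w))] with [w = c + i x]. *)
Definition kNr h x s : R := kA h * (expR (kR h x s) * cos (kT h x s)).
Definition kNi h x s : R := kA h * (expR (kR h x s) * sin (kT h x s)).

(** Partial derivatives in closed form: the trailing letters [s] and [x] name the variables of
    differentiation, and [Nr], [Ni] stand for the real and imaginary parts. *)
Let Rs h x s : R := - (2 * x ^+ 2 - 2 * s * c) / (4 * h * (c ^+ 2 + x ^+ 2)).
Let Ts h x s : R := - (2 * x * c + 2 * x * s) / (4 * h * (c ^+ 2 + x ^+ 2)).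
Let Rss h x : R := 2 * c / (4 * h * (c ^+ 2 + x ^+ 2)).
Let Tss h x : R := - (2 * x) / (4 * h * (c ^+ 2 + x ^+ 2)).
Let Rx h x s : R := - (x / (2 * (c ^+ 2 + x ^+ 2))) -
  (2 * x * (c + 2 * s) * (c ^+ 2 + x ^+ 2) - (x ^+ 2 * (c + 2 * s) - s ^+ 2 * c) * (2 * x)) /
  (4 * h * (c ^+ 2 + x ^+ 2) ^+ 2).
Let Tx h x s : R := - (c / (2 * (c ^+ 2 + x ^+ 2))) -
  ((2 * s * c - 3 * x ^+ 2 + s ^+ 2) * (c ^+ 2 + x ^+ 2) - (2 * x * s * c - x * (x ^+ 2 - s ^+ 2)) * (2 * x)) /
  (4 * h * (c ^+ 2 + x ^+ 2) ^+ 2).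
Let Nrs h x s := Rs h x s * kNr h x s - Ts h x s * kNi h x s.
Let Nis h x s := Rs h x s * kNi h x s + Ts h x s * kNr h x s.
Let Nrss h x s := Rss h x * kNr h x s + Rs h x s * Nrs h x s - (Tss h x * kNi h x s + Ts h x s * Nis h x s).
Let Niss h x s := Rss h x * kNi h x s + Rs h x s * Nis h x s + (Tss h x * kNr h x s + Ts h x s * Nrs h x s).

Let W0 x : 0 < c ^+ 2 + x ^+ 2.
Proof. by rewrite ltr_wpDr ?sqr_ge0// exprn_gt0. Qed.

Let dRs h s x : is_derive s 1 (kR h x) (Rs h x s).
Proof. by rewrite /kR /Rs; der; ring. Qed.
Let dTs h s x : is_derive s 1 (kT h x) (Ts h x s).
Proof. by rewrite /kT /Ts; der; ring. Qed.
Let dRss h s x : is_derive s 1 (Rs h x) (Rss h x).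
Proof. by rewrite /Rs /Rss; der; ring. Qed.
Let dTss h s x : is_derive s 1 (Ts h x) (Tss h x).
Proof. by rewrite /Ts /Tss; der; ring. Qed.
Let dNrs h s x : is_derive s 1 (kNr h x) (Nrs h x s).
Proof. by have := dRs h s x; have := dTs h s x => *; rewrite /Nrs /kNr /kNi; der; ring. Qed.
Let dNis h s x : is_derive s 1 (kNi h x) (Nis h x s).
Proof. by have := dRs h s x; have := dTs h s x => *; rewrite /Nis /kNi /kNr; der; ring. Qed.
Let dNrss h s x : is_derive s 1 (Nrs h x) (Nrss h x s).
Proof.
have := dRss h s x; have := dTss h s x; have := dNrs h s x; have := dNis h s x => *.
rewrite /Nrs; der; rewrite -/(Nrs h x s) /Nrss; ring.
Qed.
Let dNiss h s x : is_derive s 1 (Nis h x) (Niss h x s).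
Proof.
have := dRss h s x; have := dTss h s x; have := dNrs h s x; have := dNis h s x => *.
rewrite /Nis; der; rewrite -/(Nis h x s) /Niss; ring.
Qed.
Let dRx h s x : 0 < h -> is_derive x 1 (fun x => kR h x s) (Rx h x s).
Proof.
move=> h0; have w0 := W0 x.
have h4 : 4 * h * (c ^+ 2 + x ^+ 2) != 0 by rewrite gt_eqF// !mulr_gt0 ?W0.
by rewrite /kR /Rx; der => //; field; rewrite !gt_eqF.
Qed.
Let dTx h s x : 0 < h -> is_derive x 1 (fun x => kT h x s) (Tx h x s).
Proof.
move=> h0; have w0 := W0 x.
have h4 : 4 * h * (c ^+ 2 + x ^+ 2) != 0 by rewrite gt_eqF// !mulr_gt0 ?W0.
have c1 : c ^+ 2 + x ^+ 2 != 0 by rewrite gt_eqF.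
rewrite /kT /Tx; der => //.
have -> : (1 + (x / c) ^+ 2)^-1 = c ^+ 2 / (c ^+ 2 + x ^+ 2).
  by field; rewrite !gt_eqF// (_ : x ^+ 2 + c ^+ 2 = c ^+ 2 + x ^+ 2)//; ring.
by field; rewrite !gt_eqF.
Qed.

(** Real part of [i N_x = h N_ss + N_s]; [pde2] is the imaginary part. All derivatives are
    combinations of [kNr] and [kNi] with rational coefficients, so the identity is one between
    rational functions. *)
Let pde1 h x s : 0 < h ->
  - (Rx h x s * kNi h x s + Tx h x s * kNr h x s) = h * Nrss h x s + Nrs h x s.
Proof.
move=> h0; have w0 := W0 x.
rewrite /Nrss /Nrs /Nis /Rx /Tx /Rs /Ts /Rss /Tss; field; by rewrite !gt_eqF.
Qed.
Let pde2 h x s : 0 < h ->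
  Rx h x s * kNr h x s - Tx h x s * kNi h x s = h * Niss h x s + Nis h x s.
Proof.
move=> h0; have w0 := W0 x.
rewrite /Niss /Nrs /Nis /Rx /Tx /Rs /Ts /Rss /Tss; field; by rewrite !gt_eqF.
Qed.

Lemma kR_cont h : 0 < h -> continuous (fun q : R * R => kR h q.1 q.2).
Proof.
move=> h0; rewrite /kR; ctn.
  by apply: cont_ln => [q|]; [exact: W0|ctn].
by move=> q; rewrite gt_eqF// !mulr_gt0 ?W0.
Qed.
Lemma kT_cont h : 0 < h -> continuous (fun q : R * R => kT h q.1 q.2).
Proof.
by move=> h0; rewrite /kT; ctn; move=> q; rewrite gt_eqF// !mulr_gt0 ?W0.
Qed.
Lemma kNr_cont h : 0 < h -> continuous (fun q : R * R => kNr h q.1 q.2).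
Proof. by move=> h0; have cR := kR_cont h0; have cT := kT_cont h0; rewrite /kNr; ctn. Qed.
Lemma kNi_cont h : 0 < h -> continuous (fun q : R * R => kNi h q.1 q.2).
Proof. by move=> h0; have cR := kR_cont h0; have cT := kT_cont h0; rewrite /kNi; ctn. Qed.

(* The [x]-transform of the kernel at frequency [k], on the window [-L, L]. *)
Definition kF h L k s : R :=
  Int (- L) L (fun x => kNr h x s * cos (k * x) - kNi h x s * sin (k * x)).
Definition kF1 h L k s : R :=
  Int (- L) L (fun x => Nrs h x s * cos (k * x) - Nis h x s * sin (k * x)).
Definition kF2 h L k s : R :=
  Int (- L) L (fun x => Nrss h x s * cos (k * x) - Niss h x s * sin (k * x)).
Definition kFr h L k s : R :=
  - (kNi h L s * cos (k * L) + kNr h L s * sin (k * L)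
     - (kNi h (- L) s * cos (k * - L) + kNr h (- L) s * sin (k * - L))).

Let cts h : 0 < h -> [/\ continuous (fun q : R * R => Rs h q.1 q.2),
   continuous (fun q : R * R => Ts h q.1 q.2),
   continuous (Rss h) & continuous (Tss h)].
Proof.
by move=> h0; rewrite /Rs /Ts /Rss /Tss; split; ctn => q; rewrite gt_eqF// !mulr_gt0 ?W0.
Qed.
Let cts1 h : 0 < h -> continuous (fun q : R * R => Nrs h q.1 q.2) /\
   continuous (fun q : R * R => Nis h q.1 q.2).
Proof.
move=> h0; have [a1 a2 a3 a4] := cts h0; have cr := kNr_cont h0; have ci := kNi_cont h0.
by rewrite /Nrs /Nis; split; ctn.
Qed.
Let cts2 h : 0 < h -> continuous (fun q : R * R => Nrss h q.1 q.2) /\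
   continuous (fun q : R * R => Niss h q.1 q.2).
Proof.
move=> h0; have [a1 a2 a3 a4] := cts h0; have cr := kNr_cont h0; have ci := kNi_cont h0.
have [b1 b2] := cts1 h0.
by rewrite /Nrss /Niss; split; ctn.
Qed.

Lemma kF_d h L k (s : R) : 0 < h -> 0 <= L -> is_derive s 1 (kF h L k) (kF1 h L k s).
Proof.
move=> h0 L0; have cr := kNr_cont h0; have ci := kNi_cont h0.
have [b1 b2] := cts1 h0.
apply: (@is_derive_Int _ (fun s x => kNr h x s * cos (k * x) - kNi h x s * sin (k * x))
   (fun s x => Nrs h x s * cos (k * x) - Nis h x s * sin (k * x))).
- by lra.
- by ctn.
- by ctn.
- move=> z x _; have := dNrs h z x; have := dNis h z x => *; der; ring.
Qed.

Lemma kF1_d h L k (s : R) : 0 < h -> 0 <= L -> is_derive s 1 (kF1 h L k) (kF2 h L k s).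
Proof.
move=> h0 L0.
have [b1 b2] := cts1 h0. have [b3 b4] := cts2 h0.
apply: (@is_derive_Int _ (fun s x => Nrs h x s * cos (k * x) - Nis h x s * sin (k * x))
   (fun s x => Nrss h x s * cos (k * x) - Niss h x s * sin (k * x))).
- by lra.
- by ctn.
- by ctn.
- move=> z x _; have := dNrss h z x; have := dNiss h z x => *; der; ring.
Qed.

(** By the equation for [N] the integrand of the left-hand side is the exact [x]-derivative of the
    real part of [i N exp (i k x)]; only its values at the two ends of the window survive. *)
Lemma kF_ode h L k s : 0 < h -> 0 <= L ->
  h * kF2 h L k s + kF1 h L k s - k * kF h L k s = kFr h L k s.
Proof.
move=> h0 L0; have cr := kNr_cont h0; have ci := kNi_cont h0.
have [b1 b2] := cts1 h0. have [b3 b4] := cts2 h0.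
have cf1 : continuous (fun x => kNr h x s * cos (k * x) - kNi h x s * sin (k * x)) by ctn.
have cf2 : continuous (fun x => Nrs h x s * cos (k * x) - Nis h x s * sin (k * x)) by ctn.
have cf3 : continuous (fun x => Nrss h x s * cos (k * x) - Niss h x s * sin (k * x)) by ctn.
rewrite /kF /kF1 /kF2 -!IntZ// -IntD//; [|by ctn].
rewrite -IntB//; [|by ctn|by ctn].
have LL : - L <= L by lra.
set f := (X in Int _ _ X).
have cf : continuous f by rewrite /f; ctn.
have H (x : R) : - L <= x <= L ->
    is_derive x 1 (fun x => - (kNi h x s * cos (k * x) + kNr h x s * sin (k * x))) (f x).
  move=> _; have dRxs := @dRx h s x h0; have dTxs := @dTx h s x h0.
  have dr : is_derive x 1 (fun x => kNr h x s) (Rx h x s * kNr h x s - Tx h x s * kNi h x s).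
    by rewrite /kNr /kNi; der; ring.
  have di : is_derive x 1 (fun x => kNi h x s) (Rx h x s * kNi h x s + Tx h x s * kNr h x s).
    by rewrite /kNr /kNi; der; ring.
  rewrite /f; der.
  have p1 := @pde1 h x s h0; have p2 := @pde2 h x s h0.
  rewrite p2 -[Rx _ _ _ * _ + _]opprK p1; ring.
by rewrite (Int_FTC LL cf H) /kFr; ring.
Qed.

Lemma kNr_even h x s : kNr h (- x) s = kNr h x s.
Proof.
rewrite /kNr /kR /kT sqrrN !mulNr atanN.
by rewrite (_ : - (1 / 2 * - _) - _ = - (- (1 / 2 * atan (x / c)) - (2 * x * s * c - x * (x ^+ 2 - s ^+ 2)) / (4 * h * (c ^+ 2 + x ^+ 2)))) ?cosN//; ring.
Qed.
(** Averaging over [k] and [- k] removes the sine part. The cosine transform thus mixes the growing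
    solution of the differential equation with the decaying one. *)
Lemma kNr_cos h L k s : 0 < h -> 0 <= L ->
  Int (- L) L (fun x => kNr h x s * cos (k * x)) = (kF h L k s + kF h L (- k) s) / 2.
Proof.
move=> h0 L0; have cr := kNr_cont h0; have ci := kNi_cont h0.
rewrite /kF -IntD; [|by ctn|by ctn].
transitivity (2^-1 * (2 * Int (- L) L (fun x => kNr h x s * cos (k * x)))); first by field.
rewrite -IntZ; last by ctn.
rewrite [RHS]mulrC; congr (_ * _); apply: eq_Int => x _.
rewrite !mulNr cosN sinN; ring.
Qed.

(** The number [c^(-1/2)], which is the largest modulus of [w^(-1/2)], attained at [x = 0]. *)
Definition kC0 : R := expR (- (1 / 4 * ln (c ^+ 2))).

Lemma kR_le h x s : kR h x s <= - (1 / 4 * ln (c ^+ 2)) -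
  (x ^+ 2 * (c + 2 * s) - s ^+ 2 * c) / (4 * h * (c ^+ 2 + x ^+ 2)).
Proof.
rewrite /kR lerD2r lerN2 ler_pM2l; last by lra.
by rewrite ler_ln ?posrE ?exprn_gt0// lerDl sqr_ge0.
Qed.

(** Both parts are dominated by the modulus. The lower bound [B] on the exponent is left free and
    cleared of denominators, to serve at [s = 0], at the ends of the window and outside [U]. *)
Lemma kNr_le h x s B : 0 < h ->
  B * (4 * h * (c ^+ 2 + x ^+ 2)) <= (x ^+ 2 * (c + 2 * s) - s ^+ 2 * c) ->
  `|kNr h x s| <= kA h * kC0 * expR (- B) /\ `|kNi h x s| <= kA h * kC0 * expR (- B).
Proof.
move=> h0 HB; have w0 := W0 x.
have A0 : 0 <= kA h by rewrite invr_ge0 sqrtr_ge0.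
have H : expR (kR h x s) <= kC0 * expR (- B).
  rewrite -expRD ler_expR (le_trans (kR_le _ _ _))// lerD2l lerN2 ler_pdivlMr//.
  by rewrite !mulr_gt0.
have H2 z : `|z| <= 1 -> `|kA h * (expR (kR h x s) * z)| <= kA h * kC0 * expR (- B).
  move=> z1; rewrite normrM (ger0_norm A0) -mulrA ler_wpM2l//.
  by rewrite normrM (gtr0_norm (expR_gt0 _)) (le_trans _ H)// ler_piMr ?expR_ge0.
by split; apply: H2; [exact: cos_max|exact: sin_max].
Qed.

Lemma kF1_0_le h L k : 0 < h -> 0 < L ->
  `|kF1 h L k 0| <= Int (- L) L (fun x => (`|x| * (L + c) / (h * c ^+ 2)) *
     (kA h * kC0 * expR (- (c / (4 * (c ^+ 2 + L ^+ 2)) * x ^+ 2 / h)))).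
Proof.
move=> h0 L0; have [b1 b2] := cts1 h0.
apply: ler_Int; [by ctn|by ctn|] => x xL.
have xL1 : `|x| <= L by rewrite ler_norml.
have xL2 : x ^+ 2 <= L ^+ 2 by rewrite -(real_normK (num_real x)) ler_pXn2r ?nnegrE// ltW.
have w0 := W0 x; have wL := W0 L.
have [|Hr Hi] := @kNr_le h x 0 (c / (4 * (c ^+ 2 + L ^+ 2)) * x ^+ 2 / h) h0.
  rewrite mulr0 addr0 expr0n/= mul0r subr0.
  rewrite [X in X <= _](_ : _ = x ^+ 2 * c * ((c ^+ 2 + x ^+ 2) / (c ^+ 2 + L ^+ 2))); last first.
    by field; rewrite !gt_eqF.
  apply: ler_piMr; first by rewrite mulr_ge0 ?sqr_ge0// ltW.
  by rewrite ler_pdivrMr// mul1r lerD2l.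
set E := kA h * kC0 * _ in Hr Hi *.
have E0 : 0 <= E by apply: le_trans Hr.
have i0 : 0 <= (4 * h * (c ^+ 2 + x ^+ 2))^-1 by rewrite invr_ge0 !mulr_ge0// ltW.
have ile : (4 * h * (c ^+ 2 + x ^+ 2))^-1 <= (4 * h * c ^+ 2)^-1.
  rewrite lef_pV2 ?posrE ?mulr_gt0 ?exprn_gt0//.
  by rewrite ler_pM2l ?mulr_gt0// lerDl sqr_ge0.
have HR : `|Rs h x 0| + `|Ts h x 0| <= `|x| * (L + c) / (2 * h * c ^+ 2).
  rewrite /Rs /Ts !mulr0 !mul0r subr0 addr0 !normrM !normrN (ger0_norm i0) -mulrDl.
  rewrite [X in _ <= X](_ : _ = (2 * `|x| * (L + c)) * (4 * h * c ^+ 2)^-1); last first.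
    by field; rewrite !gt_eqF.
  apply: ler_pM => //.
  rewrite !normrM (ger0_norm (_ : 0 <= 2 :> R))// (ger0_norm (ltW c0)).
  by have := ler_wpM2l (normr_ge0 x) xL1; lra.
have HN (a b : R) : `|a| <= E -> `|b| <= E -> `|Rs h x 0| * `|a| + `|Ts h x 0| * `|b| <=
    `|x| * (L + c) / (2 * h * c ^+ 2) * E.
  move=> aE bE; apply: le_trans (ler_wpM2r E0 HR); rewrite mulrDl lerD// ler_wpM2l//.
have H1 : `|Nrs h x 0| <= `|x| * (L + c) / (2 * h * c ^+ 2) * E.
  by apply: le_trans (HN _ _ Hr Hi); rewrite -!normrM ler_normB.
have H2 : `|Nis h x 0| <= `|x| * (L + c) / (2 * h * c ^+ 2) * E.
  by apply: le_trans (HN _ _ Hi Hr); rewrite -!normrM ler_normD.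
rewrite (le_trans (ler_normB _ _))//.
rewrite [X in _ <= X](_ : _ = `|x| * (L + c) / (2 * h * c ^+ 2) * E + `|x| * (L + c) / (2 * h * c ^+ 2) * E); last first.
  by field; rewrite !gt_eqF.
rewrite !normrM lerD//; [apply: le_trans H1|apply: le_trans H2]; rewrite ler_piMr//.
  exact: cos_max.
exact: sin_max.
Qed.

End kernel_pde.

(** * Bounds on the transform and its boundary terms, uniform in the frequency *)

Section kernel_estimates.
Context {R : realType}.

Lemma expRN_le1D (z : R) : 0 <= z -> expR (- z) <= (1 + z)^-1.
Proof.
move=> z0; rewrite expRN lef_pV2 ?posrE ?expR_gt0 ?expR_ge1Dx//.
by rewrite ltr_pwDl.
Qed.

Lemma expRN_le_sq (z : R) : 0 < z -> expR (- z) <= 4 / z ^+ 2.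
Proof.
move=> z0.
have -> : 4 / z ^+ 2 = ((z / 2) ^+ 2)^-1 by field; rewrite gt_eqF.
rewrite expRN lef_pV2 ?posrE ?expR_gt0 ?exprn_gt0 ?divr_gt0//.
have -> : expR z = expR (z / 2) ^+ 2 by rewrite expr2 -expRD; congr expR; field.
rewrite ler_pXn2r ?nnegrE ?expR_ge0 ?divr_ge0 ?(ltW z0)//.
by have := expR_ge1Dx (z / 2); lra.
Qed.

(** An elementary substitute for the Gaussian integral: [exp (- B x^2) <= 1 / (1 + B x^2)], and the
    power [B^(-1/2)] is the right one. *)
Lemma Int_inv1Dsq (B L : R) : 0 < B -> 0 <= L ->
  Int (- L) L (fun x => (1 + B * x ^+ 2)^-1) <= pi / Num.sqrt B.
Proof.
move=> B0 L0; have LL : - L <= L by lra.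
have q0 : 0 < Num.sqrt B by rewrite sqrtr_gt0.
have qE : Num.sqrt B ^+ 2 = B by rewrite sqr_sqrtr// ltW.
have p0 (x : R) : 0 < 1 + B * x ^+ 2 by rewrite ltr_pwDl// mulr_ge0 ?sqr_ge0// ltW.
have cf : continuous (fun x : R => (1 + B * x ^+ 2)^-1) by ctn; move=> x; rewrite gt_eqF.
have H (x : R) : - L <= x <= L ->
    is_derive x 1 (fun x => atan (Num.sqrt B * x) / Num.sqrt B) ((1 + B * x ^+ 2)^-1).
  move=> _; der; rewrite exprMn qE; field; by rewrite !gt_eqF.
rewrite (Int_FTC LL cf H) mulrN atanN mulNr opprK -mulrDl ler_pM2r ?invr_gt0//.
by have := atan_ltpi2 (Num.sqrt B * L); lra.
Qed.

Variables (c L : R).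
Hypotheses (c0 : 0 < c) (L0 : 0 < L).
Let W0 x : 0 < c ^+ 2 + x ^+ 2.
Proof. by rewrite ltr_wpDr ?sqr_ge0// exprn_gt0. Qed.
Let b := c / (4 * (c ^+ 2 + L ^+ 2)).
Let b0 : 0 < b. Proof. by rewrite divr_gt0// mulr_gt0. Qed.

Let kA_E (h : R) : kA h = (Num.sqrt (4 * pi) * Num.sqrt h)^-1.
Proof. by rewrite /kA sqrtrM// mulr_ge0// pi_ge0. Qed.
Let s4pi0 : 0 < Num.sqrt (4 * pi) :> R.
Proof. by rewrite sqrtr_gt0 mulr_gt0// pi_gt0. Qed.
Let C00 : 0 < kC0 c. Proof. exact: expR_gt0. Qed.
Let kA0 (h : R) : 0 < h -> 0 < kA h.
Proof. by move=> h0; rewrite kA_E invr_gt0 mulr_gt0// sqrtr_gt0. Qed.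

(** At [s = 0] the kernel is dominated by a Gaussian of width [sqrt h] with a prefactor of order
    [1 / sqrt h], so the powers of [h] cancel. *)
Lemma kF_0_bound : exists2 C : R, 0 <= C & forall h k : R, 0 < h -> `|kF c h L k 0| <= C.
Proof.
exists (2 * kC0 c * pi / (Num.sqrt (4 * pi) * Num.sqrt b)).
  by rewrite divr_ge0 ?mulr_ge0 ?pi_ge0 ?sqrtr_ge0 ?(ltW C00).
move=> h k h0; have cr := kNr_cont c0 h0; have ci := kNi_cont c0 h0.
have q0 : 0 < Num.sqrt h by rewrite sqrtr_gt0.
have p0 (x : R) : 0 < 1 + b / h * x ^+ 2 by rewrite ltr_pwDl// mulr_ge0 ?sqr_ge0// divr_ge0 ?(ltW b0) ?(ltW h0).
have cf : continuous (fun x : R => (1 + b / h * x ^+ 2)^-1) by ctn; move=> x; rewrite gt_eqF.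
apply: (@le_trans _ _ (Int (- L) L (fun x => 2 * (kA h * kC0 c) * (1 + b / h * x ^+ 2)^-1))).
  apply: ler_Int; [by ctn|by ctn|] => x xL.
  have xL1 : `|x| <= L by rewrite ler_norml.
  have xL2 : x ^+ 2 <= L ^+ 2 by rewrite -(real_normK (num_real x)) ler_pXn2r ?nnegrE// ltW.
  have w0 := W0 x; have wL := W0 L.
  have [|Hr Hi] := @kNr_le R c c0 h x 0 (b / h * x ^+ 2) h0.
    rewrite mulr0 addr0 expr0n/= mul0r subr0 /b.
    rewrite [X in X <= _](_ : _ = x ^+ 2 * c * ((c ^+ 2 + x ^+ 2) / (c ^+ 2 + L ^+ 2))); last first.
      by field; rewrite !gt_eqF.
    apply: ler_piMr; first by rewrite mulr_ge0 ?sqr_ge0// ltW.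
    by rewrite ler_pdivrMr// mul1r lerD2l.
  have HE : kA h * kC0 c * expR (- (b / h * x ^+ 2)) <= kA h * kC0 c * (1 + b / h * x ^+ 2)^-1.
    apply: ler_wpM2l; first by rewrite mulr_ge0 ?(ltW C00) ?(ltW (kA0 h0)).
    by apply: expRN_le1D; rewrite mulr_ge0 ?sqr_ge0// divr_ge0 ?(ltW b0) ?(ltW h0).
  apply: (le_trans (ler_normB _ _)); rewrite (normrM (kNr c h x 0)) (normrM (kNi c h x 0)).
  have c1 : `|cos (k * x)| <= 1 by exact: cos_max.
  have s1 : `|sin (k * x)| <= 1 by exact: sin_max.
  apply: (@le_trans _ _ (`|kNr c h x 0| + `|kNi c h x 0|)).
    by apply: lerD; rewrite ler_piMr.
  lra.
rewrite IntZ//.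
apply: (le_trans (ler_wpM2l _ (Int_inv1Dsq _ (ltW L0)))).
- by rewrite !mulr_ge0 ?(ltW C00) ?(ltW (kA0 h0)).
- by rewrite divr_gt0.
have sb0 : 0 < Num.sqrt b by rewrite sqrtr_gt0.
rewrite kA_E (@sqrtrM _ b) ?(ltW b0)// sqrtrV ?(ltW h0)//.
rewrite le_eqVlt; apply/orP; left; apply/eqP; field; by rewrite !gt_eqF.
Qed.

(** Differentiation in [s] brings down a factor of order [|x| / h], that is [1 / sqrt h] on the
    Gaussian scale; multiplication by [h] leaves [sqrt h]. *)
Lemma kF1_0_bound : exists2 C : R, 0 <= C &
  forall h k : R, 0 < h -> h * `|kF1 c h L k 0| <= C * Num.sqrt h.
Proof.
exists (2 * (L + c) / c ^+ 2 * (kC0 c * pi / (Num.sqrt (4 * pi) * Num.sqrt b ^+ 2))).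
  rewrite mulr_ge0//; first by rewrite divr_ge0 ?sqr_ge0// mulr_ge0// addr_ge0 ?(ltW L0) ?(ltW c0).
  by apply: divr_ge0; apply: mulr_ge0; rewrite ?pi_ge0 ?sqrtr_ge0 ?sqr_ge0 ?(ltW C00).
move=> h k h0.
have q0 : 0 < Num.sqrt h by rewrite sqrtr_gt0.
have qE : Num.sqrt h ^+ 2 = h by rewrite sqr_sqrtr// ltW.
have sb0 : 0 < Num.sqrt b by rewrite sqrtr_gt0.
have sbE : Num.sqrt b ^+ 2 = b by rewrite sqr_sqrtr// ltW.
have p0 (x : R) : 0 < 1 + b / h * x ^+ 2 by rewrite ltr_pwDl// mulr_ge0 ?sqr_ge0// divr_ge0 ?(ltW b0) ?(ltW h0).
have cf : continuous (fun x : R => (1 + b / h * x ^+ 2)^-1) by ctn; move=> x; rewrite gt_eqF.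
pose D := 2 * ((L + c) / (h * c ^+ 2)) * (kA h * kC0 c) * (Num.sqrt h / Num.sqrt b).
have D0 : 0 <= D.
  apply: mulr_ge0; last by rewrite divr_ge0 ?(ltW q0) ?(ltW sb0).
  apply: mulr_ge0; last by apply: mulr_ge0; [exact/ltW/kA0|exact: ltW].
  apply: mulr_ge0 => //; apply: divr_ge0; first by apply: addr_ge0; exact: ltW.
  by apply: mulr_ge0; [exact: ltW|exact: sqr_ge0].
have H : `|kF1 c h L k 0| <= D * (pi / Num.sqrt (b / h)).
  apply: (le_trans (kF1_0_le c0 k h0 L0)).
  apply: (@le_trans _ _ (Int (- L) L (fun x => D * (1 + b / h * x ^+ 2)^-1))); last first.
    rewrite IntZ// ler_wpM2l// Int_inv1Dsq ?(ltW L0)// divr_gt0//.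
  apply: le_Int; [by ctn|by ctn|] => x _.
  rewrite -/b.
  set z := Num.sqrt b * `|x| / Num.sqrt h.
  have z0 : 0 <= z by rewrite !mulr_ge0 ?invr_ge0 ?(ltW q0) ?(ltW sb0).
  have zE : b / h * x ^+ 2 = z ^+ 2.
    by rewrite /z !exprMn exprVn qE sbE real_normK ?num_real//; ring.
  have xE : `|x| = Num.sqrt h / Num.sqrt b * z by rewrite /z; field; rewrite !gt_eqF.
  rewrite (_ : b * x ^+ 2 / h = z ^+ 2) ?zE; last by rewrite -zE; ring.
  rewrite xE.
  rewrite [X in X <= _](_ : _ = D * (z * expR (- z ^+ 2) / 2)); last by rewrite /D; field; rewrite !gt_eqF.
  rewrite ler_wpM2l// ler_pdivrMr//.
  have e1 : 0 < 1 + z ^+ 2 by rewrite ltr_pwDl// sqr_ge0.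
  have e2 := expR_ge1Dx (z ^+ 2 / 2).
  have e3 : (1 + z ^+ 2 / 2) ^+ 2 <= expR (z ^+ 2).
    have -> : expR (z ^+ 2) = expR (z ^+ 2 / 2) ^+ 2 by rewrite [RHS]expr2 -expRD; congr expR; field.
    by rewrite ler_pXn2r ?nnegrE ?expR_ge0// addr_ge0// divr_ge0// sqr_ge0.
  have e4 : z * (1 + z ^+ 2) <= 2 * expR (z ^+ 2).
    apply: le_trans (_ : 2 * (1 + z ^+ 2 / 2) ^+ 2 <= _); last by rewrite ler_pM2l.
    have := sqr_ge0 (z ^+ 2 - z); have := sqr_ge0 (z - 1); have := sqr_ge0 z; lra.
  rewrite expRN ler_pdivrMr ?expR_gt0// (_ : _ * 2 * _ = 2 * expR (z ^+ 2) / (1 + z ^+ 2)); last by ring.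
  by rewrite ler_pdivlMr.
apply: (le_trans (ler_wpM2l (ltW h0) H)).
rewrite (@sqrtrM _ b) ?(ltW b0)// sqrtrV ?(ltW h0)// /D kA_E.
rewrite le_eqVlt; apply/orP; left; apply/eqP; field; by rewrite !gt_eqF.
Qed.

(** Rate of exponential smallness: [kdec eps / h] bounds the exponent from below as soon as the
    numerator is at least [c eps^2] and [|x| <= L]. *)
Definition kdec (eps : R) := c * eps ^+ 2 / (4 * (c ^+ 2 + L ^+ 2)).

(** At [x = L] and [x = - L] the numerator of the exponent is at least [c (L^2 - s^2)], and
    [s + eps <= L] makes this at least [c eps^2]. The factor 4 counts the boundary terms. *)
Lemma kFr_bound eps h k s : 0 < h -> 0 <= eps -> 0 <= s <= L - eps ->
  `|kFr c h L k s| <= 4 * (kA h * kC0 c * expR (- (kdec eps / h))).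
Proof.
move=> h0 e0 /andP[s0 sL].
have wL := W0 L.
have key : kdec eps / h * (4 * h * (c ^+ 2 + L ^+ 2)) <= L ^+ 2 * (c + 2 * s) - s ^+ 2 * c.
  rewrite [X in X <= _](_ : _ = c * eps ^+ 2); last by rewrite /kdec; field; rewrite !gt_eqF.
  have : 0 <= L ^+ 2 * (2 * s) by rewrite mulr_ge0 ?sqr_ge0// mulr_ge0.
  have : c * (s ^+ 2 + eps ^+ 2) <= c * L ^+ 2 by rewrite ler_pM2l//; nra.
  by lra.
have [Hr Hi] := kNr_le c0 h0 key.
have [|Hr' Hi'] := @kNr_le R c c0 h (- L) s (kdec eps / h) h0; first by rewrite sqrrN.
set E := kA h * _ * _ in Hr Hi Hr' Hi' *.
have M (a d : R) : `|a| <= E -> `|d| <= 1 -> `|a * d| <= E.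
  by move=> aE d1; rewrite normrM (le_trans _ aE)// ler_piMr.
rewrite /kFr normrN (le_trans (ler_normB _ _))//.
have h1 := ler_normD (kNi c h L s * cos (k * L)) (kNr c h L s * sin (k * L)).
have h2 := ler_normD (kNi c h (- L) s * cos (k * - L)) (kNr c h (- L) s * sin (k * - L)).
have h3 := M _ _ Hi (cos_max (k * L)); have h4 := M _ _ Hr (sin_max (k * L)).
have h5 := M _ _ Hi' (cos_max (k * - L)); have h6 := M _ _ Hr' (sin_max (k * - L)).
lra.
Qed.

(** The exponential yields two powers of [h] against the [1 / sqrt h] of [kA]. The resulting
    [h^(3/2)] is still small after the division by [h] in [ode_cvg]. *)
Lemma kdec_small eps : 0 < eps -> exists2 C : R, 0 <= C &
  forall h : R, 0 < h -> 4 * (kA h * kC0 c * expR (- (kdec eps / h))) <= C * h * Num.sqrt h.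
Proof.
move=> e0; have d0 : 0 < kdec eps by rewrite divr_gt0 ?mulr_gt0 ?exprn_gt0.
exists (16 * kC0 c / (Num.sqrt (4 * pi) * kdec eps ^+ 2)).
  by apply: divr_ge0; apply: mulr_ge0; rewrite ?sqrtr_ge0 ?sqr_ge0 ?(ltW C00).
move=> h h0.
have q0 : 0 < Num.sqrt h by rewrite sqrtr_gt0.
have qE : Num.sqrt h ^+ 2 = h by rewrite sqr_sqrtr// ltW.
apply: (@le_trans _ _ (4 * (kA h * kC0 c * (4 / (kdec eps / h) ^+ 2)))).
  rewrite ler_pM2l// ler_pM2l ?mulr_gt0 ?kA0//.
  by apply: expRN_le_sq; rewrite divr_gt0.
rewrite kA_E le_eqVlt; apply/orP; left; apply/eqP.
move: (Num.sqrt h) qE q0 => q qE q0; rewrite -qE; field.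
by rewrite !gt_eqF// -qE exprn_gt0.
Qed.
End kernel_estimates.

(** * Normalization of the transform at s = 0 *)

Section gauss.
Context {R : realType}.

Lemma Int_even (f : R -> R) M : 0 <= M -> continuous f -> (forall x, f (- x) = f x) ->
  Int (- M) M f = 2 * Int 0 M f.
Proof.
move=> M0 cf fe.
have M0' : - M <= 0 by lra.
rewrite (@Int_split R f (- M) 0 M)//.
have [F HF] := @antiderivative R f (- M) cf.
have H1 (x : R) : - M <= x <= 0 -> is_derive x 1 F (f x) by case/andP => + _; exact: HF.
have H2 (x : R) : 0 <= x <= M -> is_derive x 1 (fun x => - F (- x)) (f x).
  move=> /andP[x0 xM]; have HF' : is_derive (- x) 1 F (f (- x)) by apply: HF; lra.
  by der; rewrite fe; ring.
by rewrite (Int_FTC M0' cf H1) (Int_FTC M0 cf H2) oppr0; ring.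
Qed.

(** The known limit concerns the square of the half-line integral; nonnegativity permits taking the
    root, and evenness doubles the result. *)
Lemma gauss_cvg (e : R) : 0 < e -> exists2 M : R, 0 < M &
  forall N : R, M <= N -> `|Int (- N) N (fun v => expR (- v ^+ 2)) - Num.sqrt pi| <= e.
Proof.
move=> e0.
have H : Num.sqrt (gauss_integral_proof.integral0_gauss x ^+ 2) @[x --> +oo] --> Num.sqrt (pi / 4 : R).
  by apply: continuous_cvg => //;
      [exact: sqrt_continuous|exact: gauss_integral_proof.cvg_integral0_gauss_sqr].
have e20 : 0 < e / 2 by rewrite divr_gt0.
move/cvgrPdist_le : H => /(_ _ e20) [M [_ HM]].
exists (`|M| + 1); first by rewrite ltr_wpDl.
move=> N MN; have N0 : 0 <= N by apply: le_trans MN; rewrite addr_ge0.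
have := HM N; rewrite sqrtr_sqr (ger0_norm (gauss_integral_proof.integral0_gauss_ge0 N)).
have -> : M < N by have := ler_norm M; lra.
move=> /(_ isT) {}HM.
have cg : continuous (fun v : R => expR (- v ^+ 2)) by ctn.
rewrite Int_even//; last by move=> x; rewrite sqrrN.
rewrite distrC.
have -> : Num.sqrt pi - 2 * Int 0 N (fun v => expR (- v ^+ 2)) =
   2 * (Num.sqrt (pi / 4) - gauss_integral_proof.integral0_gauss N).
  rewrite (_ : pi / 4 = pi * (2^-1) ^+ 2); last by field.
  rewrite sqrtrM ?pi_ge0// sqrtr_sqr ger0_norm ?invr_ge0//.
  by rewrite mulrBr; congr (_ - _); field.
rewrite normrM (ger0_norm (_ : 0 <= 2 :> R))// mulrC -ler_pdivlMr//.
Qed.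
End gauss.

Section initial_value.
Context {R : realType}.
Variables (c L : R).
Hypotheses (c0 : 0 < c) (L0 : 0 < L).
Variable b : R.
Hypothesis bE : b = c / (4 * (c ^+ 2 + L ^+ 2)).
Let b0 : 0 < b. Proof. by rewrite bE divr_gt0// mulr_gt0// ltr_wpDr ?sqr_ge0// exprn_gt0. Qed.
Let W0 (x : R) : 0 < c ^+ 2 + x ^+ 2.
Proof. by rewrite ltr_wpDr ?sqr_ge0// exprn_gt0. Qed.
Variable k : R.

(* The kernel on the real axis in the parabolic scale [x = sqrt h * z]. *)
Let Th (g z : R) : R :=
  expR (- (1 / 4 * ln (c ^+ 2 + (g * z) ^+ 2)) - z ^+ 2 * c / (4 * (c ^+ 2 + (g * z) ^+ 2))) *
  cos (- (1 / 2 * atan (g * z / c)) + g * z ^+ 3 / (4 * (c ^+ 2 + (g * z) ^+ 2)) + k * (g * z)).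

Let cTh : continuous (fun q : R * R => Th q.1 q.2).
Proof.
rewrite /Th; ctn.
- by apply: cont_ln => [q|]; [exact: W0|ctn].
- by move=> q; rewrite gt_eqF// mulr_gt0.
- by move=> q; rewrite gt_eqF// mulr_gt0.
Qed.

Let kF_Th h : 0 < h -> kF c h L k 0 =
  (Num.sqrt (4 * pi))^-1 * Int (- (L / Num.sqrt h)) (L / Num.sqrt h) (Th (Num.sqrt h)).
Proof.
move=> h0; have q0 : 0 < Num.sqrt h by rewrite sqrtr_gt0.
have qE : Num.sqrt h ^+ 2 = h by rewrite sqr_sqrtr// ltW.
have kAE : kA h = (Num.sqrt (4 * pi) * Num.sqrt h)^-1.
  by rewrite /kA sqrtrM// mulr_ge0// pi_ge0.
have s4 : 0 < Num.sqrt (4 * pi) :> R by rewrite sqrtr_gt0 mulr_gt0// pi_gt0.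
have cr := kNr_cont c0 h0; have ci := kNi_cont c0 h0.
rewrite -IntZ; last by ctn.
move: qE q0 kAE; set q := Num.sqrt h => qE q0 kAE.
rewrite /kF; set f := (X in Int _ _ X = _).
have cf : continuous f by rewrite /f; ctn.
have cq : continuous (fun z : R => q * z) by ctn.
have c1' : continuous (fun _ : R => q) by ctn.
have dq (z : R) : is_derive z 1 (fun z => q * z) q by der; ring.
have Lq : - (L / q) <= L / q by have := divr_gt0 L0 q0; lra.
have le (z : R) : - (L / q) <= z <= L / q -> q * - (L / q) <= q * z.
  by case/andP => zL _; rewrite ler_pM2l.
have := Int_subst Lq cf cq c1' dq le.
rewrite mulrN (_ : q * (L / q) = L); last by field; rewrite gt_eqF.
move=> ->; apply: eq_Int => z _.
have w0 := W0 (q * z).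
rewrite /f /kNr /kNi /kR /kT /Th kAE -qE.
rewrite !mulr0 !addr0 !expr0n/= !mul0r !subr0.
rewrite [X in _ = _ * (_ * cos X)](_ : _ =
  (- (1 / 2 * atan (q * z / c)) - (0 * c - q * z * (q * z) ^+ 2) / (4 * q ^+ 2 * (c ^+ 2 + (q * z) ^+ 2))) + k * (q * z)); last first.
  by rewrite mul0r; field; rewrite !gt_eqF.
rewrite [X in _ = _ * (expR (_ - X) * _)](_ : _ =
  (q * z) ^+ 2 * c / (4 * q ^+ 2 * (c ^+ 2 + (q * z) ^+ 2))); last first.
  by field; rewrite !gt_eqF.
rewrite mul0r [cos (_ + k * (q * z))]cosD.
by field; rewrite !gt_eqF.
Qed.

Let Th_le g z : `|g * z| <= L -> `|Th g z| <= kC0 c * expR (- (b * z ^+ 2)).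
Proof.
move=> gz; have gz2 : (g * z) ^+ 2 <= L ^+ 2.
  by rewrite -(real_normK (num_real _)) ler_pXn2r ?nnegrE// ltW.
rewrite /Th normrM gtr0_norm ?expR_gt0// -expRD.
apply: (@le_trans _ _ (expR (- (1 / 4 * ln (c ^+ 2 + (g * z) ^+ 2)) - z ^+ 2 * c / (4 * (c ^+ 2 + (g * z) ^+ 2))))).
  by rewrite ler_piMr ?expR_ge0// cos_max.
rewrite ler_expR lerD//.
  rewrite lerN2 ler_pM2l; last by lra.
  by rewrite ler_ln ?posrE ?exprn_gt0// lerDl sqr_ge0.
rewrite lerN2 mulrC -mulrA ler_wpM2l ?sqr_ge0// bE ler_pM2l// lef_pV2 ?posrE ?mulr_gt0//.
by rewrite ler_pM2l// lerD2l.
Qed.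

(** Beyond [M] the factor [|z| / M] is at least 1; inserting it turns the Gaussian majorant into an
    exact derivative. *)
Let tail g M Q : 0 <= g -> 0 < M -> M <= Q -> g * Q <= L ->
  `|Int M Q (Th g)| <= kC0 c / (2 * b * M) /\ `|Int (- Q) (- M) (Th g)| <= kC0 c / (2 * b * M).
Proof.
move=> g0 M0 MQ gQ.
have C0 : 0 < kC0 c by exact: expR_gt0.
have e0 (x : R) : 0 < expR x by exact: expR_gt0.
split.
  have cf : continuous (fun z : R => kC0 c * (z / M * expR (- (b * z ^+ 2)))) by ctn.
  apply: (@le_trans _ _ (Int M Q (fun z => kC0 c * (z / M * expR (- (b * z ^+ 2)))))).
    apply: ler_Int; [by ctn|by ctn|] => z /andP[Mz zQ].
    have z0 : 0 <= z by rewrite (le_trans _ Mz)// ltW.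
    apply: (le_trans (@Th_le g z _)).
      by rewrite ger0_norm ?mulr_ge0// (le_trans _ gQ)// ler_wpM2l.
    by rewrite ler_pM2l// ler_peMl ?expR_ge0// ler_pdivlMr// mul1r.
  have dF (z : R) : M <= z <= Q ->
      is_derive z 1 (fun z => - (kC0 c / (2 * b * M)) * expR (- (b * z ^+ 2))) (kC0 c * (z / M * expR (- (b * z ^+ 2)))).
    by move=> _; der; field; rewrite !gt_eqF.
  rewrite (Int_FTC MQ cf dF).
  have K0 : 0 <= kC0 c / (2 * b * M) by rewrite divr_ge0 ?(ltW C0)// ltW// !mulr_gt0.
  have : expR (- (b * M ^+ 2)) <= 1 by rewrite -expR0 ler_expR oppr_le0 mulr_ge0 ?sqr_ge0 ?(ltW b0).
  have := e0 (- (b * Q ^+ 2)); nra.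
have cf : continuous (fun z : R => kC0 c * (- z / M * expR (- (b * z ^+ 2)))) by ctn.
have MQ' : - Q <= - M by lra.
apply: (@le_trans _ _ (Int (- Q) (- M) (fun z => kC0 c * (- z / M * expR (- (b * z ^+ 2)))))).
  apply: ler_Int; [by ctn|by ctn|] => z /andP[Mz zQ].
  have z0 : 0 <= - z by lra.
  apply: (le_trans (@Th_le g z _)).
    rewrite -normrN -mulrN ger0_norm ?mulr_ge0// (le_trans _ gQ)// ler_wpM2l//; lra.
  rewrite ler_pM2l// ler_peMl ?expR_ge0// ler_pdivlMr// mul1r; lra.
have dF (z : R) : - Q <= z <= - M ->
    is_derive z 1 (fun z => (kC0 c / (2 * b * M)) * expR (- (b * z ^+ 2))) (kC0 c * (- z / M * expR (- (b * z ^+ 2)))).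
  by move=> _; der; field; rewrite !gt_eqF.
rewrite (Int_FTC MQ' cf dF) !sqrrN.
have K0 : 0 <= kC0 c / (2 * b * M) by rewrite divr_ge0 ?(ltW C0)// ltW// !mulr_gt0.
have : expR (- (b * M ^+ 2)) <= 1 by rewrite -expR0 ler_expR oppr_le0 mulr_ge0 ?sqr_ge0 ?(ltW b0).
have := e0 (- (b * Q ^+ 2)); nra.
Qed.

Let kC0E : kC0 c ^+ 2 * c = 1.
Proof.
rewrite /kC0 -expRM_natl -{2}(@lnK _ c) ?posrE// -expRD lnXn//.
by rewrite (_ : _ + _ = 0) ?expR0// -mulr_natl; field.
Qed.

(** At [g = 0] the profile is [kC0 c * exp (- z^2 / (4 c))]. The substitution [z = 2 sqrt c v] makes
    it the standard Gaussian, since [kC0 c * sqrt c = 1]. *)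
Let gauss0 e : 0 < e -> exists2 M : R, 0 < M &
  forall N : R, M <= N -> `|Int (- N) N (Th 0) - Num.sqrt (4 * pi)| <= e.
Proof.
move=> e0; have e20 : 0 < e / 2 by rewrite divr_gt0.
have sc0 : 0 < Num.sqrt c by rewrite sqrtr_gt0.
have scE : Num.sqrt c ^+ 2 = c by rewrite sqr_sqrtr// ltW.
have C0 : 0 < kC0 c by exact: expR_gt0.
have CsE : kC0 c * Num.sqrt c = 1.
  apply/eqP; rewrite -(@eqrXn2 _ 2) ?mulr_ge0 ?(ltW C0) ?(ltW sc0)//.
  by rewrite exprMn scE kC0E expr1n.
have [M M0 HM] := gauss_cvg e20.
exists (2 * Num.sqrt c * M); first by rewrite !mulr_gt0.
move=> N MN.
pose N' := N / (2 * Num.sqrt c).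
have MN' : M <= N' by rewrite ler_pdivlMr ?mulr_gt0// mulrC.
have NE : N = (2 * Num.sqrt c) * N' by rewrite /N'; field; rewrite gt_eqF.
have N'0 : 0 <= N' by apply: le_trans MN'; exact: ltW.
have cT0 : continuous (Th 0) by ctn.
have cg : continuous (fun v : R => expR (- v ^+ 2)) by ctn.
have Lq : - N' <= N' by lra.
have cq : continuous (fun z : R => (2 * Num.sqrt c) * z) by ctn.
have c1' : continuous (fun _ : R => 2 * Num.sqrt c) by ctn.
have dq (z : R) : is_derive z 1 (fun z => (2 * Num.sqrt c) * z) (2 * Num.sqrt c) by der; ring.
have le (z : R) : - N' <= z <= N' -> (2 * Num.sqrt c) * - N' <= (2 * Num.sqrt c) * z.
  by case/andP => zL _; rewrite ler_pM2l// mulr_gt0.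
have := Int_subst Lq cT0 cq c1' dq le.
rewrite mulrN -NE => ->.
have -> : Int (- N') N' (fun x => Th 0 (2 * Num.sqrt c * x) * (2 * Num.sqrt c)) =
    2 * Int (- N') N' (fun v => expR (- v ^+ 2)).
  rewrite -IntZ//; apply: eq_Int => v _.
  rewrite /Th !mul0r expr0n/= !addr0 mulr0 atan0 mulr0 oppr0 addr0 cos0 mulr1.
  rewrite expRD -/(kC0 c).
  rewrite [X in expR X](_ : _ = - v ^+ 2); last first.
    rewrite exprMn exprMn scE; field; by rewrite gt_eqF.
  by transitivity (2 * (kC0 c * Num.sqrt c) * expR (- v ^+ 2)); [ring|rewrite CsE; ring].
rewrite (_ : Num.sqrt (4 * pi) = 2 * Num.sqrt pi); last first.
  by rewrite (_ : 4 = 2 ^+ 2); [rewrite sqrtrM ?sqr_ge0// sqrtr_sqr ger0_norm|ring].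
by rewrite -mulrBr normrM ger0_norm// mulrC -ler_pdivlMr// HM.
Qed.

Lemma cvg0 e : 0 < e -> exists2 d : R, 0 < d &
  forall h : R, 0 < h < d -> `|kF c h L k 0 - 1| <= e.
Proof.
move=> e0.
have s4 : 0 < Num.sqrt (4 * pi) :> R by rewrite sqrtr_gt0 mulr_gt0// pi_gt0.
have C0 : 0 < kC0 c by exact: expR_gt0.
(* A quarter of the tolerance for each of four errors: the two tails, the replacement of [Th q] by
   [Th 0] on [[-M, M]], and the truncated Gaussian. *)
pose e1 := e * Num.sqrt (4 * pi) / 4.
have e10 : 0 < e1 by rewrite divr_gt0// mulr_gt0.
have [M1 M10 HM1] := gauss0 e10.
pose M := M1 + kC0 c / (2 * b * e1).
have Q0 : 0 < kC0 c / (2 * b * e1) by rewrite divr_gt0// !mulr_gt0.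
have M0 : 0 < M by rewrite addr_gt0.
have tM : kC0 c / (2 * b * M) <= e1.
  rewrite ler_pdivrMr ?mulr_gt0// (_ : e1 * _ = (2 * b * e1) * M); last by ring.
  rewrite -ler_pdivrMl ?mulr_gt0// mulrC /M lerDr; exact: ltW.
have e20 : 0 < e1 / (2 * M) by rewrite divr_gt0// mulr_gt0.
have [d d0 Hd] := @tube_norm R R (- M) M 0 Th _ e20 cTh.
pose dd := Num.min d (L / M).
have dd0 : 0 < dd by rewrite lt_min; rewrite d0 divr_gt0.
exists (dd ^+ 2); first by rewrite exprn_gt0.
move=> h /andP[h0 hd].
have q0 : 0 < Num.sqrt h by rewrite sqrtr_gt0.
have qd : Num.sqrt h < dd.
  by rewrite -(ltr_pXn2r (_ : 0 < 2)%N) ?nnegrE ?(ltW q0) ?(ltW dd0)// sqr_sqrtr// ltW.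
have [qd1 qd2] : Num.sqrt h < d /\ Num.sqrt h < L / M by apply/andP; rewrite -lt_min.
rewrite kF_Th//; move: q0 qd1 qd2; set q := Num.sqrt h => q0 qd1 qd2.
have MQ : M <= L / q.
  by rewrite ler_pdivlMr// mulrC -ler_pdivlMr// ltW.
have gQ : q * (L / q) <= L by rewrite mulrC divfK ?gt_eqF.
have [t1 t2] := tail (ltW q0) M0 MQ gQ.
have cq : continuous (Th q) by ctn.
have c00 : continuous (Th 0) by ctn.
have MM : - M <= M by lra.
rewrite (@Int_split R (Th q) (- (L / q)) (- M) (L / q))//; [|lra|lra].
rewrite (@Int_split R (Th q) (- M) M (L / q))//.
have H2 : `|Int (- M) M (Th q) - Int (- M) M (Th 0)| <= e1.
  rewrite -IntB//.
  apply: (@le_trans _ _ (e1 / (2 * M) * (M - - M))).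
    apply: Int_bound => //; first by ctn.
    move=> z zM; apply/ltW/Hd => //; rewrite /ball_ /= sub0r normrN gtr0_norm//.
  by rewrite le_eqVlt; apply/orP; left; apply/eqP; field; rewrite gt_eqF.
have H3 := HM1 M; rewrite lerDl (ltW Q0) in H3; have {}H3 := H3 isT.
have -> : forall X : R, (Num.sqrt (4 * pi))^-1 * X - 1 = (X - Num.sqrt (4 * pi)) / Num.sqrt (4 * pi).
  by move=> X; field; rewrite gt_eqF.
rewrite normrM (gtr0_norm (_ : 0 < (Num.sqrt (4 * pi))^-1)) ?invr_gt0// ler_pdivrMr//.
have E4 : e * Num.sqrt (4 * pi) = 4 * e1 by rewrite /e1; field.
rewrite E4.
move: t1 t2 H2 H3 tM; clearbody e1 M.
set i1 := Int M _ _; set i2 := Int _ (- M) _; set i3 := Int (- M) M (Th q); set i4 := Int _ _ (Th 0).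
set S := Num.sqrt (4 * pi) => t1 t2 H2 H3 tM.
rewrite (_ : i2 + (i3 + i1) - S = i2 + i1 + (i3 - i4) + (i4 - S)); last by ring.
have a1 := ler_normD (i2 + i1 + (i3 - i4)) (i4 - S).
have a2 := ler_normD (i2 + i1) (i3 - i4).
have a3 := ler_normD i2 i1.
clearbody i1 i2 i3 i4 S.
lra.
Qed.
End initial_value.

Lemma kF_0_cvg {R : realType} (c L : R) (c0 : 0 < c) (L0 : 0 < L) (k e : R) : 0 < e ->
  exists2 d : R, 0 < d & forall h : R, 0 < h < d -> `|kF c h L k 0 - 1| <= e.
Proof. by move=> e0; exact: (cvg0 c0 L0 erefl k e0). Qed.

Section half_interval.
Context {R : realType}.

Lemma Int_fold (f : R -> R) M : 0 <= M -> continuous f ->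
  Int (- M) M f = Int 0 M (fun x => f x + f (- x)).
Proof.
move=> M0 cf.
have M0' : - M <= 0 by lra.
have cfN : continuous (fun x : R => f (- x)) by ctn.
rewrite IntD// (@Int_split R f (- M) 0 M)//.
have [F HF] := @antiderivative R f (- M) cf.
have H1 (x : R) : - M <= x <= 0 -> is_derive x 1 F (f x) by case/andP => + _; exact: HF.
have H2 (x : R) : 0 <= x <= M -> is_derive x 1 (fun x => - F (- x)) (f (- x)).
  move=> /andP[x0 xM]; have HF' : is_derive (- x) 1 F (f (- x)) by apply: HF; lra.
  by der; ring.
by rewrite (Int_FTC M0' cf H1) (Int_FTC M0 cfN H2) oppr0; ring.
Qed.

Lemma sin_bound (z : R) : 0 <= z -> `|sin z| <= z.
Proof.
move=> z0.
have H1 (x : R) : 0 <= x <= z -> is_derive x 1 sin (cos x) by move=> _; exact: is_derive_sin.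
have H2 (x : R) : 0 <= x <= z -> `|cos x| <= 1 by move=> _; exact: cos_max.
by have := mvt_bound z0 H1 H2; rewrite sin0 !subr0 mul1r.
Qed.

(** Substitution [t = Y sin p]: then [sqrt (Y^2 - t^2) = Y cos p], and [dt = Y cos p dp] supplies
    the area density of the sphere. *)
Lemma sphere_mode_t (Y k m : R) : 0 < Y -> 0 < k ->
  Int (- Y) Y (fun t => cos (Num.sqrt (k ^+ 2 + m ^+ 2) * t) *
     Int (- (pi / 2)) (pi / 2) (fun s => expR (m * (Num.sqrt (Y ^+ 2 - t ^+ 2) * sin s))))
  = 2 * pi * (sin (k * Y) / k).
Proof.
move=> Y0 k0.
have P0 : - (pi / 2) <= pi / 2 :> R by have := pi_ge0 R; lra.
set w := Num.sqrt (k ^+ 2 + m ^+ 2).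
set f := (X in Int _ _ X).
have cf0 : continuous (fun q : R * R => expR (m * (Num.sqrt (Y ^+ 2 - q.1 ^+ 2) * sin q.2))) by ctn.
have cf1 : continuous (fun t : R => Int (- (pi / 2)) (pi / 2) (fun s => expR (m * (Num.sqrt (Y ^+ 2 - t ^+ 2) * sin s)))).
  by apply: (@cont_Int R R (fun t s : R => expR (m * (Num.sqrt (Y ^+ 2 - t ^+ 2) * sin s)))).
have cf : continuous f by rewrite /f; ctn.
have cg : continuous (fun p : R => Y * sin p) by ctn.
have cg' : continuous (fun p : R => Y * cos p) by ctn.
have dg (p : R) : is_derive p 1 (fun p => Y * sin p) (Y * cos p) by der; ring.
have sin_ge (p : R) : -1 <= sin p <= 1 by have := sin_max p; rewrite ler_norml.
have le (p : R) : - (pi / 2) <= p <= pi / 2 -> Y * sin (- (pi / 2)) <= Y * sin p.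
  by move=> _; rewrite ler_pM2l// sinN sin_pihalf; case/andP: (sin_ge p).
have := Int_subst P0 cf cg cg' dg le.
rewrite sinN sin_pihalf mulrN mulr1 => ->.
transitivity (Y * Int (- (pi / 2)) (pi / 2) (fun p => Int (- (pi / 2)) (pi / 2) (fun s =>
   cos p * cos (w * (Y * sin p)) * expR (m * (Y * cos p * sin s))))); last first.
  rewrite sphere_mode//; field; by rewrite !gt_eqF.
have c3' : continuous (fun q : R * R => cos q.1 * cos (w * (Y * sin q.1)) * expR (m * (Y * cos q.1 * sin q.2))) by ctn.
rewrite -IntZ; last by apply: (@cont_Int R R (fun p s : R => cos p * cos (w * (Y * sin p)) * expR (m * (Y * cos p * sin s)))).
apply: eq_Int => p pp; rewrite /f.
have cp : 0 <= cos p by apply: cos_ge0_pihalf.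
have -> : Num.sqrt (Y ^+ 2 - (Y * sin p) ^+ 2) = Y * cos p.
  have -> : Y ^+ 2 - (Y * sin p) ^+ 2 = (Y * cos p) ^+ 2.
    rewrite !exprMn -[X in X - _]mulr1 -(cos2Dsin2 p); ring.
  by rewrite sqrtr_sqr ger0_norm// mulr_ge0// ltW.
rewrite IntZ; last by ctn.
ring.
Qed.
End half_interval.

(** * Pairing of the kernel with a single mode *)

Section mode.
Context {R : realType}.
Variables (c y0 eps k1 : R).
Hypotheses (c0 : 0 < c) (y00 : 0 < y0) (eps0 : 0 < eps) (k10 : 0 < k1).
Local Notation L := (y0 + eps).
Let L0 : 0 < L. Proof. exact: addr_gt0. Qed.

Let rho h := 4 * (kA h * kC0 c * expR (- (kdec c L eps / h))).
Let rhoP h k s : 0 < h -> 0 <= s <= y0 -> `|kFr c h L k s| <= rho h.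
Proof. by move=> h0 s0; apply: kFr_bound; rewrite ?(ltW eps0)// addrK. Qed.

(** For [h <= 1] the initial data, the boundary terms and even their quotient by [h] are bounded, so
    [ode_growth] gives one constant for all [h] and all [k >= 0]. *)
Lemma kF_growth : exists2 C : R, 0 <= C & forall h k : R, 0 < h <= 1 -> 0 <= k ->
  exists2 al : R, `|al| <= C &
    forall s : R, 0 <= s <= y0 -> `|kF c h L k s - al * expR (grow h k * s)| <= C.
Proof.
have [C1 C10 H1] := kF_0_bound c0 L0.
have [C2 C20 H2] := kF1_0_bound c0 L0.
have [C3 C30 H3] := kdec_small L c0 eps0.
exists (2 * C1 + C2 + C3 * y0 + C3 * y0 ^+ 2).
  by rewrite !addr_ge0// mulr_ge0// ?sqr_ge0// ltW.
move=> h k /andP[h0 h1] k0.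
have q1 : Num.sqrt h <= 1 by rewrite -sqrtr1 ler_sqrt.
have q0 : 0 <= Num.sqrt h by exact: sqrtr_ge0.
have r1 : rho h <= C3.
  by apply: (le_trans (H3 h h0)); rewrite -mulrA ler_piMr// mulr_ile1// ltW.
have r2 : rho h / h <= C3.
  by rewrite ler_pdivrMr// (le_trans (H3 h h0))// ler_piMr// mulr_ge0// ltW.
have a2 : h * `|kF1 c h L k 0| <= C2.
  by apply: (le_trans (H2 h k h0)); rewrite ler_piMr.
have a1 := H1 h k h0.
have [al al1 al2] := ode_growth h0 y00 (fun s _ => kF_d c0 k s h0 (ltW L0)) (fun s _ => kF1_d c0 k s h0 (ltW L0))
   (fun s _ => kF_ode c0 k s h0 (ltW L0)) (fun s => @rhoP h k s h0) k0.
have b1 : rho h * y0 <= C3 * y0 by rewrite ler_pM2r.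
have b2 : rho h * y0 ^+ 2 / h <= C3 * y0 ^+ 2.
  by rewrite mulrAC; apply: (ler_wpM2r _ r2); exact: sqr_ge0.
have z1 : 0 <= C3 * y0 by rewrite mulr_ge0// ltW.
have z2 : 0 <= C3 * y0 ^+ 2 by rewrite mulr_ge0// sqr_ge0.
exists al; first by apply: (le_trans al1); lra.
move=> s s0; apply: (le_trans (al2 s s0)); lra.
Qed.

(** The energy only controls [k F^2]; the lower bound [k1] on the frequency allows the division by
    [k]. In the application [k1] is the lowest positive wave number. *)
Lemma kF_decay : exists2 C : R, 0 <= C & forall h k s : R, 0 < h <= 1 -> k1 <= k -> 0 <= s <= y0 ->
  `|kF c h L (- k) s| <= C.
Proof.
have [C1 C10 H1] := kF_0_bound c0 L0.
have [C2 C20 H2] := kF1_0_bound c0 L0.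
have [C3 C30 H3] := kdec_small L c0 eps0.
pose D := C2 ^+ 2 / k1 + C1 ^+ 2 + C3 ^+ 2 * y0 / (2 * k1).
have D0 : 0 <= D.
  apply: addr_ge0; [apply: addr_ge0|]; last 1 first.
  - by apply: divr_ge0; apply: mulr_ge0 => //; rewrite ?sqr_ge0// ltW.
  - by apply: divr_ge0; rewrite ?sqr_ge0// ltW.
  - exact: sqr_ge0.
exists (Num.sqrt D); first exact: sqrtr_ge0.
move=> h k s /andP[h0 h1] kk s0.
have k0 : 0 < k by apply: lt_le_trans kk.
have q1 : Num.sqrt h <= 1 by rewrite -sqrtr1 ler_sqrt.
have q0 : 0 <= Num.sqrt h by exact: sqrtr_ge0.
have qE : Num.sqrt h ^+ 2 = h by rewrite sqr_sqrtr// ltW.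
have A0 : 0 <= rho h by apply: (le_trans (normr_ge0 _) (@rhoP h k 0 h0 _)); rewrite lexx ltW.
have r1 : rho h ^+ 2 <= C3 ^+ 2.
  rewrite ler_pXn2r ?nnegrE//.
  by apply: (le_trans (H3 h h0)); rewrite -mulrA ler_piMr// mulr_ile1// ltW.
have := ode_energy h0 y00 (fun s _ => kF_d c0 (- k) s h0 (ltW L0)) (fun s _ => kF1_d c0 (- k) s h0 (ltW L0))
   (fun s _ => kF_ode c0 (- k) s h0 (ltW L0)) (fun s => @rhoP h (- k) s h0) k0 erefl s0.
have a1 : kF c h L (- k) 0 ^+ 2 <= C1 ^+ 2.
  by rewrite -(real_normK (num_real _)) ler_pXn2r ?nnegrE// H1.
have a2 : h * kF1 c h L (- k) 0 ^+ 2 <= C2 ^+ 2.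
  have : (h * `|kF1 c h L (- k) 0|) ^+ 2 <= (C2 * Num.sqrt h) ^+ 2.
    by rewrite ler_pXn2r ?nnegrE ?mulr_ge0 ?(ltW h0)// H2.
  by rewrite !exprMn qE real_normK ?num_real// expr2 -mulrA mulrC ler_pM2r.
move=> H.
rewrite -sqrtr_sqr ler_sqrt//.
rewrite -(ler_pM2l k0); apply: (le_trans H).
have t1 : C2 ^+ 2 <= k * (C2 ^+ 2 / k1).
  by rewrite mulrCA ler_peMr ?sqr_ge0// ler_pdivlMr// mul1r.
have t3 : C3 ^+ 2 * y0 / 2 <= k * (C3 ^+ 2 * y0 / (2 * k1)).
  rewrite (_ : k * _ = C3 ^+ 2 * y0 / 2 * (k / k1)); last by field; rewrite gt_eqF.
  rewrite ler_peMr//; first by apply: divr_ge0 => //; apply: mulr_ge0; rewrite ?sqr_ge0// ltW.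
  by rewrite ler_pdivlMr// mul1r.
have t2 : k * kF c h L (- k) 0 ^+ 2 <= k * C1 ^+ 2 by rewrite ler_pM2l.
have t4 : rho h ^+ 2 * y0 / 2 <= C3 ^+ 2 * y0 / 2 by rewrite ler_pM2r// ler_pM2r.
rewrite /D !mulrDr.
apply: lerD; last exact: le_trans t4 t3.
apply: lerD => //; exact: le_trans a2 t1.
Qed.

Lemma kF_cvg k e : 0 < e -> exists2 d : R, 0 < d & forall h s : R, 0 < h < d -> 0 <= s <= y0 ->
  `|kF c h L k s - expR (k * s)| <= e.
Proof.
move=> e0.
have [C2 C20 H2] := kF1_0_bound c0 L0.
have [C3 C30 H3] := kdec_small L c0 eps0.
set A := (y0 ^+ 2 + 2 * (2 * y0 + 4 + 4 * `|k|) + 4 * k ^+ 2 * y0 + 1) * expR (2 * `|k| * y0) ^+ 2.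
have AE : A = (y0 ^+ 2 + 2 * (2 * y0 + 4 + 4 * `|k|) + 4 * k ^+ 2 * y0 + 1) * expR (2 * `|k| * y0) ^+ 2 by [].
have A0 : 0 < A.
  apply: mulr_gt0; last by rewrite exprn_gt0// expR_gt0.
  have z1 := sqr_ge0 y0; have z2 : 0 <= 4 * k ^+ 2 * y0.
    by apply: mulr_ge0; [apply: mulr_ge0 => //; exact: sqr_ge0|exact: ltW].
  apply: ltr_wpDl => //; apply: addr_ge0 => //; apply: addr_ge0 => //; apply: mulr_ge0 => //.
  apply: addr_ge0; last exact: mulr_ge0.
  by apply: addr_ge0 => //; apply: mulr_ge0 => //; exact: ltW.
pose B := C3 + C2 + 1.
have B0 : 0 < B by rewrite /B ltr_wpDl// addr_ge0.
have BE : B = C3 + C2 + 1 by [].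
clearbody A B.
have e20 : 0 < e / (2 * A) by rewrite divr_gt0// mulr_gt0.
have [d1 d10 Hd1] := kF_0_cvg c0 L0 k e20.
pose d2 := (e / (2 * A * B)) ^+ 2.
have d20 : 0 < d2 by rewrite exprn_gt0// divr_gt0// !mulr_gt0.
pose d3 := 3 / (16 * (`|k| + 1)).
have k10' : 0 < `|k| + 1 by rewrite ltr_wpDl.
have d30 : 0 < d3 by rewrite divr_gt0// mulr_gt0.
exists (Num.min (Num.min d1 d2) (Num.min 1 d3)); first by rewrite !lt_min d10 d20 d30 ltr01.
move=> h s /andP[h0]; rewrite !lt_min => /andP[/andP[hd1 hd2] /andP[h1 hd3]] s0.
have := ode_cvg h0 y00 (fun s _ => kF_d c0 k s h0 (ltW L0)) (fun s _ => kF1_d c0 k s h0 (ltW L0))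
   (fun s _ => kF_ode c0 k s h0 (ltW L0)) (fun s => @rhoP h k s h0) (ltW h1) _ s0.
have -> : 4 * h * `|k| <= 3 / 4.
  have : h * (16 * (`|k| + 1)) <= 3 by rewrite -ler_pdivlMr ?mulr_gt0// ltW.
  have := ltW h0; have := normr_ge0 k; nra.
move=> /(_ isT); rewrite -AE => /le_trans; apply.
have q0 : 0 <= Num.sqrt h by exact: sqrtr_ge0.
have qE : Num.sqrt h ^+ 2 = h by rewrite sqr_sqrtr// ltW.
have q1 : Num.sqrt h <= 1 by rewrite -sqrtr1 ler_sqrt// ltW.
have qd : Num.sqrt h <= e / (2 * A * B).
  rewrite -(ler_pXn2r (_ : 0 < 2)%N) ?nnegrE// ?qE ?(ltW hd2)//.
  by rewrite ltW// divr_gt0// !mulr_gt0.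
have r2 : rho h / h <= C3 * Num.sqrt h.
  by rewrite ler_pdivrMr// (le_trans (H3 h h0))// mulrAC.
have r3 : h <= Num.sqrt h by rewrite -{1}qE expr2 ler_piMr.
have r4 := H2 h k h0.
have r5 : `|kF c h L k 0 - 1| <= e / (2 * A) by apply: Hd1; rewrite h0.
have r6 : B * Num.sqrt h <= e / (2 * A).
  rewrite mulrC -ler_pdivlMr// (_ : e / (2 * A) / B = e / (2 * A * B))//.
  by field; rewrite !gt_eqF.
have -> : e = A * (e / (2 * A) + e / (2 * A)) by field; rewrite gt_eqF.
rewrite ler_pM2l//.
have : C3 * Num.sqrt h + C2 * Num.sqrt h + Num.sqrt h = B * Num.sqrt h by rewrite BE; ring.
lra.
Qed.

(** Real form of the kernel; [K_Kr] below identifies it with [K]. *)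
Definition Kr h x t : R := pi^-1 * Int 0 (pi / 2) (fun s => kNr c h x (Num.sqrt (y0 ^+ 2 - t ^+ 2) * sin s)).
Definition Jmode h k w : R :=
  Int (- y0) y0 (fun t => Int (- L) L (fun x => Kr h x t * cos (k * x)) * cos (w * t)).

Let p2 : 0 <= pi / 2 :> R. Proof. by have := pi_ge0 R; lra. Qed.
Let LL : - L <= L. Proof. by have := L0; lra. Qed.
Let yy : - y0 <= y0. Proof. by have := y00; lra. Qed.

Lemma Kr_cont h : 0 < h -> continuous (fun q : R * R => Kr h q.1 q.2).
Proof.
move=> h0; rewrite /Kr; have cr := kNr_cont c0 h0.
have cI' : continuous (fun q : R * R => Int 0 (pi / 2) (fun s => kNr c h q.1 (Num.sqrt (y0 ^+ 2 - q.2 ^+ 2) * sin s))).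
  by apply: (@cont_Int R (R * R)%type (fun q s => kNr c h q.1 (Num.sqrt (y0 ^+ 2 - q.2 ^+ 2) * sin s))) => //; ctn.
by ctn.
Qed.

Lemma kF_cont h k : 0 < h -> continuous (kF c h L k).
Proof.
move=> h0; have cr := kNr_cont c0 h0; have ci := kNi_cont c0 h0.
by apply: (@cont_Int R R (fun s x : R => kNr c h x s * cos (k * x) - kNi c h x s * sin (k * x))) => //; ctn.
Qed.

(** The integrals in [x] and [s] are exchanged. The factor [2 pi] clears the [pi^-1] of [Kr] and the
    1/2 of [kNr_cos]. *)
Lemma Jmode_E h k w : 0 < h -> 2 * pi * Jmode h k w =
  Int (- y0) y0 (fun t => cos (w * t) * Int 0 (pi / 2) (fun s =>
    kF c h L k (Num.sqrt (y0 ^+ 2 - t ^+ 2) * sin s) +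
    kF c h L (- k) (Num.sqrt (y0 ^+ 2 - t ^+ 2) * sin s))).
Proof.
move=> h0; have cr := kNr_cont c0 h0; have cK := Kr_cont h0.
have c1 := @kF_cont h k h0; have c2' := @kF_cont h (- k) h0.
have cJ : continuous (fun t : R => Int (- L) L (fun x => Kr h x t * cos (k * x))).
  by apply: (@cont_Int R R (fun t x : R => Kr h x t * cos (k * x))) => //; ctn.
rewrite /Jmode -IntZ; last by ctn.
apply: eq_Int => t _; rewrite mulrA [RHS]mulrC; congr (_ * _).
have crt : continuous (fun q : R * R => kNr c h q.1 (Num.sqrt (y0 ^+ 2 - t ^+ 2) * sin q.2) * cos (k * q.1)) by ctn.
rewrite /Kr.
transitivity (2 * pi * (pi^-1 * Int (- L) L (fun x => Int 0 (pi / 2) (fun s => kNr c h x (Num.sqrt (y0 ^+ 2 - t ^+ 2) * sin s) * cos (k * x))))).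
  congr (_ * _); rewrite -IntZ.
    by apply: eq_Int => x _; rewrite -mulrA; congr (_ * _);
       rewrite mulrC -IntZ; [apply: eq_Int => s _; rewrite mulrC|ctn].
  by apply: (@cont_Int R R (fun x s : R => kNr c h x (Num.sqrt (y0 ^+ 2 - t ^+ 2) * sin s) * cos (k * x))).
rewrite (@Int_swap _ (fun x s => kNr c h x (Num.sqrt (y0 ^+ 2 - t ^+ 2) * sin s) * cos (k * x)))//.
rewrite mulrA mulfK; last by rewrite gt_eqF// pi_gt0.
rewrite -IntZ; last by apply: (@cont_Int R R (fun s x : R => kNr c h x (Num.sqrt (y0 ^+ 2 - t ^+ 2) * sin s) * cos (k * x))) => //; ctn.
apply: eq_Int => s _.
by rewrite (kNr_cos c0 k _ h0 (ltW L0)) mulrC divfK.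
Qed.

Let rho_range t s : - y0 <= t <= y0 -> 0 <= s <= pi / 2 ->
  0 <= Num.sqrt (y0 ^+ 2 - t ^+ 2) * sin s <= y0.
Proof.
move=> ty sp.
have s0 : 0 <= sin s.
  case/andP: sp => s0 sp; apply: sin_ge0_pi; rewrite s0/= (le_trans sp)//.
  by have := pi_ge0 R; lra.
have s1 : sin s <= 1 by exact: (le_trans (ler_norm _) (sin_max s)).
rewrite mulr_ge0 ?sqrtr_ge0//=.
apply: (@le_trans _ _ (Num.sqrt (y0 ^+ 2 - t ^+ 2))); first by rewrite ler_piMr ?sqrtr_ge0.
rewrite -[X in _ <= X](ger0_norm (ltW y00)) -sqrtr_sqr ler_sqrt ?sqr_ge0//.
by rewrite gerBl sqr_ge0.
Qed.

(** In the limit the two transforms become [exp (k z)] and [exp (- k z)]. Their sum over [[0, pi/2]]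
    unfolds to the full interval of the spherical mean, in which [k] is the growth rate and [bt] the
    remaining frequency. *)
Lemma Jmode_cvg k bt e : 0 <= k -> 0 < bt -> 0 < e ->
  exists2 d : R, 0 < d & forall h : R, 0 < h < d ->
   `|Jmode h k (Num.sqrt (bt ^+ 2 + k ^+ 2)) - sin (bt * y0) / bt| <= e.
Proof.
move=> k0 bt0 e0.
have pi0 := pi_gt0 R.
have e10 : 0 < e / y0 by rewrite divr_gt0.
have [d1 d10 H1] := kF_cvg k e10.
have [d2 d20 H2] := kF_cvg (- k) e10.
exists (Num.min d1 d2); first by rewrite lt_min d10.
move=> h /andP[h0]; rewrite lt_min => /andP[hd1 hd2].
have c1 := @kF_cont h k h0; have c2' := @kF_cont h (- k) h0.
set w := Num.sqrt _.
rewrite -(ler_pM2l (_ : 0 < 2 * pi :> R)) ?mulr_gt0//.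
rewrite -[X in X * `|_|](@gtr0_norm _ (2 * pi)) ?mulr_gt0// -normrM mulrBr Jmode_E//.
rewrite -(@sphere_mode_t _ y0 bt k)// -/w.
pose f1 (t s : R) := kF c h L k (Num.sqrt (y0 ^+ 2 - t ^+ 2) * sin s) + kF c h L (- k) (Num.sqrt (y0 ^+ 2 - t ^+ 2) * sin s).
pose f2 (t s : R) := expR (k * (Num.sqrt (y0 ^+ 2 - t ^+ 2) * sin s)).
have cf1 : continuous (fun q : R * R => f1 q.1 q.2) by rewrite /f1; ctn.
have cf2 : continuous (fun q : R * R => f2 q.1 q.2) by rewrite /f2; ctn.
have cI1 : continuous (fun t : R => Int 0 (pi / 2) (f1 t)) by apply: (@cont_Int _ _ f1).
have pp : - (pi / 2) <= pi / 2 :> R by lra.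
have cI2 : continuous (fun t : R => Int (- (pi / 2)) (pi / 2) (f2 t)) by apply: (@cont_Int _ _ f2).
rewrite -IntB; [|by ctn|by ctn].
apply: (@le_trans _ _ (e / y0 * pi * (y0 - - y0))); last first.
  by rewrite le_eqVlt; apply/orP; left; apply/eqP; field; rewrite gt_eqF.
apply: Int_bound => //; first by ctn.
move=> t ty; rewrite -mulrBr normrM.
apply: (@le_trans _ _ `|Int 0 (pi / 2) (f1 t) - Int (- (pi / 2)) (pi / 2) (f2 t)|).
  by rewrite ler_piMl// cos_max.
have cf2t : continuous (f2 t) by ctn.
have cf1t : continuous (f1 t) by ctn.
rewrite (Int_fold p2 cf2t) -IntB//; last by ctn.
apply: (@le_trans _ _ (2 * (e / y0) * (pi / 2 - 0))); last first.
  by rewrite subr0 le_eqVlt; apply/orP; left; apply/eqP; field; rewrite gt_eqF.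
apply: Int_bound => //; first by ctn.
move=> s sp; have rr := rho_range ty sp.
have b1 := H1 h _ _ rr; have b2 := H2 h _ _ rr.
rewrite h0 hd1 in b1; rewrite h0 hd2 in b2; have {}b1 := b1 isT; have {}b2 := b2 isT.
rewrite /f1 /f2 sinN !mulrN -mulNr.
set A1 := kF _ _ _ k _ in b1 *; set A2 := kF _ _ _ (- k) _ in b2 *.
rewrite (_ : A1 + A2 - _ = (A1 - expR (k * (Num.sqrt (y0 ^+ 2 - t ^+ 2) * sin s))) + (A2 - expR (- k * (Num.sqrt (y0 ^+ 2 - t ^+ 2) * sin s)))); last by ring.
by apply: (le_trans (ler_normD _ _)); rewrite mulr_natl mulr2n lerD.
Qed.

(** Up to a bounded error the transform is [al * exp (mu s)] with [mu = grow h k], and this term is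
    integrated exactly by the spherical mean. Size estimates alone would lose a factor
    [exp (mu y0)]. *)
Lemma Jmode_bound : exists2 C : R, 0 <= C & forall h k bt : R, 0 < h <= 1 -> (k = 0 \/ k1 <= k) -> 0 < bt ->
   `|Jmode h k (Num.sqrt (bt ^+ 2 + k ^+ 2))| <= C.
Proof.
have pi0 := pi_gt0 R.
have [C1 C10 H1] := kF_growth.
have [C2 C20 H2] := kF_decay.
exists (y0 * (3 * C1 + C2 + C1)).
  by rewrite mulr_ge0 ?(ltW y00)// !addr_ge0// mulr_ge0.
move=> h k bt hh kk bt0; have /andP[h0 h1] := hh.
have k0 : 0 <= k by case: kk => [->//|]; apply: le_trans; exact: ltW.
have [al al1 al2] := H1 h k hh k0.
set mu := grow h k in al2.
have mu0 : 0 <= mu by exact: grow_ge0.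
have muk : mu <= k by exact: grow_le.
have c1 := @kF_cont h k h0; have c2' := @kF_cont h (- k) h0.
set w := Num.sqrt _.
(* For [k = 0] the decay estimate does not apply, but then [mu = 0] and the growth estimate already
   bounds the transform. *)
have neg s : 0 <= s <= y0 -> `|kF c h L (- k) s| <= 2 * C1 + C2.
  move=> sy; case: kk => [kE|kk]; last by apply: (le_trans (H2 h k s hh kk sy)); lra.
  have muE : mu = 0 by apply/eqP; rewrite eq_le mu0 andbT -[X in _ <= X]kE.
  have := al2 s sy; rewrite muE mul0r expR0 mulr1 kE oppr0 => Hs.
  rewrite (_ : kF _ _ _ _ _ = (kF c h L 0 s - al) + al); last by ring.
  apply: (le_trans (ler_normD _ _)); lra.
(* [w^2 - mu^2] is positive: the growing mode is absorbed by the time frequency. *)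
pose kp := Num.sqrt (w ^+ 2 - mu ^+ 2).
have wE : w ^+ 2 = bt ^+ 2 + k ^+ 2 by rewrite sqr_sqrtr// addr_ge0 ?sqr_ge0.
have kp2 : 0 < w ^+ 2 - mu ^+ 2.
  have : mu ^+ 2 <= k ^+ 2 by rewrite ler_pXn2r ?nnegrE.
  have := exprn_gt0 2 bt0; rewrite wE; lra.
have kp0 : 0 < kp by rewrite sqrtr_gt0.
have kpE : kp ^+ 2 = w ^+ 2 - mu ^+ 2 by rewrite sqr_sqrtr// ltW.
have w0 : 0 <= w by exact: sqrtr_ge0.
have wE2 : Num.sqrt (kp ^+ 2 + mu ^+ 2) = w by rewrite kpE subrK sqrtr_sqr ger0_norm.
have sph := @sphere_mode_t _ y0 kp mu y00 kp0; rewrite wE2 in sph.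
have sphb : `|2 * pi * (sin (kp * y0) / kp)| <= 2 * pi * y0.
  rewrite normrM (gtr0_norm (_ : 0 < 2 * pi)) ?mulr_gt0// ler_pM2l ?mulr_gt0//.
  rewrite normrM (gtr0_norm (_ : 0 < kp^-1)) ?invr_gt0// ler_pdivrMr// mulrC.
  by apply: sin_bound; rewrite mulr_ge0// ltW.
rewrite -(ler_pM2l (_ : 0 < 2 * pi :> R)) ?mulr_gt0//.
rewrite -[X in X * `|_|](@gtr0_norm _ (2 * pi)) ?mulr_gt0// -normrM Jmode_E//.
pose f1 (t s : R) := kF c h L k (Num.sqrt (y0 ^+ 2 - t ^+ 2) * sin s) + kF c h L (- k) (Num.sqrt (y0 ^+ 2 - t ^+ 2) * sin s).
pose f2 (t s : R) := expR (mu * (Num.sqrt (y0 ^+ 2 - t ^+ 2) * sin s)).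
have cf1 : continuous (fun q : R * R => f1 q.1 q.2) by rewrite /f1; ctn.
have cf2 : continuous (fun q : R * R => f2 q.1 q.2) by rewrite /f2; ctn.
have cI1 : continuous (fun t : R => Int 0 (pi / 2) (f1 t)) by apply: (@cont_Int _ _ f1).
have pp : - (pi / 2) <= pi / 2 :> R by lra.
have cI2 : continuous (fun t : R => Int (- (pi / 2)) (pi / 2) (f2 t)) by apply: (@cont_Int _ _ f2).
have HD : `|Int (- y0) y0 (fun t => cos (w * t) * Int 0 (pi / 2) (f1 t)) -
    al * Int (- y0) y0 (fun t => cos (w * t) * Int (- (pi / 2)) (pi / 2) (f2 t))| <=
   (3 * C1 + C2 + C1) * (pi / 2) * (y0 - - y0).
  rewrite -IntZ; last by ctn.
  rewrite -IntB; [|by ctn|by ctn].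
  apply: Int_bound => //; first by ctn.
  move=> t ty; rewrite mulrCA -mulrBr normrM.
  apply: (@le_trans _ _ `|Int 0 (pi / 2) (f1 t) - al * Int (- (pi / 2)) (pi / 2) (f2 t)|).
    by rewrite ler_piMl// cos_max.
  have cf2t : continuous (f2 t) by ctn.
  have cf1t : continuous (f1 t) by ctn.
  rewrite (Int_fold p2 cf2t) -IntZ; last by ctn.
  rewrite -IntB//; last by ctn.
  rewrite -[X in _ <= _ * X]subr0.
  apply: Int_bound => //; first by ctn.
  move=> s sp; have rr := rho_range ty sp.
  have b1 := al2 _ rr; have b2 := neg _ rr.
  rewrite /f1 /f2 sinN !mulrN.
  set z := Num.sqrt _ * sin s in b1 b2 rr *.
  have z0 : 0 <= z by case/andP: rr.
  have e1 : `|al * expR (- (mu * z))| <= C1.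
    rewrite normrM (le_trans _ al1)// ler_piMr// gtr0_norm ?expR_gt0// -expR0 ler_expR oppr_le0.
    by rewrite mulr_ge0.
  rewrite (_ : _ - _ = (kF c h L k z - al * expR (mu * z)) + kF c h L (- k) z - al * expR (- (mu * z))); last by ring.
  have n1 := ler_normB (kF c h L k z - al * expR (mu * z) + kF c h L (- k) z) (al * expR (- (mu * z))).
  have n2 := ler_normD (kF c h L k z - al * expR (mu * z)) (kF c h L (- k) z).
  lra.
rewrite sph in HD.
set I1 := Int _ _ _ in HD *.
have : `|I1| <= (3 * C1 + C2 + C1) * (pi / 2) * (y0 - - y0) + C1 * (2 * pi * y0).
  rewrite -(subrK (al * (2 * pi * (sin (kp * y0) / kp))) I1) (le_trans (ler_normD _ _))// lerD//.
  by rewrite normrM ler_pM.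
move=> /le_trans; apply.
rewrite -subr_ge0 (_ : _ - _ = pi * y0 * (3 * C1 + C2 - C1)); last by field.
by rewrite !mulr_ge0 ?(ltW pi0) ?(ltW y00)//; lra.
Qed.
End mode.

(* Identification with the complex kernel *)
From mathcomp Require Import complex.
Section kernel_match.
Context {R : realType}.
Local Open Scope complex_scope.

Lemma complex_eq (a b a' b' : R) : a = a' -> b = b' -> a +i* b = a' +i* b'.
Proof. by move=> -> ->. Qed.

Lemma mulcE (a b a' b' : R) : (a +i* b) * (a' +i* b') = (a * a' - b * b') +i* (a * b' + b * a').
Proof. by []. Qed.

(** [sqrtc (c +i* x)] and its polar candidate [z] both square to [c + i x], hence agree up to sign,
    and both have positive real part. *)
Lemma sqrtc_polar (c x : R) : 0 < c ->
  (sqrtc (c +i* x))^-1 = (expR (- (1 / 4 * ln (c ^+ 2 + x ^+ 2))) * cos (- (1 / 2 * atan (x / c)))) +i*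
                         (expR (- (1 / 4 * ln (c ^+ 2 + x ^+ 2))) * sin (- (1 / 2 * atan (x / c)))).
Proof.
move=> c0.
set W := c ^+ 2 + x ^+ 2; have W0 : 0 < W by rewrite ltr_wpDr ?sqr_ge0// exprn_gt0.
set l := 1 / 4 * ln W; set th := 1 / 2 * atan (x / c).
pose z : R[i] := (expR l * cos th) +i* (expR l * sin th).
have cs : cos th ^+ 2 + sin th ^+ 2 = 1 by exact: cos2Dsin2.
have sW : Num.sqrt W ^+ 2 = W by rewrite sqr_sqrtr// ltW.
have sW0 : 0 < Num.sqrt W by rewrite sqrtr_gt0.
have e2l : expR l ^+ 2 = Num.sqrt W.
  apply/eqP; rewrite -(@eqrXn2 _ 2) ?sqr_ge0 ?sqrtr_ge0// sW -exprM -expRM_natl.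
  by rewrite (_ : _ * l = ln W) ?lnK ?posrE// /l; field.
have sq1 : Num.sqrt (1 + (x / c) ^+ 2) = Num.sqrt W / c.
  rewrite (_ : 1 + _ = W * (c^-1) ^+ 2); last by rewrite /W; field; rewrite gt_eqF.
  by rewrite sqrtrM ?(ltW W0)// sqrtr_sqr ger0_norm// invr_ge0 ltW.
have thE : th + th = atan (x / c) by rewrite /th; field.
have z2 : z ^+ 2 = c +i* x.
  rewrite expr2 mulcE; apply: complex_eq.
    transitivity (expR l ^+ 2 * (cos th * cos th - sin th * sin th)); first by ring.
    rewrite -cosD thE e2l cos_atan sq1; field; by rewrite !gt_eqF.
  transitivity (expR l ^+ 2 * (sin th * cos th + cos th * sin th)); first by ring.
  have sa : sin (atan (x / c)) = x / c * cos (atan (x / c)).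
    have h : tan (atan (x / c)) = x / c by exact: atanK.
    rewrite -{2}h /tan divfK// gt_eqF// cos_gt0_pihalf// atan_gtNpi2 atan_ltpi2//.
  rewrite -sinD thE e2l sa cos_atan sq1; field; by rewrite !gt_eqF.
have z0 : 0 < complex.Re z.
  rewrite /= mulr_gt0 ?expR_gt0//; apply: cos_gt0_pihalf.
  have := atan_gtNpi2 (x / c); have := atan_ltpi2 (x / c); have := pi_gt0 R; rewrite /th; lra.
have s0 := Re_sqrtc_gt0 x c0.
have sE : sqrtc (c +i* x) = z.
  have : (sqrtc (c +i* x) - z) * (sqrtc (c +i* x) + z) = 0.
    by rewrite -subr_sqr sqr_sqrtc z2 subrr.
  move=> /eqP; rewrite mulf_eq0 => /orP[/eqP/subr0_eq//|/eqP H].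
  have : complex.Re (sqrtc (c +i* x) + z) = complex.Re (sqrtc (c +i* x)) + complex.Re z by rewrite raddfD.
  rewrite H [LHS]/= => H2.
  by move: (addr_gt0 s0 z0); rewrite -H2 ltxx.
rewrite sE.
have zn0 : z != 0.
  by apply/eqP => zE; move: z0; rewrite zE ltxx.
apply: (mulfI zn0); rewrite divff// mulcE cosN sinN.
have el : expR l * expR (- l) = 1 by rewrite -expRD subrr expR0.
apply/esym; apply: complex_eq.
  transitivity ((expR l * expR (- l)) * (cos th ^+ 2 + sin th ^+ 2)); first by ring.
  by rewrite el cs mulr1.
by ring.
Qed.

(** Separating real and imaginary parts of [(x + i s)^2 / (c + i x)] produces the exponents of [kR]
    and [kT]; the prefactor splits as [pi^-1 * (4 pi h)^(-1/2)]. *)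
Lemma K_Kr (c y0 h x t : R) : 0 < c -> 0 < h -> K c h x y0 t = Kr c y0 h x t.
Proof.
move=> c0 h0.
have W0 : 0 < c ^+ 2 + x ^+ 2 by rewrite ltr_wpDr ?sqr_ge0// exprn_gt0.
have p0 := pi_gt0 R.
set q := Num.sqrt (y0 ^+ 2 - t ^+ 2).
pose a (s : R) := - ((x ^+ 2 * (c + 2 * s) - s ^+ 2 * c) / (4 * h * (c ^+ 2 + x ^+ 2))).
pose b (s : R) := - ((2 * x * s * c - x * (x ^+ 2 - s ^+ 2)) / (4 * h * (c ^+ 2 + x ^+ 2))).
have expE (s : R) : - ((4 * h)%:C * (c +i* x))^-1 * (x +i* s) ^+ 2 = a s +i* b s.
  have wE : (4 * h)%:C * (c +i* x) = (4 * h * c) +i* (4 * h * x).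
    by rewrite mulcE; apply: complex_eq; ring.
  have nz : (4 * h * c) +i* (4 * h * x) != 0 :> R[i].
    by rewrite eq_complex /= negb_and gt_eqF// !mulr_gt0.
  rewrite wE; apply: (mulfI nz); rewrite mulrA mulrN divff// mulN1r expr2 !mulcE.
  transitivity ((- (x * x - s * s)) +i* (- (x * s + s * x))); first by [].
  rewrite /a /b; apply: complex_eq; field; by rewrite !gt_eqF.
have ca : continuous (fun s => a (q * sin s)).
  by rewrite /a; ctn => s; rewrite gt_eqF// !mulr_gt0.
have cb : continuous (fun s => b (q * sin s)).
  by rewrite /b; ctn => s; rewrite gt_eqF// !mulr_gt0.
rewrite /K sqrtc_polar//.
have -> : (fun s : R => expc (- ((4 * h)%:C * (c +i* x))^-1 * (x +i* (Num.sqrt (y0 ^+ 2 - t ^+ 2) * sin s)) ^+ 2)) =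
   (fun s => (expR (a (q * sin s)) * cos (b (q * sin s))) +i* (expR (a (q * sin s)) * sin (b (q * sin s)))).
  by apply/funext => s; rewrite -/q expE.
set l := expR _; set C := cos (- _); set S := sin (- _).
rewrite /Cintegral /=.
rewrite -/(Int 0 (pi / 2) (fun s => expR (a (q * sin s)) * cos (b (q * sin s)))).
rewrite -/(Int 0 (pi / 2) (fun s => expR (a (q * sin s)) * sin (b (q * sin s)))).
rewrite -!IntZ; [|by ctn|by ctn].
rewrite -IntB; [|by ctn|by ctn].
rewrite /Kr -/q -!IntZ; [| |by ctn]; last first.
  by have cr := kNr_cont c0 h0; ctn.
apply: eq_Int => s _.
have prefE : (2 * pi `^ (3 / 2) * Num.sqrt h)^-1 = pi^-1 * kA h :> R.
  have -> : pi `^ (3 / 2) = pi * Num.sqrt pi :> R.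
    rewrite (_ : 3 / 2 = 1 + 2^-1); last by field.
    by rewrite powRD ?gt_eqF ?implybT// powRr1 ?(ltW p0)// powR12_sqrt ?(ltW p0).
  rewrite /kA (_ : 4 * pi * h = 2 ^+ 2 * (pi * h)); last by ring.
  rewrite sqrtrM ?sqr_ge0// sqrtr_sqr ger0_norm// sqrtrM ?(ltW p0)//.
  have : 0 < Num.sqrt pi :> R by rewrite sqrtr_gt0.
  have : 0 < Num.sqrt h by rewrite sqrtr_gt0.
  by move: p0; move: (pi : R) => p p0 i1 i2; field; rewrite !gt_eqF.
rewrite prefE -!mulrA; congr (_ * _); rewrite /kNr; congr (_ * _).
have -> : kR c h x (q * sin s) = - (1 / 4 * ln (c ^+ 2 + x ^+ 2)) + a (q * sin s) by [].
have -> : kT c h x (q * sin s) = - (1 / 2 * atan (x / c)) + b (q * sin s) by [].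
rewrite expRD cosD -/l -/C -/S; ring.
Qed.
End kernel_match.

(** * Differential calculus on the half-space *)

Section half_space_calculus.
Context {R : realType}.
Implicit Types (u v : R -> R -> R -> R) (x y t l : R) (g f : R -> R).

(** Constant extension below [y = 0]. Continuity within the half-space becomes ordinary continuity
    on the whole space, which is the form the lemmas on parametric integrals require. *)
Definition clamp u x y t : R := u x (Num.max y 0) t.

Lemma clampE u x y t : 0 <= y -> clamp u x y t = u x y t.
Proof. by move=> y0; rewrite /clamp max_l. Qed.

Lemma continuous_half_spaceP u :
  continuous_half_space u <-> continuous (fun p : R * R * R => clamp u p.1.1 p.1.2 p.2).
Proof.
split.
  move=> /subspace_continuousP H p.
  pose m (p : R * R * R) : R * R * R := (p.1.1, Num.max p.1.2 0, p.2).
  have cm : continuous m by rewrite /m; ctn.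
  have mp q : half_space (m q) by rewrite /half_space/= le_max lexx orbT.
  have Hm : (fun p : R * R * R => u p.1.1 p.1.2 p.2) @ within half_space (nbhs (m p)) --> u (m p).1.1 (m p).1.2 (m p).2.
    exact: H.
  apply: (@cvg_comp _ _ _ m (fun p : R * R * R => u p.1.1 p.1.2 p.2) _ _ _ _ Hm).
  move=> A /= NA; have := cm p _ NA; rewrite /nbhs/=.
  by apply: filterS => q; apply; exact: mp.
move=> H; apply: (@subspace_eq_continuous _ _ _ (fun p : R * R * R => clamp u p.1.1 p.1.2 p.2)).
  by move=> [[x y] t]; rewrite inE /half_space/= => y0; rewrite clampE.
exact: continuous_subspaceT.
Qed.

Lemma is_derive_cvg g y l : is_derive y 1 g l <-> k^-1 * (g (y + k) - g y) @[k --> 0^'] --> l.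
Proof.
have E : (fun h : R => h^-1 *: ((g \o shift y) (h *: (1 : R)) - g y)) = (fun k => k^-1 * (g (y + k) - g y)).
  apply/funext => h.
  have -> : (g \o shift y) (h *: (1 : R)) = g (y + h).
    by rewrite /= addrC; congr (g (_ + _)); exact: mulr1.
  by [].
split.
  move=> H; have := @ex_derive _ _ _ _ _ _ _ H; rewrite /derivable E => c.
  have := @derive_val _ _ _ _ _ _ _ H; rewrite /derive E => <-; exact: c.
move=> H; apply: DeriveDef; first by rewrite /derivable E; apply/cvg_ex; exists l.
by rewrite /derive E; exact: cvg_lim.
Qed.

(* [g] extends the [y]-section of [u] to a function differentiable at [y]:
   this treats interior and boundary points uniformly. *)
Definition is_dy u x y t l : Prop :=
  exists2 g, (forall y', 0 <= y' -> g y' = u x y' t) & is_derive y 1 g l.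

Lemma is_dy_int u x y t l : 0 < y -> is_dy u x y t l -> is_derive y 1 (fun y' => u x y' t) l.
Proof.
move=> y0 [g gu dg]; apply: near_eq_is_derive dg.
near=> z; apply: gu; near: z; exists y => //= z; rewrite /ball_/= ltr_norml => /andP[]; lra.
Unshelve. all: by end_near. Qed.

Lemma is_dy_bnd u x t l : is_dy u x 0 t l ->
  right_quotient (fun y' => u x y' t) 0 @ 0^'+ --> l.
Proof.
move=> [g gu dg].
have := cvg_dnbhs_at_right ((is_derive_cvg g 0 l).1 dg).
apply: cvg_trans; apply: near_eq_cvg; near=> k.
by rewrite /right_quotient !add0r !gu//; near: k; exact: nbhs_right_ge.
Unshelve. all: by end_near. Qed.

Lemma is_dy_dy u x y t l : 0 <= y -> is_dy u x y t l -> dy u x y t = l.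
Proof.
rewrite le_eqVlt => /predU1P[<-|y0] H; rewrite /dy.
  by rewrite ltxx; apply/cvg_lim => //; exact: is_dy_bnd.
by rewrite y0 derive1E; exact: (@derive_val _ _ _ _ _ _ _ (is_dy_int y0 H)).
Qed.

Lemma has_partials_is_dy u x y t : 0 <= y -> has_partials u x y t ->
  is_dy u x y t (dy u x y t).
Proof.
rewrite le_eqVlt => /predU1P[<-|y0] [_ _]; rewrite /dy.
  rewrite ltxx => c; set l := lim _ in c *.
  (* Below the boundary the section is continued by the line of slope [l], which turns the right
     derivative into a two-sided one. *)
  exists (fun y => if 0 <= y then u x y t else u x 0 t + l * y).
    by move=> y' ->.
  apply/is_derive_cvg/cvgrPdist_le => e e0.
  have [d /= d0 Hd] := (cvgrPdist_le _ _).1 c e e0.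
  exists d => //= k kd k0; have [k1|k1] := ltP 0 k.
    by rewrite add0r lexx (ltW k1); have := Hd k kd k1; rewrite /right_quotient add0r.
  have k2 : k < 0 by rewrite lt_neqAle k0.
  rewrite add0r lexx (leNgt 0 k) k2/= addrAC subrr add0r.
  by rewrite mulrCA mulVf// mulr1 subrr normr0 ltW.
rewrite y0 => d; exists (fun y' => u x y' t) => //.
by apply: DeriveDef => //; rewrite derive1E.
Qed.

Definition is_partials u x y t a b d : Prop :=
  [/\ is_derive x 1 (fun x' => u x' y t) a, is_dy u x y t b & is_derive t 1 (fun t' => u x y t') d].

Lemma is_partials_has u x y t a b d : 0 <= y -> is_partials u x y t a b d ->
  [/\ has_partials u x y t, dx u x y t = a, dy u x y t = b & dt u x y t = d].
Proof.
move=> y0 [Ha Hb Hd]; split.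
- split; [exact: (@ex_derive _ _ _ _ _ _ _ Ha)|exact: (@ex_derive _ _ _ _ _ _ _ Hd)|].
  move: y0 Hb; rewrite le_eqVlt => /predU1P[<-|y0] H.
    by rewrite ltxx; apply/cvg_ex; exists b; exact: is_dy_bnd.
  by rewrite y0; exact: (@ex_derive _ _ _ _ _ _ _ (is_dy_int y0 H)).
- by rewrite /dx derive1E; exact: (@derive_val _ _ _ _ _ _ _ Ha).
- exact: is_dy_dy.
- by rewrite /dt derive1E; exact: (@derive_val _ _ _ _ _ _ _ Hd).
Qed.

Lemma has_is_partials u x y t : 0 <= y -> has_partials u x y t ->
  is_partials u x y t (dx u x y t) (dy u x y t) (dt u x y t).
Proof.
move=> y0 H; split; last 2 first.
- exact: has_partials_is_dy.
- by case: H => _ + _; move=> c; apply: DeriveDef => //; rewrite /dt derive1E.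
- by case: H => + _ _; move=> c; apply: DeriveDef => //; rewrite /dx derive1E.
Qed.

Lemma Ck_cont k u : Ck_half_space k u -> continuous_half_space u.
Proof. by case: k => [|k] []. Qed.

Lemma Ck_partials k u x y t : Ck_half_space k.+1 u -> 0 <= y ->
  is_partials u x y t (dx u x y t) (dy u x y t) (dt u x y t).
Proof. by move=> [_ [H _ _ _]] y0; exact/has_is_partials/H. Qed.

Lemma continuous_half_space_ext u v : (forall x y t, 0 <= y -> u x y t = v x y t) ->
  continuous_half_space u -> continuous_half_space v.
Proof.
move=> uv /continuous_half_spaceP cu; apply/continuous_half_spaceP.
suff -> : (fun p : R * R * R => clamp v p.1.1 p.1.2 p.2) = (fun p => clamp u p.1.1 p.1.2 p.2) by [].
by apply/funext => p; rewrite /clamp uv// le_max lexx orbT.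
Qed.

(** Values below [y = 0] are arbitrary, and each partial derivative on the half-space is determined
    by values on the half-space; induction on the order carries this to all of them. *)
Lemma Ck_ext k u v : (forall x y t, 0 <= y -> u x y t = v x y t) ->
  Ck_half_space k u -> Ck_half_space k v.
Proof.
elim: k u v => [|k IH] u v uv [cu H].
  by split=> //; exact: continuous_half_space_ext uv cu.
have cv := continuous_half_space_ext uv cu.
case: H => Hp Hx Hy Ht.
have P x y t : 0 <= y -> is_partials v x y t (dx u x y t) (dy u x y t) (dt u x y t).
  move=> y0; have [a [g gu dg] d] := has_is_partials y0 (Hp x y t y0).
  split.
  - by rewrite (_ : (fun _ => _) = (fun x' => u x' y t))//; apply/funext => z; rewrite uv.
  - by exists g => // y' y'0; rewrite gu// uv.
  - by rewrite (_ : (fun _ => _) = (fun t' => u x y t'))//; apply/funext => z; rewrite uv.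
split=> //; split.
- by move=> x y t y0; have [] := is_partials_has y0 (P x y t y0).
- by apply: IH Hx => x y t y0; have [] := is_partials_has y0 (P x y t y0).
- by apply: IH Hy => x y t y0; have [] := is_partials_has y0 (P x y t y0).
- by apply: IH Ht => x y t y0; have [] := is_partials_has y0 (P x y t y0).
Qed.

(** The partial derivatives may be given by any formulas valid for [y >= 0]; the closure properties
    below are proved in this way. *)
Lemma Ck_build k u ux uy ut : continuous_half_space u ->
  (forall x y t, 0 <= y -> is_partials u x y t (ux x y t) (uy x y t) (ut x y t)) ->
  Ck_half_space k ux -> Ck_half_space k uy -> Ck_half_space k ut ->
  Ck_half_space k.+1 u.
Proof.
move=> cu P Hx Hy Ht; split=> //; split.
- by move=> x y t y0; have [] := is_partials_has y0 (P x y t y0).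
- by apply: Ck_ext Hx => x y t y0; have [] := is_partials_has y0 (P x y t y0).
- by apply: Ck_ext Hy => x y t y0; have [] := is_partials_has y0 (P x y t y0).
- by apply: Ck_ext Ht => x y t y0; have [] := is_partials_has y0 (P x y t y0).
Qed.

Lemma Ck_S k u : Ck_half_space k.+1 u -> Ck_half_space k u.
Proof.
elim: k u => [|k IH] u [cu H]; first by split.
case: H => Hp Hx Hy Ht; split; first exact: cu.
split; [exact: Hp|exact: (IH _ Hx)|exact: (IH _ Hy)|exact: (IH _ Ht)].
Qed.

Lemma Ck_le k m u : (k <= m)%N -> Ck_half_space m u -> Ck_half_space k u.
Proof.
elim: m => [|m IH]; first by rewrite leqn0 => /eqP ->.
rewrite leq_eqVlt => /predU1P[-> //|]; rewrite ltnS => km /Ck_S; exact: IH.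
Qed.

Lemma Ck_cst k (a : R) : Ck_half_space k (fun _ _ _ => a).
Proof.
elim: k a => [|k IH] a; first by split=> //; apply/continuous_half_spaceP; rewrite /clamp; ctn.
apply: (@Ck_build _ _ (fun _ _ _ => 0) (fun _ _ _ => 0) (fun _ _ _ => 0)) => //.
  by apply/continuous_half_spaceP; rewrite /clamp; ctn.
by move=> x y t y0; split; [exact: derC|exists (fun=> a) => //; exact: derC|exact: derC].
Qed.

Lemma Ck_add k u v : Ck_half_space k u -> Ck_half_space k v ->
  Ck_half_space k (fun x y t => u x y t + v x y t).
Proof.
elim: k u v => [|k IH] u v Hu Hv.
  split=> //; apply/continuous_half_spaceP.
  have := (continuous_half_spaceP _).1 (Ck_cont Hu); have := (continuous_half_spaceP _).1 (Ck_cont Hv).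
  by rewrite /clamp => cv cu; ctn.
have [_ [_ ux uy ut]] := Hu; have [_ [_ vx vy vt]] := Hv.
apply: (Ck_build _ _ (IH _ _ ux vx) (IH _ _ uy vy) (IH _ _ ut vt)).
  apply/continuous_half_spaceP.
  have := (continuous_half_spaceP _).1 (Ck_cont Hu); have := (continuous_half_spaceP _).1 (Ck_cont Hv).
  by rewrite /clamp => cv cu; ctn.
move=> x y t y0; have [a1 [g gu b1] d1] := Ck_partials x t Hu y0.
have [a2 [g' gv b2] d2] := Ck_partials x t Hv y0; split.
- exact: derD.
- by exists (fun y => g y + g' y); [move=> y' y'0; rewrite gu// gv|exact: derD].
- exact: derD.
Qed.

Lemma Ck_mul k u v : Ck_half_space k u -> Ck_half_space k v ->
  Ck_half_space k (fun x y t => u x y t * v x y t).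
Proof.
elim: k u v => [|k IH] u v Hu Hv.
  split=> //; apply/continuous_half_spaceP.
  have := (continuous_half_spaceP _).1 (Ck_cont Hu); have := (continuous_half_spaceP _).1 (Ck_cont Hv).
  by rewrite /clamp => cv cu; ctn.
have [_ [_ ux uy ut]] := Hu; have [_ [_ vx vy vt]] := Hv.
have Hu' := Ck_S Hu; have Hv' := Ck_S Hv.
apply: (Ck_build _ _ (Ck_add (IH _ _ ux Hv') (IH _ _ Hu' vx)) (Ck_add (IH _ _ uy Hv') (IH _ _ Hu' vy))
  (Ck_add (IH _ _ ut Hv') (IH _ _ Hu' vt))).
  apply/continuous_half_spaceP.
  have := (continuous_half_spaceP _).1 (Ck_cont Hu); have := (continuous_half_spaceP _).1 (Ck_cont Hv).
  by rewrite /clamp => cv cu; ctn.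
move=> x y t y0; have [a1 [g gu b1] d1] := Ck_partials x t Hu y0.
have [a2 [g' gv b2] d2] := Ck_partials x t Hv y0; split.
- exact: derM.
- exists (fun y => g y * g' y); first by move=> y' y'0; rewrite gu// gv.
  by rewrite -gu// -gv//; exact: derM.
- exact: derM.
Qed.

Lemma Ck_scale k u (a : R) : Ck_half_space k u -> Ck_half_space k (fun x y t => a * u x y t).
Proof. by move=> Hu; exact: Ck_mul (Ck_cst k a) Hu. Qed.

Lemma is_dy_section u x y t l : is_derive y 1 (fun y' => u x y' t) l -> is_dy u x y t l.
Proof. by move=> d; exists (fun y' => u x y' t). Qed.

Lemma Ck_affine k u (x0 a t0 b : R) : Ck_half_space k u ->
  Ck_half_space k (fun x y t => u (x0 + a * x) y (t0 + b * t)).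
Proof.
elim: k u => [|k IH] u Hu.
  split=> //; apply/continuous_half_spaceP.
  by have := (continuous_half_spaceP _).1 (Ck_cont Hu); rewrite /clamp => cu; apply: (@cont_comp3 _ _ _ _ _ (fun x y t => u x (Num.max y 0) t)) => //; ctn.
have [_ [_ ux uy ut]] := Hu.
apply: (Ck_build _ _ (Ck_scale a (IH _ ux)) (IH _ uy) (Ck_scale b (IH _ ut))).
  apply/continuous_half_spaceP.
  by have := (continuous_half_spaceP _).1 (Ck_cont Hu); rewrite /clamp => cu; apply: (@cont_comp3 _ _ _ _ _ (fun x y t => u x (Num.max y 0) t)) => //; ctn.
move=> x y t y0; have [a1 b1 d1'] := Ck_partials (x0 + a * x) (t0 + b * t) Hu y0.
have da z0 (e z : R) : is_derive z 1 (fun z : R => z0 + e * z) e by der; ring.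
split.
- by apply: (der_eq (@der_comp R (fun x' => u x' y (t0 + b * t)) (fun x => x0 + a * x) x _ _ a1 (da _ _ _))); rewrite mulrC.
- by have [g gu dg] := b1; exists g.
- by apply: (der_eq (@der_comp R (fun t' => u (x0 + a * x) y t') (fun t => t0 + b * t) t _ _ d1' (da _ _ _))); rewrite mulrC.
Qed.

(** The sequence [f] lists the successive derivatives of [f 0]; shifting it is what lets the
    induction pass through the chain rule. *)
Lemma Ck_comp k u (f : nat -> R -> R) : (forall n, continuous (f n)) ->
  (forall n x, (n < k)%N -> is_derive x 1 (f n) (f n.+1 x)) ->
  Ck_half_space k u -> Ck_half_space k (fun x y t => f 0%N (u x y t)).
Proof.
elim: k u f => [|k IH] u f cf df Hu; have cf0 := cf 0%N.
  split=> //; apply/continuous_half_spaceP.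
  by have := (continuous_half_spaceP _).1 (Ck_cont Hu); rewrite /clamp => cu; ctn.
have [_ [_ ux uy ut]] := Hu.
have H1 : Ck_half_space k (fun x y t => f 1%N (u x y t)).
  apply: (IH u (fun n => f n.+1)) (Ck_S Hu) => [n|n x nk]; [exact: cf|exact: df].
apply: (Ck_build _ _ (Ck_mul H1 ux) (Ck_mul H1 uy) (Ck_mul H1 ut)).
  apply/continuous_half_spaceP.
  by have := (continuous_half_spaceP _).1 (Ck_cont Hu); rewrite /clamp => cu; ctn.
move=> x y t y0; have [a1 [g gu b1] d1'] := Ck_partials x t Hu y0; split.
- exact: (@der_comp R (f 0%N) (fun x' => u x' y t) x _ _ (df _ _ _) a1).
- exists (fun y' => f 0%N (g y')); first by move=> y' y'0; rewrite gu.
  by rewrite -gu//; exact: (@der_comp R (f 0%N) g y _ _ (df _ _ _) b1).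
- exact: (@der_comp R (f 0%N) (fun t' => u x y t') t _ _ (df _ _ _) d1').
Qed.

Lemma Ck_coord_x k : Ck_half_space k (fun x _ _ : R => x).
Proof.
have cx : continuous_half_space (fun x _ _ : R => x).
  by apply/continuous_half_spaceP; rewrite /clamp; ctn.
case: k => [|k]; first by split.
apply: (Ck_build cx _ (Ck_cst k 1) (Ck_cst k 0) (Ck_cst k 0)) => x y t y0.
by split; [exact: derI|apply: is_dy_section; exact: derC|exact: derC].
Qed.

Lemma Ck_coord_y k : Ck_half_space k (fun _ y _ : R => y).
Proof.
have cx : continuous_half_space (fun _ y _ : R => y).
  by apply/continuous_half_spaceP; rewrite /clamp; ctn.
case: k => [|k]; first by split.
apply: (Ck_build cx _ (Ck_cst k 0) (Ck_cst k 1) (Ck_cst k 0)) => x y t y0.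
by split; [exact: derC|apply: is_dy_section; exact: derI|exact: derC].
Qed.

Lemma Ck_coord_t k : Ck_half_space k (fun _ _ t : R => t).
Proof.
have cx : continuous_half_space (fun _ _ t : R => t).
  by apply/continuous_half_spaceP; rewrite /clamp; ctn.
case: k => [|k]; first by split.
apply: (Ck_build cx _ (Ck_cst k 0) (Ck_cst k 0) (Ck_cst k 1)) => x y t y0.
by split; [exact: derC|apply: is_dy_section; exact: derC|exact: derI].
Qed.

Lemma Ck_cos k u (a p : R) : Ck_half_space k u ->
  Ck_half_space k (fun x y t => cos (a * u x y t + p)).
Proof.
move=> Hu; pose f (n : nat) (x : R) := a ^+ n * cos (a * x + p + n%:R * (pi / 2)).
apply: Ck_ext (@Ck_comp k u f _ _ Hu) => [x y t _|n|n x _].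
- by rewrite /f expr0 mul1r mul0r addr0.
- by rewrite /f; ctn.
- have E : cos (a * x + p + n.+1%:R * (pi / 2)) = - sin (a * x + p + n%:R * (pi / 2)).
    by rewrite -cosDpihalf; congr (cos _); rewrite -natr1; ring.
  by rewrite /f E exprS; der; ring.
Qed.

(** Truncated power, of class [C^(n-1)] for [n >= 1]. It supplies both the cutoff functions and the
    weight of the energy; finite smoothness suffices for them. *)
Definition pospow (n : nat) x : R := Num.max 0 x ^+ n.

Lemma pospow_d n x : (0 < n)%N -> is_derive x 1 (pospow n.+1) (n.+1%:R * pospow n x).
Proof.
move=> n0; rewrite /pospow; have [x0|x0|->] := ltgtP x 0.
- rewrite expr0n -leqn0 leqNgt n0 mulr0.
  have H : is_derive x 1 (fun _ : R => 0 : R) 0 by exact: derC.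
  apply: near_eq_is_derive H.
  near=> z; rewrite max_l ?expr0n//; apply: ltW; near: z; exact: lt_nbhsl.
- have H : is_derive x 1 (fun z : R => z ^+ n.+1) (n.+1%:R * x ^+ n) by der; rewrite -mulr_natl; ring.
  apply: near_eq_is_derive H.
  near=> z; rewrite max_r//; apply: ltW; near: z; exact: lt_nbhsr.
- rewrite expr0n -leqn0 leqNgt n0 mulr0; apply/is_derive_cvg/cvgrPdist_le => e e0.
  have e1 : 0 < Num.min e 1 by rewrite lt_min e0 ltr01.
  exists (Num.min e 1) => //= k kd k0.
  have /andP[ke k1] : (`|k| < e) && (`|k| < 1) by rewrite -lt_min; move: kd; rewrite /ball_/= sub0r normrN.
  rewrite !add0r maxxx expr0n/= subr0 normrN normrM normfV normrX.
  apply: le_trans (ltW ke); rewrite ler_pdivrMl ?normr_gt0//.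
  have m0 : 0 <= Num.max 0 k by rewrite le_max lexx.
  have m1 : Num.max 0 k <= `|k| by rewrite ge_max normr_ge0 ler_norm.
  rewrite ger0_norm//; case: n n0 => // n _.
  rewrite 2!exprS mulrA; apply: le_trans (_ : `|k| * `|k| * 1 <= _); last by rewrite mulr1.
  apply: ler_pM => //; [exact: mulr_ge0|exact: exprn_ge0|by apply: ler_pM|].
  by apply: exprn_ile1 => //; exact: le_trans (ltW k1).
Unshelve. all: by end_near. Qed.

Lemma Ck_pospow k n u : (k < n)%N -> Ck_half_space k u ->
  Ck_half_space k (fun x y t => pospow n (u x y t)).
Proof.
move=> kn Hu; pose f i z := (n ^_ i)%:R * pospow (n - i)%N z : R.
apply: Ck_ext (@Ck_comp k u f _ _ Hu) => [x y t _|i|i z ik].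
- by rewrite /f ffactn0 mul1r subn0.
- by rewrite /f /pospow; ctn.
- rewrite /f ffactnSr natrM -mulrA.
  have i1 : (n - i = (n - i.+1).+1)%N by rewrite subnSK// (ltn_trans ik).
  have := @pospow_d (n - i.+1)%N z; rewrite -i1 subn_gt0 => /(_ (leq_ltn_trans ik kn)) H.
  by apply: (der_eq (derM (derC z (n ^_ i)%:R) H)); ring.
Qed.
End half_space_calculus.

(** * The wave equation and its separated solutions *)

Section wave.
Context {R : realType}.
Implicit Types (u v : R -> R -> R -> R) (x y t l a b : R).

(** First partial derivatives recorded as functions, so that those of sums and modes are read off
    from formulas instead of the limits behind [dx], [dy] and [dt]. *)
Definition jet u ux uy ut : Prop := forall x y t, 0 <= y ->
  is_partials u x y t (ux x y t) (uy x y t) (ut x y t).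

Lemma is_partials_ext u v x y t a b l : (forall x y t, 0 <= y -> u x y t = v x y t) ->
  0 <= y -> is_partials u x y t a b l -> is_partials v x y t a b l.
Proof.
move=> uv y0 [Ha [g gu dg] Hl]; split.
- by rewrite (_ : (fun _ => _) = (fun x' => u x' y t))//; apply/funext => z; rewrite uv.
- by exists g => // y' y'0; rewrite gu// uv.
- by rewrite (_ : (fun _ => _) = (fun t' => u x y t'))//; apply/funext => z; rewrite uv.
Qed.

Lemma jet_ext u v ux uy ut : (forall x y t, 0 <= y -> u x y t = v x y t) ->
  jet u ux uy ut -> jet v ux uy ut.
Proof. by move=> uv H x y t y0; apply: (is_partials_ext uv y0); exact: H. Qed.

Lemma jet_add u ux uy ut v vx vy vt : jet u ux uy ut -> jet v vx vy vt ->
  jet (fun x y t => u x y t + v x y t) (fun x y t => ux x y t + vx x y t)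
    (fun x y t => uy x y t + vy x y t) (fun x y t => ut x y t + vt x y t).
Proof.
move=> Hu Hv x y t y0; have [a1 [g gu b1] d1'] := Hu x y t y0.
have [a2 [g' gv b2] d2] := Hv x y t y0; split; [exact: derD| |exact: derD].
by exists (fun y => g y + g' y); [move=> y' y'0; rewrite gu// gv|exact: derD].
Qed.

Lemma jet_scale a u ux uy ut : jet u ux uy ut ->
  jet (fun x y t => a * u x y t) (fun x y t => a * ux x y t)
    (fun x y t => a * uy x y t) (fun x y t => a * ut x y t).
Proof.
move=> Hu x y t y0; have [a1 [g gu b1] d1'] := Hu x y t y0; split.
- by apply: (der_eq (derM (derC x a) a1)); ring.
- by exists (fun y => a * g y); [move=> y' y'0; rewrite gu|apply: (der_eq (derM (derC y a) b1)); ring].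
- by apply: (der_eq (derM (derC t a) d1')); ring.
Qed.

Lemma jet_affine x0 a t0 b u ux uy ut : jet u ux uy ut ->
  jet (fun x y t => u (x0 + a * x) y (t0 + b * t)) (fun x y t => a * ux (x0 + a * x) y (t0 + b * t))
    (fun x y t => uy (x0 + a * x) y (t0 + b * t)) (fun x y t => b * ut (x0 + a * x) y (t0 + b * t)).
Proof.
move=> Hu x y t y0; have [a1 [g gu b1] d1'] := Hu (x0 + a * x) y (t0 + b * t) y0.
have da z0 (e z : R) : is_derive z 1 (fun z : R => z0 + e * z) e by der; ring.
split.
- by apply: (der_eq (@der_comp R (fun x' => u x' y (t0 + b * t)) (fun x => x0 + a * x) x _ _ a1 (da _ _ _))); rewrite mulrC.
- by exists g.
- by apply: (der_eq (@der_comp R (fun t' => u (x0 + a * x) y t') (fun t => t0 + b * t) t _ _ d1' (da _ _ _))); rewrite mulrC.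
Qed.

Lemma jetE u ux uy ut x y t : jet u ux uy ut -> 0 <= y ->
  [/\ dx u x y t = ux x y t, dy u x y t = uy x y t & dt u x y t = ut x y t].
Proof. by move=> H y0; have [] := is_partials_has y0 (H x y t y0). Qed.

Lemma Ck_jet k u : Ck_half_space k.+1 u -> jet u (dx u) (dy u) (dt u).
Proof. by move=> H x y t y0; exact: Ck_partials H y0. Qed.

Definition wave_op u x y t : R := dt (dt u) x y t - dx (dx u) x y t - dy (dy u) x y t.

Lemma wave_opE u ux uy ut uxx uxy uxt uyx uyy uyt utx uty utt x y t :
  jet u ux uy ut -> jet ux uxx uxy uxt -> jet uy uyx uyy uyt -> jet ut utx uty utt ->
  0 <= y -> wave_op u x y t = utt x y t - uxx x y t - uyy x y t.
Proof.
move=> H Hx Hy Ht y0; rewrite /wave_op.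
have E1 : forall x y t, 0 <= y -> ux x y t = dx u x y t by move=> x' y' t' /(jetE x' t' H) [].
have E2 : forall x y t, 0 <= y -> uy x y t = dy u x y t by move=> x' y' t' /(jetE x' t' H) [].
have E3 : forall x y t, 0 <= y -> ut x y t = dt u x y t by move=> x' y' t' /(jetE x' t' H) [].
have [-> _ _] := jetE x t (jet_ext E1 Hx) y0.
have [_ -> _] := jetE x t (jet_ext E2 Hy) y0.
by have [_ _ ->] := jetE x t (jet_ext E3 Ht) y0.
Qed.

Definition wave u : Prop := [/\ Ck_half_space 2 u,
  forall x y t, 0 <= y -> wave_op u x y t = 0 & forall x t, u x 0 t = 0].

Lemma wave_add u v : wave u -> wave v -> wave (fun x y t => u x y t + v x y t).
Proof.
have aux (a b c a' b' c' : R) : a - b - c = 0 -> a' - b' - c' = 0 ->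
  a + a' - (b + b') - (c + c') = 0 by lra.
move=> [cu wu bu] [cv wv bv]; split; [exact: Ck_add| |by move=> x t; rewrite bu bv addr0].
move=> x y t y0; have [_ [_ ux uy ut]] := cu; have [_ [_ vx vy vt]] := cv.
rewrite (wave_opE x t (jet_add (Ck_jet cu) (Ck_jet cv)) (jet_add (@Ck_jet 0 _ ux) (@Ck_jet 0 _ vx))
  (jet_add (@Ck_jet 0 _ uy) (@Ck_jet 0 _ vy)) (jet_add (@Ck_jet 0 _ ut) (@Ck_jet 0 _ vt)) y0).
exact: aux (wu x y t y0) (wv x y t y0).
Qed.

Lemma wave_scale a u : wave u -> wave (fun x y t => a * u x y t).
Proof.
move=> [cu wu bu].
have aux (p q r : R) : p - q - r = 0 -> a * p - a * q - a * r = 0.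
  by move=> pqr; rewrite -!mulrBr pqr mulr0.
split; [exact: Ck_scale| |by move=> x t; rewrite bu mulr0].
move=> x y t y0; have [_ [_ ux uy ut]] := cu.
rewrite (wave_opE x t (jet_scale a (Ck_jet cu)) (jet_scale a (@Ck_jet 0 _ ux))
  (jet_scale a (@Ck_jet 0 _ uy)) (jet_scale a (@Ck_jet 0 _ ut)) y0).
exact: aux (wu x y t y0).
Qed.

Lemma wave_affine x0 a t0 b u : a ^+ 2 = 1 -> b ^+ 2 = 1 -> wave u ->
  wave (fun x y t => u (x0 + a * x) y (t0 + b * t)).
Proof.
move=> a1 b1 [cu wu bu].
have aux (p q r : R) : p - q - r = 0 -> b * (b * p) - a * (a * q) - r = 0.
  by move=> <-; rewrite !mulrA -!expr2 a1 b1 !mul1r.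
split; [exact: Ck_affine| |by move=> x t; rewrite bu].
move=> x y t y0; have [_ [_ ux uy ut]] := cu.
rewrite (wave_opE x t (jet_affine x0 a t0 b (Ck_jet cu)) (jet_scale a (jet_affine x0 a t0 b (@Ck_jet 0 _ ux)))
  (jet_affine x0 a t0 b (@Ck_jet 0 _ uy)) (jet_scale b (jet_affine x0 a t0 b (@Ck_jet 0 _ ut))) y0).
exact: aux (wu (x0 + a * x) y (t0 + b * t) y0).
Qed.

Lemma wave_sum (I : Type) (r : seq I) (F : I -> R -> R -> R -> R) :
  (forall i, wave (F i)) -> wave (fun x y t => \sum_(i <- r) F i x y t).
Proof.
move=> HF; elim: r => [|i r IH].
  rewrite (_ : (fun _ => _) = (fun _ _ _ => 0 * 0)); last first.
    by apply/funext => x; apply/funext => y; apply/funext => t; rewrite big_nil mulr0.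
  apply: (@wave_scale 0 (fun _ _ _ => 0)); split; [exact: (Ck_cst 2 0)| |by []].
  have j0 : jet (fun _ _ _ : R => 0) (fun _ _ _ : R => 0) (fun _ _ _ : R => 0) (fun _ _ _ : R => 0).
    by move=> x y t y0; split; [exact: derC|apply: is_dy_section; exact: derC|exact: derC].
  by move=> x y t y0; rewrite (wave_opE x t j0 j0 j0 j0 y0) subrr subr0.
rewrite (_ : (fun _ => _) = (fun x y t => F i x y t + \sum_(i <- r) F i x y t)); last first.
  by apply/funext => x; apply/funext => y; apply/funext => t; rewrite big_cons.
exact: (wave_add (HF i) IH).
Qed.

Lemma half_space_closure u v : continuous_half_space u -> continuous_half_space v ->
  (forall x y t, 0 < y -> u x y t = v x y t) -> forall x y t, 0 <= y -> u x y t = v x y t.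
Proof.
move=> /continuous_half_spaceP cu /continuous_half_spaceP cv H x y t.
rewrite le_eqVlt => /predU1P[<-|/H//].
have c w : continuous (fun p : R * R * R => clamp w p.1.1 p.1.2 p.2) ->
    clamp w x z t @[z --> 0^'+] --> clamp w x 0 t.
  move=> cw; have l : continuous (fun y : R => clamp w x y t).
    by apply: (@cont_comp3 R R _ _ _ (clamp w)) => //; ctn.
  by apply: cvg_at_right_filter; exact: l.
have l1 := c _ cu; have l2 := c _ cv.
rewrite -(clampE u x t (lexx 0)) -(clampE v x t (lexx 0)).
have l3 : clamp u x z t @[z --> 0^'+] --> clamp v x 0 t.
  apply: cvg_trans l2; apply: near_eq_cvg; near=> z.
  have z0 : 0 < z by near: z; exact: nbhs_right_gt.
  by rewrite !clampE ?H// ltW.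
exact: (cvg_unique _ l1 l3).
Unshelve. all: by end_near. Qed.

(** The second derivatives are continuous up to the boundary, so the equation passes from the open
    half-space to [y = 0]. *)
Lemma wave_op_boundary u : Ck_half_space 2 u ->
  (forall x y t, 0 < y -> wave_op u x y t = 0) -> forall x y t, 0 <= y -> wave_op u x y t = 0.
Proof.
move=> [_ [_ [_ [_ uxx _ _]] [_ [_ _ uyy _]] [_ [_ _ _ utt]]]] H x y t y0.
have H1 := @Ck_cont R 0 _ utt.
have H2 := Ck_cont (@Ck_add R 0 _ _ uxx uyy).
have E a b c : (a - b - c = 0) = (a = b + c) by apply/propext; split; lra.
rewrite /wave_op E; apply: (half_space_closure H1 H2 _ x t y0) => x' y' t' y'0.
by have := H x' y' t' y'0; rewrite /wave_op E.
Qed.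

(* [k ^+ 2 + b ^+ 2 = w ^+ 2] is the dispersion relation. *)
Definition mode k b w x y t : R := cos (k * x) * sin (b * y) * cos (w * t).

Lemma mode_wave k b w : w ^+ 2 = b ^+ 2 + k ^+ 2 -> wave (mode k b w).
Proof.
move=> kbw; split.
- have C3 (a p : R) (f : R -> R -> R -> R) : Ck_half_space 2 f -> Ck_half_space 2 (fun x y t => cos (a * f x y t + p)).
    exact: Ck_cos.
  apply: (Ck_ext _ (Ck_mul (Ck_mul (C3 k 0 _ (Ck_coord_x 2)) (C3 b (- (pi / 2)) _ (Ck_coord_y 2))) (C3 w 0 _ (Ck_coord_t 2)))).
  by move=> x y t _; rewrite !addr0 /mode -cosBpihalf.
- pose m (a : R) (f g h : R -> R) x y t := a * (f (k * x) * g (b * y) * h (w * t)).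
  have j (f g h f' g' h' : R -> R) a : (forall z : R, is_derive z 1 f (f' z)) -> (forall z : R, is_derive z 1 g (g' z)) ->
      (forall z : R, is_derive z 1 h (h' z)) -> jet (m a f g h) (m (a * k) f' g h) (m (a * b) f g' h) (m (a * w) f g h').
    move=> df dg dh.
    have dl (e z : R) : is_derive z 1 (fun z : R => e * z) e by der; ring.
    move=> x y t y0; split.
    + have H := @der_comp R f (fun x => k * x) x _ _ (df _) (dl k x).
      by apply: (der_eq (derM (derC x a) (derM (derM H (derC x (g (b * y)))) (derC x (h (w * t)))))); rewrite /m; ring.
    + apply: is_dy_section; have H := @der_comp R g (fun y => b * y) y _ _ (dg _) (dl b y).
      by apply: (der_eq (derM (derC y a) (derM (derM (derC y (f (k * x))) H) (derC y (h (w * t)))))); rewrite /m; ring.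
    + have H := @der_comp R h (fun t => w * t) t _ _ (dh _) (dl w t).
      by apply: (der_eq (derM (derC t a) (derM (derC t (f (k * x) * g (b * y))) H))); rewrite /m; ring.
  have ds (z : R) : is_derive z 1 (@sin R) (cos z) by exact: is_derive_sin.
  have dcs (z : R) : is_derive z 1 (@cos R) (- sin z) by exact: is_derive_cos.
  have dns (z : R) : is_derive z 1 (fun z : R => - sin z) (- cos z) by der; ring.
  have j0 : jet (mode k b w) (m k (fun z => - sin z) sin cos) (m b cos cos cos) (m w cos sin (fun z => - sin z)).
    apply: (@jet_ext (m 1 cos sin cos)); first by move=> x y t _; rewrite /m mul1r.
    by have := j _ _ _ _ _ _ 1 dcs ds dcs; rewrite !mul1r.
  move=> x y t y0; rewrite (wave_opE x t j0 (j _ _ _ _ _ _ _ dns ds dcs) (j _ _ _ _ _ _ _ dcs dcs dcs) (j _ _ _ _ _ _ _ dcs ds dns) y0).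
  by rewrite /m -!expr2 kbw; ring.
- by move=> x t; rewrite /mode mulr0 sin0 mulr0 mul0r.
Qed.

Lemma mode_partials k b w x y t : 0 <= y -> is_partials (mode k b w) x y t
  (- k * (sin (k * x) * sin (b * y) * cos (w * t)))
  (b * (cos (k * x) * cos (b * y) * cos (w * t)))
  (- w * (cos (k * x) * sin (b * y) * sin (w * t))).
Proof.
move=> y0; split; last 1 first.
- by rewrite /mode; der; ring.
- by rewrite /mode; der; ring.
- by apply: is_dy_section; rewrite /mode; der; ring.
Qed.
End wave.

(** * The energy inequality *)

Section energy.
Context {R : realType}.
Implicit Types (u v d : R -> R -> R -> R) (x y t l a b : R).

Lemma is_derive_uniq (f : R -> R) x a b : is_derive x 1 f a -> is_derive x 1 f b -> a = b.
Proof.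
move=> Ha Hb; rewrite -(@derive_val _ _ _ _ _ _ _ Ha); exact: (@derive_val _ _ _ _ _ _ _ Hb).
Qed.

(** Symmetry of mixed derivatives by integration: [f] is its value at [a] plus the integral of [fs],
    and differentiation under the integral followed by the fundamental theorem gives [fsx]. The
    threshold [lo] permits a second variable confined to the open half-space. *)
Lemma schwarz (f fx fs fsx : R -> R -> R) lo x s l : lo < s ->
  continuous (fun p : R * R => fs p.1 p.2) -> continuous (fun p : R * R => fsx p.1 p.2) ->
  (forall x s, lo < s -> is_derive x 1 (f^~ s) (fx x s)) ->
  (forall x s, lo < s -> is_derive s 1 (f x) (fs x s)) ->
  (forall x s, lo < s -> is_derive x 1 (fs^~ s) (fsx x s)) ->
  is_derive s 1 (fx x) l -> l = fsx x s.
Proof.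
move=> los cfs cfsx Hx Hs Hsx Hl; pose a := (lo + s) / 2.
have loa : lo < a by rewrite /a; lra.
have as_ : a < s by rewrite /a; lra.
clearbody a.
have cfsp q : continuous (fs q) by ctn.
have cfsxp q : continuous (fsx q) by ctn.
have E q s' : a <= s' -> f q s' = f q a + Int a s' (fs q).
  move=> as'; have H (z : R) : a <= z <= s' -> is_derive z 1 (f q) (fs q z).
    by move=> /andP[az _]; apply: Hs; exact: lt_le_trans az.
  by rewrite (Int_FTC as' (cfsp q) H); ring.
have Ex s' : a <= s' -> fx x s' = fx x a + Int a s' (fsx x).
  move=> as'; apply: (is_derive_uniq (Hx x s' (lt_le_trans loa as'))).
  rewrite (_ : (f^~ s') = (fun q => f q a + Int a s' (fs q))); last by apply/funext => q; exact: E.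
  apply: derD; first exact: Hx.
  by apply: is_derive_Int => // z y /andP[ay _]; apply: Hsx; exact: lt_le_trans ay.
apply: (is_derive_uniq Hl).
have H1 : is_derive s 1 (fun s' => fx x a + Int a s' (fsx x)) (fsx x s).
  by apply: (der_eq (derD (derC s (fx x a)) (Int_FTC1 (cfsxp x) as_))); rewrite add0r.
apply: near_eq_is_derive H1; near=> s'.
have as' : a <= s' by apply: ltW; near: s'; exact: lt_nbhsr.
by rewrite /= (Ex _ as').
Unshelve. all: by end_near. Qed.

Lemma dt_dx d x y t : Ck_half_space 2 d -> 0 <= y -> dt (dx d) x y t = dx (dt d) x y t.
Proof.
move=> cd y0; have [_ [_ cx cy ct]] := cd.
have [_ [_ ctx _ _]] := ct; have /continuous_half_spaceP := ct.1.
have /continuous_half_spaceP := ctx.1.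
rewrite /clamp => c1' c2'.
have jd := Ck_jet cd; have jx := @Ck_jet _ 0 _ cx; have jt := @Ck_jet _ 0 _ ct.
have E : Num.max y 0 = y by rewrite max_l.
apply: (@schwarz (fun x t => d x y t) (fun x t => dx d x y t) (fun x t => dt d x y t)
  (fun x t => dx (dt d) x y t) (t - 1) x t).
- lra.
- by rewrite -E; apply: (@cont_comp3 _ _ _ _ _ (fun x y t => dt d x (Num.max y 0) t)) => //; ctn.
- by rewrite -E; apply: (@cont_comp3 _ _ _ _ _ (fun x y t => dx (dt d) x (Num.max y 0) t)) => //; ctn.
- by move=> x' t' _; have [] := jd x' y t' y0.
- by move=> x' t' _; have [] := jd x' y t' y0.
- by move=> x' t' _; have [H _ _] := jt x' y t' y0; exact: H.
- by have [] := jx x y t y0.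
Qed.

(** Obtained from [schwarz] for [y > 0], then carried to the boundary by continuity. *)
Lemma dt_dy d x y t : Ck_half_space 2 d -> 0 <= y -> dt (dy d) x y t = dy (dt d) x y t.
Proof.
move=> cd; have [_ [_ cx cy ct]] := cd.
have [_ [_ _ cty _]] := ct; have [_ [_ _ _ cyt]] := cy.
move: x y t; apply: half_space_closure; [exact: cyt.1|exact: cty.1|].
have /continuous_half_spaceP := cy.1.
have /continuous_half_spaceP := cyt.1.
rewrite /clamp => c1' c2' x y t y0.
have jd := Ck_jet cd; have jy := @Ck_jet _ 0 _ cy; have jt := @Ck_jet _ 0 _ ct.
symmetry; rewrite -[in RHS](max_l (ltW y0)).
apply: (@schwarz (fun t y => d x y t) (fun t y => dt d x y t) (fun t y => dy d x (Num.max y 0) t)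
  (fun t y => dt (dy d) x (Num.max y 0) t) 0 t y _ y0).
- by apply: (@cont_comp3 _ _ _ _ _ (fun x y t => dy d x (Num.max y 0) t)) => //; ctn.
- by apply: (@cont_comp3 _ _ _ _ _ (fun x y t => dt (dy d) x (Num.max y 0) t)) => //; ctn.
- by move=> t' y' y'0; have [] := jd x y' t' (ltW y'0).
- move=> t' y' y'0; have [_ H _] := jd x y' t' (ltW y'0).
  by rewrite max_l ?(ltW y'0)//; exact: is_dy_int.
- by move=> t' y' y'0; have [_ _ H] := jy x y' t' (ltW y'0); rewrite max_l ?(ltW y'0).
- by have [_ H _] := jt x y t (ltW y0); exact: is_dy_int.
Qed.

(** Inside the cone the vector [(x, y)] is shorter than [T]. Cauchy-Schwarz and the inequality of
    the means then show that the energy flux does not exceed the loss caused by the shrinking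
    weight. *)
Lemma cone_dissipation (T x y p q r : R) : 0 <= T -> x ^+ 2 + y ^+ 2 < T ^+ 2 ->
  2 * r * (x * p + y * q) <= T * (p ^+ 2 + q ^+ 2 + r ^+ 2).
Proof.
move=> T0 H; have T1 : 0 < T.
  rewrite lt_neqAle T0 andbT; apply: contraTneq H => <-.
  by rewrite expr0n/= -leNgt addr_ge0// sqr_ge0.
rewrite -(ler_pM2l T1); set A := x * p + y * q.
have H1 : A ^+ 2 <= (x ^+ 2 + y ^+ 2) * (p ^+ 2 + q ^+ 2).
  by have := sqr_ge0 (x * q - y * p); rewrite /A; nra.
have H2 : (x ^+ 2 + y ^+ 2) * (p ^+ 2 + q ^+ 2) <= T ^+ 2 * (p ^+ 2 + q ^+ 2).
  by apply: ler_wpM2r; [rewrite addr_ge0// sqr_ge0|exact: ltW].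
by have := sqr_ge0 (T * r - A); nra.
Qed.

(** Vanishes on the light cone whose vertex is the origin at time [M]. Its truncated square is a
    [C^1] weight, so the energy is an integral over a fixed rectangle and no moving boundary
    enters. *)
Definition cone M x y t : R := (M - t) ^+ 2 - x ^+ 2 - y ^+ 2.

Lemma pospow_eq0 n (z : R) : (0 < n)%N -> z <= 0 -> pospow n z = 0.
Proof. by move=> n0 z0; rewrite /pospow max_l// expr0n -leqn0 leqNgt n0. Qed.

Lemma pospow_ge0 n (z : R) : 0 <= pospow n z.
Proof. by rewrite exprn_ge0// le_max lexx. Qed.

Lemma pospow_cont n : continuous (@pospow R n).
Proof. by rewrite /pospow; ctn. Qed.

Lemma cone_cont M n : continuous (fun z : R * R * R => pospow n (cone M z.1.1 z.1.2 z.2)).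
Proof. by have c := @pospow_cont n; rewrite /cone; ctn. Qed.

Lemma dpospow_cone (g : R -> R) (z a : R) : is_derive z 1 g a ->
  is_derive z 1 (fun z => pospow 2 (g z)) (2 * pospow 1 (g z) * a).
Proof. by move=> dg; exact: (@der_comp R (pospow 2) g z _ _ (pospow_d (g z) (ltnSn 0)) dg). Qed.

Definition energy M (p q r : R -> R -> R -> R) t : R := Int 0 M (fun y => Int (- M) M (fun x =>
  pospow 2 (cone M x y t) * (p x y t ^+ 2 + q x y t ^+ 2 + r x y t ^+ 2))).

(* The first order system satisfied by [(p, q, r) = (dx d, dy d, dt d)]. *)
Lemma energy_le_system M (p q r px rx qy ry : R -> R -> R -> R) t :
  continuous (fun z : R * R * R => p z.1.1 z.1.2 z.2) -> continuous (fun z : R * R * R => q z.1.1 z.1.2 z.2) ->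
  continuous (fun z : R * R * R => r z.1.1 z.1.2 z.2) -> continuous (fun z : R * R * R => px z.1.1 z.1.2 z.2) ->
  continuous (fun z : R * R * R => rx z.1.1 z.1.2 z.2) -> continuous (fun z : R * R * R => qy z.1.1 z.1.2 z.2) ->
  continuous (fun z : R * R * R => ry z.1.1 z.1.2 z.2) ->
  (forall x y t : R, 0 <= y -> is_derive t 1 (p x y) (rx x y t)) ->
  (forall x y t : R, 0 <= y -> is_derive t 1 (q x y) (ry x y t)) ->
  (forall x y t : R, 0 <= y -> is_derive t 1 (r x y) (px x y t + qy x y t)) ->
  (forall x y t : R, 0 <= y -> is_derive x 1 (fun x => p x y t) (px x y t)) ->
  (forall x y t : R, 0 <= y -> is_derive x 1 (fun x => r x y t) (rx x y t)) ->
  (forall x y t : R, 0 < y -> is_derive y 1 (fun y => q x y t) (qy x y t)) ->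
  (forall x y t : R, 0 < y -> is_derive y 1 (fun y => r x y t) (ry x y t)) ->
  (forall x t, r x 0 t = 0) ->
  0 <= t <= M -> energy M p q r t <= energy M p q r 0.
Proof.
move=> kp kq kr kpx krx kqy kry hpt hqt hrt hpx hrx hqy hry r0 /andP[t0 tM].
have M0 : 0 <= M by exact: le_trans tM.
have MM : - M <= M by lra.
pose w x y t := pospow 2 (cone M x y t); pose w1 x y t := pospow 1 (cone M x y t).
have cw : continuous (fun z : R * R * R => w z.1.1 z.1.2 z.2) := @cone_cont M 2.
have cw1 : continuous (fun z : R * R * R => w1 z.1.1 z.1.2 z.2) := @cone_cont M 1.
have dwx (x y t' : R) : is_derive x 1 (fun x => w x y t') (- 4 * x * w1 x y t').
  have H : is_derive x 1 (fun x => cone M x y t') (- 2 * x) by rewrite /cone; der; ring.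
  by apply: (der_eq (dpospow_cone H)); rewrite /w1; ring.
have dwy (x y t' : R) : is_derive y 1 (fun y => w x y t') (- 4 * y * w1 x y t').
  have H : is_derive y 1 (fun y => cone M x y t') (- 2 * y) by rewrite /cone; der; ring.
  by apply: (der_eq (dpospow_cone H)); rewrite /w1; ring.
have dwt (x y t' : R) : is_derive t' 1 (fun t => w x y t) (- 4 * (M - t') * w1 x y t').
  have H : is_derive t' 1 (fun t => cone M x y t) (- 2 * (M - t')) by rewrite /cone; der; ring.
  by apply: (der_eq (dpospow_cone H)); rewrite /w1; ring.
have wM x y t' : 0 <= t' <= M -> M <= `|x| -> w x y t' = 0.
  move=> /andP[t'0 t'M] Mx; apply: pospow_eq0 => //; rewrite /cone.
  have : (M - t') ^+ 2 <= `|x| ^+ 2 by apply: lerXn2r; rewrite ?nnegrE //; lra.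
  by rewrite real_normK ?num_real//; have := sqr_ge0 y; lra.
have wM' x t' : 0 <= t' <= M -> w x M t' = 0.
  move=> /andP[t'0 t'M]; apply: pospow_eq0 => //; rewrite /cone.
  have : (M - t') ^+ 2 <= M ^+ 2 by apply: lerXn2r; rewrite ?nnegrE //; lra.
  by have := sqr_ge0 x; lra.
have w1P x y t' : cone M x y t' <= 0 -> w1 x y t' = 0 by move=> c0; exact: pospow_eq0.
have w1_ge0 x y t' : 0 <= w1 x y t' by exact: pospow_ge0.
pose e x y t := w x y t * (p x y t ^+ 2 + q x y t ^+ 2 + r x y t ^+ 2).
have EE t' : energy M p q r t' = Int 0 M (fun y => Int (- M) M (fun x => e x y t')) by [].
clearbody w w1.
pose e' x y t := - 4 * (M - t) * w1 x y t * (p x y t ^+ 2 + q x y t ^+ 2 + r x y t ^+ 2)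
  + w x y t * (2 * (p x y t * rx x y t + q x y t * ry x y t + r x y t * (px x y t + qy x y t))).
have ce : continuous (fun z : R * R * R => e z.1.1 z.1.2 z.2) by rewrite /e; ctn.
have ce' : continuous (fun z : R * R * R => e' z.1.1 z.1.2 z.2) by rewrite /e'; ctn.
have de (x y t' : R) : 0 <= y -> is_derive t' 1 (e x y) (e' x y t').
  move=> y0; have H := derM (dwt x y t') (derD (derD (der_sqr (hpt x y t' y0)) (der_sqr (hqt x y t' y0))) (der_sqr (hrt x y t' y0))).
  by apply: (der_eq H); rewrite /e'; ring.
(* Once the exact derivatives [fx] and [fy] of the flux are split off, [g] collects all terms in
   which the weight is differentiated; its sign is that of [cone_dissipation]. *)
pose g x y t' := 4 * w1 x y t' * (2 * r x y t' * (x * p x y t' + y * q x y t') - (M - t') * (p x y t' ^+ 2 + q x y t' ^+ 2 + r x y t' ^+ 2)).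
pose fx x y t' := - 4 * x * w1 x y t' * (2 * p x y t' * r x y t')
     + w x y t' * 2 * (px x y t' * r x y t' + p x y t' * rx x y t').
pose fy x y t' := - 4 * y * w1 x y t' * (2 * q x y t' * r x y t')
     + w x y t' * 2 * (qy x y t' * r x y t' + q x y t' * ry x y t').
have e'E x y t' : e' x y t' = g x y t' + fx x y t' + fy x y t'.
  by rewrite /e' /g /fx /fy; ring.
have cfx : continuous (fun z : R * R * R => fx z.1.1 z.1.2 z.2) by rewrite /fx; ctn.
have cfy : continuous (fun z : R * R * R => fy z.1.1 z.1.2 z.2) by rewrite /fy; ctn.
have cg : continuous (fun z : R * R * R => g z.1.1 z.1.2 z.2) by rewrite /g; ctn.
have Ix y t' : 0 <= t' <= M -> 0 <= y -> Int (- M) M (fun x => fx x y t') = 0.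
  move=> t'M y0.
  have H (x : R) : - M <= x <= M -> is_derive x 1 (fun x => w x y t' * 2 * (p x y t' * r x y t')) (fx x y t').
    move=> _; apply: (der_eq (derM (derM (dwx x y t') (derC x 2)) (derM (hpx x y t' y0) (hrx x y t' y0)))).
    by rewrite /fx; ring.
  have cfxy : continuous (fun x => fx x y t') by clear -cfx; ctn.
  by rewrite (Int_FTC MM cfxy H) !wM ?mul0r ?subrr// ?normrN ler_norm.
(* The flux vanishes at [y = 0] by the Dirichlet condition on [r], and at [y = M] by the weight. *)
have Iy x t' : 0 <= t' <= M -> Int 0 M (fun y => fy x y t') = 0.
  move=> t'M.
  have H (y : R) : 0 < y < M -> is_derive y 1 (fun y => w x y t' * 2 * (q x y t' * r x y t')) (fy x y t').
    move=> /andP[y0 _]; apply: (der_eq (derM (derM (dwy x y t') (derC y 2)) (derM (hqy x y t' y0) (hry x y t' y0)))).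
    by rewrite /fy; ring.
  have cfxy : continuous (fun y => fy x y t') by clear -cfy; ctn.
  have cF : continuous (fun y => w x y t' * 2 * (q x y t' * r x y t')) by clear -cw kq kr; ctn.
  rewrite (Int_FTC2 M0 cfxy (continuous_subspaceT cF) H).
  by rewrite r0 wM'// !mulr0 !mul0r subrr.
have g_le x y t' : 0 <= t' <= M -> g x y t' <= 0.
  move=> /andP[t'0 t'M]; have [c0|c0] := leP (cone M x y t') 0; first by rewrite /g w1P// mulr0 mul0r.
  rewrite -oppr_ge0 /g -mulrN; apply: mulr_ge0; first by apply: mulr_ge0.
  rewrite opprB subr_ge0; apply: cone_dissipation; first lra.
  by move: c0; rewrite /cone; lra.
clear hpt hqt hrt hpx hrx hqy hry dwx dwy dwt.
clearbody e e' g fx fy.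
pose E' t := Int 0 M (fun y => Int (- M) M (fun x => e' x y t)).
clear kp kq kr kpx krx kqy kry cw cw1.
have dE (t' : R) : is_derive t' 1 (fun t : R => Int 0 M (fun y => Int (- M) M (fun x => e x y t))) (E' t').
  apply: (@is_derive_Int R (fun t y => Int (- M) M (fun x => e x y t)) (fun t y => Int (- M) M (fun x => e' x y t))) => //.
  - by apply: (@cont_Int R _ (fun (z : R * R) x => e x z.2 z.1)) => //; clear -ce; ctn.
  - by apply: (@cont_Int R _ (fun (z : R * R) x => e' x z.2 z.1)) => //; clear -ce'; ctn.
  - move=> z y /andP[y0 _]; apply: (@is_derive_Int R (fun t x => e x y t) (fun t x => e' x y t)) => //.
    + by clear -ce; ctn.
    + by clear -ce'; ctn.
    + by move=> z' x _; exact: de.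
have E0 t' : 0 <= t' <= M -> E' t' <= 0.
  move=> t'M.
  have c1' y : continuous (fun x => g x y t') by clear -cg; ctn.
  have c2' y : continuous (fun x => fx x y t') by clear -cfx; ctn.
  have c3' y : continuous (fun x => fy x y t') by clear -cfy; ctn.
  have c4 : continuous (fun y => Int (- M) M (fun x => g x y t')).
    by apply: (@cont_Int R _ (fun y x => g x y t')) => //; clear -cg; ctn.
  have c5 : continuous (fun y => Int (- M) M (fun x => fy x y t')).
    by apply: (@cont_Int R _ (fun y x => fy x y t')) => //; clear -cfy; ctn.
  have -> : E' t' = Int 0 M (fun y => Int (- M) M (fun x => g x y t')) + Int 0 M (fun y => Int (- M) M (fun x => fy x y t')).
    rewrite -(IntD _ _ c4 c5); apply: eq_Int => y /andP[y0 _].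
    transitivity (Int (- M) M (fun x => g x y t' + fx x y t' + fy x y t')); first by apply: eq_Int => x _; exact: e'E.
    by rewrite IntD//; [rewrite IntD// Ix// addr0|exact: contD].
  rewrite (@Int_swap R (fun y x => fy x y t'))//; last by clear -cfy; ctn.
  under [X in _ + X]eq_Int do rewrite Iy//.
  rewrite Int0 addr0 -oppr_ge0 -IntN//.
  apply: Int_ge0 => y _; rewrite -IntN//.
  by apply: Int_ge0 => x _; rewrite oppr_ge0; exact: g_le.
have E0' x : 0 <= x <= t -> E' x <= 0.
  by move=> /andP[x0 xt]; apply: E0; rewrite x0 (le_trans xt tM).
have := @le_of_derive_le R _ E' 0 t 0 t0 (fun x _ => dE x) E0'.
by rewrite mul0r subr_le0 !EE.
Qed.

(** Symmetry of mixed derivatives gives the equations for [p] and [q], the wave equation gives the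
    one for [r], and differentiating the Dirichlet condition in time gives [r = 0] on the
    boundary. *)
Lemma energy_le M d t : wave d -> 0 <= t <= M ->
  energy M (clamp (dx d)) (clamp (dy d)) (clamp (dt d)) t <=
  energy M (clamp (dx d)) (clamp (dy d)) (clamp (dt d)) 0.
Proof.
move=> [cd wd bd].
have [_ [_ cx cy ct]] := cd.
have [_ [_ cxx _ cxt]] := cx; have [_ [_ _ cyy cyt]] := cy; have [_ [_ ctx cty ctt]] := ct.
have jd := Ck_jet cd; have jx := @Ck_jet _ 0 _ cx; have jy := @Ck_jet _ 0 _ cy; have jt := @Ck_jet _ 0 _ ct.
have cl0 w : continuous_half_space w -> continuous (fun p : R * R * R => clamp w p.1.1 p.1.2 p.2).
  by move/continuous_half_spaceP.
have cly w wy x y t' : 0 < y -> is_derive y 1 (fun y => w x y t') wy -> is_derive y 1 (fun y => clamp w x y t') wy.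
  move=> y0; apply: near_eq_is_derive; near=> z; rewrite clampE//; apply: ltW; near: z; exact: lt_nbhsr.
have clt w x y t' l : 0 <= y -> is_derive t' 1 (fun t' => w x y t') l -> is_derive t' 1 (clamp w x y) l.
  by move=> y0; rewrite /clamp max_l.
have clx w x y t' l : 0 <= y -> is_derive x 1 (fun x => w x y t') l -> is_derive x 1 (fun x => clamp w x y t') l.
  by move=> y0; rewrite /clamp max_l.
have wE x y t' : 0 <= y -> dt (dt d) x y t' = dx (dx d) x y t' + dy (dy d) x y t'.
  by move=> y0; have := wd x y t' y0; rewrite /wave_op -addrA -opprD => /eqP; rewrite subr_eq0 => /eqP.
apply: (energy_le_system (cl0 _ cx.1) (cl0 _ cy.1) (cl0 _ ct.1) (cl0 _ cxx.1) (cl0 _ ctx.1) (cl0 _ cyy.1) (cl0 _ cty.1)).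
- move=> x y t' y0; rewrite (clampE _ _ _ y0) -(dt_dx x t' cd y0).
  by have [_ _ H] := jx x y t' y0; exact: clt H.
- move=> x y t' y0; rewrite (clampE _ _ _ y0) -(dt_dy x t' cd y0).
  by have [_ _ H] := jy x y t' y0; exact: clt H.
- move=> x y t' y0; rewrite !(clampE _ _ _ y0) -(wE _ _ _ y0).
  by have [_ _ H] := jt x y t' y0; exact: clt H.
- by move=> x y t' y0; rewrite (clampE _ _ _ y0); have [H _ _] := jx x y t' y0; exact: clx H.
- by move=> x y t' y0; rewrite (clampE _ _ _ y0); have [H _ _] := jt x y t' y0; exact: clx H.
- move=> x y t' y0; rewrite (clampE _ _ _ (ltW y0)); have [_ H _] := jy x y t' (ltW y0).
  exact: (cly _ _ _ _ _ y0 (is_dy_int y0 H)).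
- move=> x y t' y0; rewrite (clampE _ _ _ (ltW y0)); have [_ H _] := jt x y t' (ltW y0).
  exact: (cly _ _ _ _ _ y0 (is_dy_int y0 H)).
- move=> x t'; rewrite (clampE _ _ _ (lexx 0)); have [_ _ H0] := jd x 0 t' (lexx 0).
  apply: (is_derive_uniq H0); rewrite (_ : (fun t => d x 0 t) = fun=> 0); first exact: derC.
  by apply/funext => z; exact: bd.
Unshelve. all: by end_near. Qed.
End energy.

(** * Cosine series *)

Section cosine_series.
Context {R : realType}.
Implicit Types (f g phi : R -> R) (x y : R).

Lemma int_bernoulli (a : R) n : 0 <= a -> 1 + n%:R * a <= (1 + a) ^+ n.
Proof.
move=> a0; elim: n => [|n IH]; first by rewrite mul0r addr0 expr0.
have H : (1 + n%:R * a) * (1 + a) <= (1 + a) ^+ n * (1 + a) by apply: ler_wpM2r => //; lra.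
rewrite exprSr; apply: le_trans H; rewrite -natr1.
have : 0 <= n%:R * a * a by apply: mulr_ge0 => //; apply: mulr_ge0.
nra.
Qed.

(** The powers of [b / a > 1] exceed any constant by Bernoulli's inequality; [a = 0] is separate
    because of the quotient. *)
Lemma pow_ratio (a b A B : R) : 0 <= a < b -> 0 < A -> exists N, B * a ^+ N < A * b ^+ N.
Proof.
move=> /andP[a0 ab] A0; have b0 : 0 < b by exact: le_lt_trans ab.
move: a0; rewrite le_eqVlt => /predU1P[<-|a0].
  by exists 1%N; rewrite !expr1 mulr0 mulr_gt0.
pose r := b / a - 1; have r0 : 0 < r by rewrite /r subr_gt0 ltr_pdivlMr// mul1r.
have [N HN] : exists N : nat, B / A / r < N%:R.
  by exists (Num.trunc (B / A / r)).+1; exact: truncnS_gt.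
exists N; have bE : b = (1 + r) * a by rewrite /r addrC subrK divfK ?gt_eqF.
rewrite bE exprMn mulrA ltr_pM2r ?exprn_gt0//.
have H := int_bernoulli N (ltW r0).
rewrite mulrC -ltr_pdivrMr//; apply: lt_le_trans H.
by move: HN; rewrite ltr_pdivrMr//; lra.
Qed.

Lemma Int_pos_zero (f : R -> R) a b : continuous f -> (forall x, a <= x <= b -> 0 <= f x) ->
  Int a b f = 0 -> forall x, a < x < b -> f x = 0.
Proof.
move=> cf f0 I0 x /andP[ax xb]; have ab : a <= b by lra.
have I1 y : a <= y <= b -> Int a y f = 0.
  move=> /andP[ay yb]; apply/eqP; rewrite eq_le.
  have := @Int_split _ f a y b ay yb cf; rewrite I0 => E.
  have h1 : 0 <= Int a y f by apply: Int_ge0 => z /andP[az zy]; apply: f0; rewrite az (le_trans zy).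
  have h2 : 0 <= Int y b f by apply: Int_ge0 => z /andP[az zy]; apply: f0; rewrite zy (le_trans ay).
  by rewrite h1 andbT; lra.
have D := Int_FTC1 cf ax.
have H : is_derive x 1 (fun _ : R => 0 : R) 0 by exact: derC.
apply: (is_derive_uniq D); apply: near_eq_is_derive H.
near=> z; rewrite I1//; apply/andP; split; apply: ltW; near: z; [exact: lt_nbhsr|exact: lt_nbhsl].
Unshelve. all: by end_near. Qed.

Lemma zero_closure (f : R -> R) a b : a < b -> continuous f -> (forall x, a < x < b -> f x = 0) ->
  forall x, a <= x <= b -> f x = 0.
Proof.
move=> ab cf f0 x xab; apply/eqP; apply: contraT => fx.
have fx0 : 0 < `|f x| by rewrite normr_gt0.
have [d /= d0 Hd] := (cvgrPdist_lt _ _).1 (cf x) _ fx0.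
pose d' := Num.min (d / 2) ((b - a) / 2).
have d'0 : 0 < d' by rewrite lt_min; apply/andP; split; lra.
have dd : d' <= d / 2 by rewrite ge_min lexx.
have db : d' <= (b - a) / 2 by rewrite ge_min lexx orbT.
have [z zab zx] : exists2 z, a < z < b & `|x - z| < d.
  have [h|h] := leP x ((a + b) / 2).
    exists (x + d' / 2); last by rewrite opprD addNKr normrN gtr0_norm; lra.
    by apply/andP; split; lra.
  exists (x - d' / 2); last by rewrite opprB addrC subrK gtr0_norm; lra.
  by apply/andP; split; lra.
by have := Hd z zx; rewrite /= (f0 z zab) subr0 ltxx.
Qed.

Section uniqueness.
Variables (P : R) (g : R -> R).
Hypotheses (P0 : 0 < P) (cg : continuous g).
Let kp : R := pi / P.
Hypothesis H0 : forall n : nat, Int 0 P (fun x => g x * cos (n%:R * kp * x)) = 0.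

(** Functions whose product with [g] is still orthogonal to every cosine. Being closed under linear
    combinations and, by the product formula, under multiplication by [cos (kp * x)], this class
    contains all polynomials in that cosine. *)
Let S phi := continuous phi /\
  forall n : nat, Int 0 P (fun x => g x * phi x * cos (n%:R * kp * x)) = 0.

Let S_lin a b phi psi : S phi -> S psi -> S (fun x => a * phi x + b * psi x).
Proof.
move=> [c1 h1] [c2 h2]; split; first by ctn.
move=> n; transitivity (a * Int 0 P (fun x => g x * phi x * cos (n%:R * kp * x)) +
  b * Int 0 P (fun x => g x * psi x * cos (n%:R * kp * x))); last by rewrite h1 h2 !mulr0 addr0.
rewrite -!IntZ; [|by ctn..]; rewrite -IntD; [|by ctn..].
by apply: eq_Int => x _; ring.
Qed.

Let S_cos phi : S phi -> S (fun x => phi x * cos (kp * x)).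
Proof.
move=> [cp h]; split; first by ctn.
case=> [|n].
  rewrite -[RHS](h 1%N); apply: eq_Int => x _.
  by rewrite mul1r !mul0r cos0 mulr1 mulrA.
transitivity (2^-1 * Int 0 P (fun x => g x * phi x * cos (n.+2%:R * kp * x)) +
  2^-1 * Int 0 P (fun x => g x * phi x * cos (n%:R * kp * x))); last by rewrite !h !mulr0 addr0.
rewrite -!IntZ; [|by ctn..]; rewrite -IntD; [|by ctn..].
apply: eq_Int => x _.
have -> : n.+2%:R * kp * x = n.+1%:R * kp * x + kp * x by rewrite -(natr1 n.+1); ring.
have -> : n%:R * kp * x = n.+1%:R * kp * x - kp * x by rewrite -(natr1 n); ring.
by rewrite cosD cosB; field.
Qed.

(** Equal to 1 exactly where the cosine takes the value [z0]. For [z0] between -1 and 1 the square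
    is at most 4, so the divisor 8 keeps the function at least 1/2. *)
Let peak z0 x := 1 - (cos (kp * x) - z0) ^+ 2 / 8.

Let S_peak z0 N : S (fun x => peak z0 x ^+ N).
Proof.
elim: N => [|N IH].
  split; first by under eq_fun do rewrite expr0; exact: contC.
  by move=> n; rewrite -[RHS](H0 n); apply: eq_Int => x _; rewrite expr0 mulr1.
have h1 := S_cos IH; have h2 := S_cos h1.
have := S_lin 1 1 (S_lin (1 - z0 ^+ 2 / 8) (z0 / 4) IH h1) (S_lin 0 (- 8^-1) IH h2).
congr S; apply/funext => x; cbn beta; rewrite [_ ^+ N.+1]exprSr; move: (peak z0 x ^+ N) => p; rewrite /peak.
by field.
Qed.

(** If [g x0] were positive, high powers of [peak] would concentrate the integral near [x0] and make
    it positive, whereas orthogonality makes it 0. *)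
Lemma cosine_uniqueness_pos x0 : 0 < x0 < P -> g x0 <= 0.
Proof.
move=> /andP[x00 x0P]; rewrite leNgt; apply/negP => gx0.
have kp0 : 0 < kp by rewrite divr_gt0 ?pi_gt0.
have kP : kp * P = pi by rewrite /kp divfK// gt_eqF.
pose z0 := cos (kp * x0).
have kx x : 0 <= x <= P -> kp * x \in `[0, pi].
  by move=> /andP[h1 h2]; rewrite in_itv/= -kP mulr_ge0 ?(ltW kp0)// ler_wpM2l// ltW.
have z0b : -1 < z0 < 1.
  rewrite -(cospi R) -(cos0 R) /z0 !ltr_cos ?kx ?in_itv/= ?lexx ?pi_ge0//; last 2 first.
  - by rewrite (ltW x00) ltW.
  - by rewrite (ltW x00) ltW.
  by rewrite -kP ltr_pM2l// x0P mulr_gt0.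
have [d /= d0 Hd] := (cvgrPdist_lt _ _).1 (@cg x0) _ (divr_gt0 gx0 (ltr0n R 2)).
have gpos x : `|x0 - x| < d -> g x0 / 2 <= g x.
  by move=> /Hd; rewrite ltr_norml => /andP[]; lra.
(* The cosine is injective on [[0, pi]], and continuity of [acos] turns closeness of cosines into
   closeness of points. *)
have ca := continuous_acos z0b.
have [d1 /= d10 Hd1] := (cvgrPdist_lt _ _).1 ca _ (mulr_gt0 kp0 d0).
pose D := Num.min d1 1.
have D0 : 0 < D by rewrite lt_min d10 ltr01.
have D1 : D <= 1 by rewrite ge_min lexx orbT.
have near_g x : 0 <= x <= P -> `|z0 - cos (kp * x)| < D -> g x0 / 2 <= g x.
  move=> xP zx; apply: gpos.
  have := Hd1 (cos (kp * x)); rewrite /ball_/= => /(_ (lt_le_trans zx _)).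
  rewrite ge_min lexx => /(_ isT); rewrite /z0 !cosK ?kx ?(ltW x00) ?(ltW x0P)//.
  by rewrite -mulrBr normrM (gtr0_norm kp0) ltr_pM2l.
have cc : continuous (fun x : R => cos (kp * x)) by ctn.
have g20 : 0 < g x0 / 2 := divr_gt0 gx0 (ltr0n R 2).
have D20 : 0 < D / 2 by lra.
have D2D : D / 2 < D by lra.
have [d2 /= d20 Hd2] := (cvgrPdist_lt _ _).1 (cc x0) _ D20.
pose q := Num.min (x0 + d2 / 2) P.
have q0 : x0 < q by rewrite lt_min x0P andbT; lra.
have qP : q <= P by rewrite ge_min lexx orbT.
have qd : q <= x0 + d2 / 2 by rewrite ge_min lexx.
have nearJ x : x0 <= x <= q -> `|z0 - cos (kp * x)| < D / 2.
  by move=> /andP[h1 h2]; apply: Hd2; rewrite /ball_/= distrC ger0_norm; lra.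
clear Hd Hd1 Hd2 gpos.
have [G G0 HG] := @cont_bound R g 0 P cg.
(* [a] bounds [peak] from above where the cosines are at least [D] apart, [b] from below on
   [[x0, q]], where they are within [D / 2]; then [N] is taken so large that [b^N] outweighs
   [a^N]. *)
pose a := 1 - D ^+ 2 / 8; pose b := 1 - (D / 2) ^+ 2 / 8.
have D2 : D ^+ 2 <= 1 by rewrite expr_le1// ltW.
have D3 : 0 < D ^+ 2 by rewrite exprn_gt0.
have ab : 0 <= a < b by rewrite /a /b expr_div_n; lra.
have bge0 : 0 <= b by case/andP: ab => a0 /ltW; exact: le_trans.
have A0 : 0 < g x0 / 2 * (q - x0) by rewrite mulr_gt0// subr_gt0.
have [N HN] := @pow_ratio a b _ (2 * G * P) ab A0.
have pk x : 0 <= peak z0 x.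
  rewrite /peak; have h1 := cos_le1 (kp * x); have h2 := cos_geN1 (kp * x).
  have : (cos (kp * x) - z0) ^+ 2 <= 4 by nra.
  lra.
have cpk : continuous (fun x => g x * peak z0 x ^+ N) by rewrite /peak; ctn.
have low x : 0 <= x <= P -> - (G * a ^+ N) <= g x * peak z0 x ^+ N.
  move=> xP; have [h|h] := ltP `|z0 - cos (kp * x)| D.
    apply: le_trans (_ : 0 <= _); first by rewrite oppr_le0 mulr_ge0// exprn_ge0//; case/andP: ab.
    by rewrite mulr_ge0 ?exprn_ge0// (le_trans (ltW g20) (near_g x xP h)).
  have pa : peak z0 x <= a.
    rewrite /peak /a; have : D ^+ 2 <= (cos (kp * x) - z0) ^+ 2; last lra.
    by rewrite -[leRHS]real_normK ?num_real// distrC; apply: lerXn2r; rewrite ?nnegrE// ltW.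
  have pN : peak z0 x ^+ N <= a ^+ N by apply: lerXn2r; rewrite ?nnegrE//; case/andP: ab.
  have pN0 : 0 <= peak z0 x ^+ N by rewrite exprn_ge0.
  have gG : - G <= g x by have := HG x xP; rewrite ler_norml => /andP[].
  by clear -gG pN pN0 G0; nra.
have lowJ x : x0 <= x <= q -> g x0 / 2 * b ^+ N <= g x * peak z0 x ^+ N.
  move=> xJ; have zJ := nearJ x xJ; case/andP: xJ => h1 h2.
  apply: ler_pM; [exact: ltW|exact: exprn_ge0| |].
    by apply: near_g; [rewrite (le_trans (ltW x00) h1) (le_trans h2 qP)|exact: lt_trans zJ D2D].
  apply: lerXn2r; rewrite ?nnegrE//.
  rewrite /peak /b; have : (cos (kp * x) - z0) ^+ 2 <= (D / 2) ^+ 2; last lra.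
  by rewrite -[leLHS]real_normK ?num_real// distrC; apply: lerXn2r; rewrite ?nnegrE// ltW.
have := (S_peak z0 N).2 0%N.
have -> : Int 0 P (fun x => g x * peak z0 x ^+ N * cos (0%:R * kp * x)) = Int 0 P (fun x => g x * peak z0 x ^+ N).
  by apply: eq_Int => x _; rewrite !mul0r cos0 mulr1.
have qP0 : x0 <= P by exact: ltW.
rewrite (@Int_split _ _ 0 x0 P (ltW x00) qP0 cpk) (@Int_split _ _ x0 q P (ltW q0) qP cpk).
have cst (k : R) : continuous (fun _ : R => k) by exact: contC.
have i1 : - (G * a ^+ N) * (x0 - 0) <= Int 0 x0 (fun x => g x * peak z0 x ^+ N).
  rewrite -Int_cst ?(ltW x00)//; apply: le_Int => // x /andP[h1 h2]; by apply: low; rewrite h1 (le_trans h2 (ltW x0P)).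
have i2 : g x0 / 2 * b ^+ N * (q - x0) <= Int x0 q (fun x => g x * peak z0 x ^+ N).
  by rewrite -Int_cst ?(ltW q0)//; apply: le_Int.
have i3 : - (G * a ^+ N) * (P - q) <= Int q P (fun x => g x * peak z0 x ^+ N).
  rewrite -Int_cst//; apply: le_Int => // x /andP[h1 h2]; by apply: low; rewrite h2 andbT (le_trans (ltW (lt_trans x00 q0)) h1).
have GaN : 0 <= G * a ^+ N by rewrite mulr_ge0// exprn_ge0//; case/andP: ab.
have aux (aN bN q' m P' x0' i1' i2' i3' : R) : 2 * G * P' * aN < m / 2 * (q' - x0') * bN ->
    - (G * aN) * (x0' - 0) <= i1' -> m / 2 * bN * (q' - x0') <= i2' ->
    - (G * aN) * (P' - q') <= i3' -> 0 <= G * aN -> 0 < P' -> x0' < q' -> i1' + (i2' + i3') = 0 -> False.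
  by clear; nra.
exact: aux HN i1 i2 i3 GaN P0 q0.
Qed.
End uniqueness.

Lemma cosine_uniqueness (P : R) g : 0 < P -> continuous g ->
  (forall n : nat, Int 0 P (fun x => g x * cos (n%:R * (pi / P) * x)) = 0) ->
  forall x, 0 <= x <= P -> g x = 0.
Proof.
move=> P0 cg H; apply: zero_closure => // x xP; apply/eqP; rewrite eq_le.
rewrite (cosine_uniqueness_pos P0 cg H xP)/=.
have cNg : continuous (fun x => - g x) by ctn.
have := @cosine_uniqueness_pos P _ P0 cNg _ x xP; rewrite oppr_le0; apply => n.
transitivity (- Int 0 P (fun x => g x * cos (n%:R * (pi / P) * x))); last by rewrite H oppr0.
by rewrite -IntN; [apply: eq_Int => z _; rewrite mulNr|ctn].
Qed.

Lemma cosine_uniqueness2 (P : R) (g : R -> R -> R) : 0 < P ->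
  continuous (fun p : R * R => g p.1 p.2) ->
  (forall m n : nat, Int 0 P (fun x => Int 0 P (fun y =>
     g x y * cos (n%:R * (pi / P) * y)) * cos (m%:R * (pi / P) * x)) = 0) ->
  forall x y, 0 <= x <= P -> 0 <= y <= P -> g x y = 0.
Proof.
move=> P0 cg H x y xP yP; have cgx z : continuous (g z) by ctn.
apply: (cosine_uniqueness P0 (cgx x)) yP => n.
have contI : continuous (fun x => Int 0 P (fun y => g x y * cos (n%:R * (pi / P) * y))).
  by apply: (@cont_Int R _ (fun x y => g x y * cos (n%:R * (pi / P) * y))); [exact: ltW|ctn].
exact: (cosine_uniqueness P0 contI (H^~ n)) xP.
Qed.

Lemma sin_natpi (n : nat) : sin (n%:R * (pi : R)) = 0.
Proof.
elim: n => [|n IH]; first by rewrite mul0r sin0.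
by rewrite -natr1 mulrDl mul1r sinD IH sinpi mul0r mulr0 addr0.
Qed.

Section orthogonality.
Variable (P : R).
Hypothesis P0 : 0 < P.
Let kp : R := pi / P.

Lemma cos_mean (n : nat) : Int 0 P (fun x => cos (n%:R * kp * x)) = if n == 0%N then P else 0.
Proof.
case: eqP => [->|/eqP n0].
  rewrite (_ : Int _ _ _ = Int 0 P (fun=> 1)); last by apply: eq_Int => x _; rewrite !mul0r cos0.
  by rewrite Int_cst ?(ltW P0)// mul1r subr0.
have kp0 : 0 < kp by rewrite divr_gt0 ?pi_gt0.
have nk : n%:R * kp != 0 by rewrite mulf_neq0 ?pnatr_eq0// gt_eqF.
have E : sin (n%:R * kp * P) = 0 by rewrite /kp -mulrA divfK ?gt_eqF// sin_natpi.
move: (n%:R * kp) nk E => a a0 E.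
have cf : continuous (fun x : R => cos (a * x)) by ctn.
have H (x : R) : 0 <= x <= P -> is_derive x 1 (fun x => sin (a * x) / a) (cos (a * x)).
  by move=> _; der; field.
by rewrite (Int_FTC (ltW P0) cf H) E mulr0 sin0 subrr.
Qed.

Lemma cos_orthogonal (m n : nat) :
  Int 0 P (fun x => cos (m%:R * kp * x) * cos (n%:R * kp * x)) =
  if m == n then (if m == 0%N then P else P / 2) else 0.
Proof.
wlog mn : m n / (m <= n)%N.
  move=> H; have [/H//|/ltnW/H E] := leqP m n.
  rewrite (eq_sym m n); transitivity (if n == m then if n == 0%N then P else P / 2 else 0); last first.
    by case: eqP => // ->.
  by rewrite -E; apply: eq_Int => x _; rewrite mulrC.
transitivity (2^-1 * Int 0 P (fun x => cos ((n - m)%:R * kp * x)) + 2^-1 * Int 0 P (fun x => cos ((n + m)%:R * kp * x))).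
  rewrite -!IntZ; [|by ctn..]; rewrite -IntD; [|by ctn..].
  apply: eq_Int => x _; rewrite natrB// natrD.
  have -> : (n%:R - m%:R) * kp * x = n%:R * kp * x - m%:R * kp * x by ring.
  have -> : (n%:R + m%:R) * kp * x = n%:R * kp * x + m%:R * kp * x by ring.
  by rewrite cosB cosD; field.
rewrite !cos_mean subn_eq0 addn_eq0.
have [->|nm] := eqVneq m n.
  by rewrite leqnn andbb; case: eqP => _; field.
rewrite leqNgt ltn_neqAle nm mn/=.
by rewrite (_ : (n == 0%N) && _ = false) ?mulr0 ?addr0//; apply: contraNF nm => /andP[/eqP -> /eqP ->].
Qed.
End orthogonality.
End cosine_series.

(** * Square partial sums and uniform convergence *)

Section double_series.
Context {R : realType}.
Implicit Types (a p : nat -> nat -> R) (N : nat).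

Definition sq N a : R := \sum_(m < N) \sum_(n < N) a m n.

Lemma sqS N a : sq N.+1 a = sq N a + (\sum_(m < N) a m N + \sum_(n < N.+1) a N n).
Proof.
rewrite /sq big_ord_recr/= addrA; congr (_ + _).
by under eq_bigr do rewrite big_ord_recr/=; rewrite big_split.
Qed.

Lemma sq_diff a p N N' : (N <= N')%N -> (forall m n, `|a m n| <= p m n) ->
  `|sq N' a - sq N a| <= sq N' p - sq N p.
Proof.
move=> + ap; elim: N' => [|N' IH]; first by rewrite leqn0 => /eqP ->; rewrite !subrr normr0.
rewrite leq_eqVlt => /predU1P[->|]; first by rewrite !subrr normr0.
rewrite ltnS => /IH H; rewrite !sqS.
have h1 : `|\sum_(m < N') a m N'| <= \sum_(m < N') p m N'.
  by apply: le_trans (ler_norm_sum _ _ _) _; apply: ler_sum.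
have h2 : `|\sum_(n < N'.+1) a N' n| <= \sum_(n < N'.+1) p N' n.
  by apply: le_trans (ler_norm_sum _ _ _) _; apply: ler_sum.
rewrite addrAC [leRHS]addrAC; apply: le_trans (ler_normD _ _) _; apply: lerD => //.
by apply: le_trans (ler_normD _ _) _; exact: lerD.
Qed.

Lemma sqZ N k a : sq N (fun m n => k * a m n) = k * sq N a.
Proof. by rewrite /sq mulr_sumr; apply: eq_bigr => i _; rewrite mulr_sumr. Qed.

Lemma eq_sq N a p : (forall m n, a m n = p m n) -> sq N a = sq N p.
Proof. by move=> H; apply: eq_bigr => i _; apply: eq_bigr => j _. Qed.

Definition maj m n : R := (m.+1%:R ^+ 2)^-1 * (n.+1%:R ^+ 2)^-1.

Lemma maj_ge0 m n : 0 <= maj m n.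
Proof. by rewrite mulr_ge0// invr_ge0 sqr_ge0. Qed.

Lemma sum_inv_sq N : \sum_(i < N) (i.+1%:R ^+ 2)^-1 <= 2 :> R.
Proof.
case: N => [|N]; first by rewrite big_ord0.
suff : \sum_(i < N.+1) (i.+1%:R ^+ 2)^-1 <= 2 - N.+1%:R^-1 :> R.
  by move/le_trans; apply; rewrite gerBl invr_ge0.
elim: N => [|N IH]; first by rewrite big_ord_recr big_ord0/= expr1n invr1; lra.
rewrite big_ord_recr/=; have x0 : 0 < N.+1%:R :> R by [].
have xE : N.+2%:R = N.+1%:R + 1 :> R by rewrite natr1.
have aux (p q r s : R) : p <= 2 - q -> r <= q - s -> p + r <= 2 - s by lra.
apply: aux IH _.
rewrite xE; move: (N.+1%:R) x0 => x x0.
have -> : x^-1 - (x + 1)^-1 = (x * (x + 1))^-1.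
  by field; apply/andP; split; apply: lt0r_neq0; lra.
rewrite lef_pV2 ?posrE ?mulr_gt0 ?exprn_gt0//; nra.
Qed.

(** One null sequence serves as the rate for every series dominated by a multiple of [maj]. *)
Lemma tails : exists2 tau : nat -> R, tau N @[N --> \oo] --> 0 &
  forall N N', (N <= N')%N -> sq N' maj - sq N maj <= tau N.
Proof.
have H N : sq N maj <= 4.
  have -> : sq N maj = (\sum_(i < N) (i.+1%:R ^+ 2)^-1) * (\sum_(i < N) (i.+1%:R ^+ 2)^-1).
    by rewrite mulr_suml; apply: eq_bigr => i _; rewrite mulr_sumr.
  have s0 : 0 <= \sum_(i < N) (i.+1%:R ^+ 2)^-1 :> R by apply: sumr_ge0 => i _; rewrite invr_ge0 sqr_ge0.
  have := @sum_inv_sq N; nra.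
have nd : nondecreasing_seq (fun N => sq N maj).
  move=> N N' NN; rewrite -subr_ge0.
  have mm m n : `|maj m n| <= maj m n by rewrite ger0_norm// maj_ge0.
  exact: le_trans (normr_ge0 _) (sq_diff NN mm).
have cv : cvgn (fun N => sq N maj).
  by apply: nondecreasing_is_cvgn => //; exists 4 => _ [N _ <-].
exists (fun N => limn (fun N => sq N maj) - sq N maj).
  by rewrite -(subrr (limn (fun N => sq N maj))); apply: cvgB => //; exact: cvg_cst.
by move=> N N' _; rewrite lerD2r; exact: nondecreasing_cvgn_le.
Qed.

Lemma uniform_limit (T : topologicalType) (f : nat -> T -> R) (tau : nat -> R) :
  (forall N, continuous (f N)) -> tau N @[N --> \oo] --> 0 ->
  (forall N N' z, (N <= N')%N -> `|f N' z - f N z| <= tau N) ->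
  exists2 F : T -> R, continuous F & forall N z, `|F z - f N z| <= tau N.
Proof.
move=> cf t0 H.
have cv z : cvgn (fun N => f N z).
  apply: cauchy_cvg; apply/cauchy_exP => e e0.
  have [N _ HN] := (cvgrPdist_lt _ _).1 t0 _ e0.
  exists (f N z); exists N => // N' /= NN'; rewrite /ball/= distrC.
  apply: le_lt_trans (H _ _ _ NN') _.
  by have := HN N (leqnn N); rewrite sub0r normrN; exact/le_lt_trans/ler_norm.
have HF N z : `|limn (fun N => f N z) - f N z| <= tau N.
  have l : `|f N' z - f N z| @[N' --> \oo] --> `|limn (fun N => f N z) - f N z|.
    by apply: cvg_norm; apply: cvgB; [exact: cv|exact: cvg_cst].
  rewrite -(cvg_lim _ l)//; apply: limr_le; first by apply/cvg_ex; eexists; exact: l.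
  by exists N => // N' /= NN'; exact: H.
exists (fun z => limn (fun N => f N z)) => // z.
apply/cvgrPdist_lt => e e0; have e3 : 0 < e / 3 by lra.
have [N _ HN] := (cvgrPdist_lt _ _).1 t0 _ e3.
have tN : tau N < e / 3 by have := HN N (leqnn N); rewrite sub0r normrN; exact/le_lt_trans/ler_norm.
have H4 := (cvgrPdist_lt _ _).1 (cf N z) _ e3.
near=> w; have fw : `|f N z - f N w| < e / 3 by near: w; exact: H4.
have h1 := HF N z; have h2 := HF N w; move: fw h1 h2.
move: (limn _) (limn _) => A B; rewrite !ltr_norml !ler_norml => /andP[a1 a2] /andP[b1 b2] /andP[c1' c2'].
by apply/andP; split; lra.
Unshelve. all: by end_near. Qed.
End double_series.

Section cosine_expansion.
Context {R : realType}.
Variables (P : R) (B : R -> R -> R) (C : R).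
Hypotheses (P0 : 0 < P) (cBf : continuous (fun z : R * R => B z.1 z.2)).
Let kp : R := pi / P.

Definition wavenum (n : nat) : R := n%:R * (pi / P).

Definition coeff2 (f : R -> R -> R) (m n : nat) : R :=
  Int 0 P (fun x => Int 0 P (fun y => f x y * cos (wavenum n * y)) * cos (wavenum m * x)).

(** The second index is shifted: [n] stands for the frequency [n.+1]. The frequency 0 in [y] is left
    out because [sin (b y) / b] requires a nonzero [b]; the hypothesis [B0] says that its
    coefficients vanish. *)
Definition cos_coeff m n : R :=
  (if m == 0%N then P^-1 else 2 / P) * (2 / P) * coeff2 B m n.+1.

Let ic (f : R -> R -> R) n : continuous (fun z : R * R => f z.1 z.2) ->
  continuous (fun x => Int 0 P (fun y => f x y * cos (wavenum n * y))).
Proof.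
move=> cf; apply: (@cont_Int R _ (fun x y => f x y * cos (wavenum n * y))); [exact: ltW|ctn].
Qed.

Lemma coeff2B f g m n : continuous (fun z : R * R => f z.1 z.2) -> continuous (fun z : R * R => g z.1 z.2) ->
  coeff2 (fun x y => f x y - g x y) m n = coeff2 f m n - coeff2 g m n.
Proof.
move=> cf cg; have cfx x : continuous (f x) by ctn.
have cgx x : continuous (g x) by ctn.
have cf' := @ic f n cf; have cg' := @ic g n cg.
rewrite /coeff2 -IntB; [|by ctn..].
apply: eq_Int => x _; rewrite -mulrBl -IntB; [|by ctn..].
by congr (_ * _); apply: eq_Int => y _; rewrite mulrBl.
Qed.

Lemma coeff2_bound f m n k : continuous (fun z : R * R => f z.1 z.2) ->
  (forall x y, 0 <= x <= P -> 0 <= y <= P -> `|f x y| <= k) -> `|coeff2 f m n| <= k * P * P.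
Proof.
move=> cf fk; have cfx x : continuous (f x) by ctn.
have cf' := @ic f n cf.
have := @Int_bound R (fun x => Int 0 P (fun y => f x y * cos (wavenum n * y)) * cos (wavenum m * x)) 0 P (k * P) (ltW P0).
rewrite subr0; apply; first by ctn.
move=> x xP; rewrite normrM.
have -> : k * P = k * (P - 0) * 1 by rewrite subr0 mulr1.
apply: ler_pM => //; last by rewrite ler_norml cos_geN1 cos_le1.
apply: Int_bound; [exact: ltW|by ctn|move=> y yP].
rewrite normrM -[leRHS]mulr1; apply: ler_pM => //; first exact: fk.
by rewrite ler_norml cos_geN1 cos_le1.
Qed.

Definition cos_partial (c : nat -> nat -> R) N (x y : R) : R :=
  sq N (fun m n => c m n * (cos (wavenum m * x) * cos (wavenum n.+1 * y))).

Lemma cos_partial_cont c N : continuous (fun z : R * R => cos_partial c N z.1 z.2).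
Proof.
rewrite /cos_partial /sq.
apply: (cont_sum (F := fun (m : 'I_N) (z : R * R) => \sum_(n < N) c m n * (cos (wavenum m * z.1) * cos (wavenum n.+1 * z.2)))) => m.
by apply: (cont_sum (F := fun (n : 'I_N) (z : R * R) => c m n * (cos (wavenum m * z.1) * cos (wavenum n.+1 * z.2)))) => n; ctn.
Qed.

Lemma coeff2_partial c N m' n' : coeff2 (cos_partial c N) m' n' =
  sq N (fun m n => c m n *
    (Int 0 P (fun x => cos (wavenum m * x) * cos (wavenum m' * x)) *
     Int 0 P (fun y => cos (wavenum n.+1 * y) * cos (wavenum n' * y)))).
Proof.
transitivity (Int 0 P (fun x => \sum_(m < N) \sum_(n < N) (c m n * Int 0 P (fun y => cos (wavenum n.+1 * y) * cos (wavenum n' * y))) *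
   (cos (wavenum m * x) * cos (wavenum m' * x)))).
  apply: eq_Int => x _.
  transitivity (Int 0 P (fun y => \sum_(m < N) \sum_(n < N) (c m n * cos (wavenum m * x)) * (cos (wavenum n.+1 * y) * cos (wavenum n' * y))) * cos (wavenum m' * x)).
    congr (_ * _); apply: eq_Int => y _; rewrite /cos_partial /sq mulr_suml; apply: eq_bigr => m _.
    by rewrite mulr_suml; apply: eq_bigr => n _; ring.
  rewrite Int_sum; last first.
    by move=> m; apply: cont_sum => n; ctn.
  rewrite mulr_suml; apply: eq_bigr => m _; rewrite Int_sum; last by move=> n; ctn.
  rewrite mulr_suml; apply: eq_bigr => n _; rewrite IntZ; last by ctn.
  by ring.
rewrite Int_sum; last by move=> m; apply: cont_sum => n; ctn.
apply: eq_bigr => m _; rewrite Int_sum; last by move=> n; ctn.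
apply: eq_bigr => n _; rewrite IntZ; last by ctn.
by ring.
Qed.

Lemma coeff2_partial_eq c N m' n' : (m' < N)%N -> (n' < N)%N ->
  coeff2 (cos_partial c N) m' n'.+1 = c m' n' * ((if m' == 0%N then P else P / 2) * (P / 2)).
Proof.
move=> mN nN; rewrite coeff2_partial /sq (bigD1 (Ordinal mN))//= (bigD1 (Ordinal nN))//=.
rewrite !(cos_orthogonal P0) !eqxx/= big1 => [|n nn]; last first.
  by rewrite !(cos_orthogonal P0) eqSS (_ : (n == n' :> nat) = false) ?mulr0//; apply: contraNF nn.
rewrite big1 => [|m mm]; first by rewrite !addr0.
rewrite big1// => n _; rewrite !(cos_orthogonal P0).
by rewrite (_ : (m == m' :> nat) = false) ?mul0r ?mulr0//; apply: contraNF mm.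
Qed.

Lemma coeff2_partial0 c N m' : coeff2 (cos_partial c N) m' 0 = 0.
Proof. by rewrite coeff2_partial /sq big1// => m _; rewrite big1// => n _; rewrite !(cos_orthogonal P0)/= !mulr0. Qed.

Hypotheses (C0 : 0 <= C) (cle : forall m n, `|cos_coeff m n| <= C * maj m n)
  (B0 : forall x, 0 <= x <= P -> Int 0 P (B x) = 0).

Lemma cos_terms_le m n (x y : R) : `|cos_coeff m n * (cos (wavenum m * x) * cos (wavenum n.+1 * y))| <= C * maj m n.
Proof.
rewrite normrM -[leRHS]mulr1; apply: ler_pM => //.
by rewrite normrM -[leRHS]mulr1; apply: ler_pM => //; rewrite ler_norml cos_geN1 cos_le1.
Qed.

(** Domination makes the series converge uniformly to some continuous [F]; orthogonality gives [F]
    the coefficients of [B], and uniqueness identifies the two. *)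
Lemma cosine_expansion (tau : nat -> R) : tau N @[N --> \oo] --> 0 ->
  (forall N N', (N <= N')%N -> sq N' maj - sq N maj <= tau N) ->
  forall N x y, 0 <= x <= P -> 0 <= y <= P -> `|B x y - cos_partial cos_coeff N x y| <= C * tau N.
Proof.
move=> t0 Ht.
have Ct0 : C * tau N @[N --> \oo] --> 0.
  by rewrite -(mulr0 C); apply: cvgM => //; exact: cvg_cst.
have [||F cF HF] := @uniform_limit R _ (fun N (z : R * R) => cos_partial cos_coeff N z.1 z.2) (fun N => C * tau N) _ Ct0.
- by move=> N; exact: cos_partial_cont.
- move=> N N' z NN; apply: le_trans (sq_diff NN (fun m n => cos_terms_le m n _ _)) _.
  by rewrite !sqZ -mulrBr ler_wpM2l// Ht.
have cF' : continuous (fun z : R * R => F (z.1, z.2)) by ctn.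
have E m n : coeff2 (fun x y => B x y - F (x, y)) m n = 0.
  rewrite (@coeff2B B (fun x y => F (x, y)))//.
  have H N : `|coeff2 (fun x y => F (x, y)) m n - coeff2 (cos_partial cos_coeff N) m n| <= C * tau N * P * P.
    rewrite -(@coeff2B (fun x y => F (x, y)))//; last exact: cos_partial_cont.
    apply: coeff2_bound; last by move=> x y _ _; exact: (HF N (x, y)).
    by have cS := @cos_partial_cont cos_coeff N; exact: contB.
  have [N0 HN] : exists N0, forall N, (N0 <= N)%N -> coeff2 (cos_partial cos_coeff N) m n = coeff2 B m n.
    case: n {H} => [|n].
      exists 0%N => N _; rewrite coeff2_partial0; symmetry; rewrite /coeff2.
      have H x : 0 <= x <= P -> Int 0 P (fun y => B x y * cos (wavenum 0 * y)) * cos (wavenum m * x) = 0.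
        move=> xP; transitivity (Int 0 P (B x) * cos (wavenum m * x)); last by rewrite B0// mul0r.
        by congr (_ * _); apply: eq_Int => y _; rewrite /wavenum !mul0r cos0 mulr1.
      by rewrite (eq_Int H) Int0.
    exists (maxn m n).+1 => N; rewrite gtn_max => /andP[mN nN].
    rewrite coeff2_partial_eq// /cos_coeff.
    by case: eqP => _; field; rewrite gt_eqF.
  apply/eqP; rewrite -normr_le0; apply/ler_addgt0Pl => e e0; rewrite addr0.
  have e'0 : 0 < e / (P * P) by rewrite divr_gt0// mulr_gt0.
  have [N1 _ HN1] := (cvgrPdist_lt _ _).1 Ct0 _ e'0.
  have := HN1 (maxn N0 N1) (leq_maxr _ _); rewrite sub0r normrN => h1.
  rewrite -(HN (maxn N0 N1) (leq_maxl _ _)) distrC; apply: le_trans (H _) _.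
  apply: ltW; rewrite -mulrA -ltr_pdivlMr ?mulr_gt0//; apply: le_lt_trans h1; exact: ler_norm.
move=> N x y xP yP.
have -> : B x y = F (x, y); last exact: (HF N (x, y)).
apply/eqP; rewrite -subr_eq0; apply/eqP.
have cBF : continuous (fun z : R * R => B z.1 z.2 - F (z.1, z.2)) by exact: contB.
exact: (@cosine_uniqueness2 R P (fun x y => B x y - F (x, y)) P0 cBF E).
Qed.
End cosine_expansion.

(** * Decay of the coefficients *)

Section coefficient_decay.
Context {R : realType}.

Lemma cos_ibp2 (P k : R) (f f1 f2 : R -> R) : 0 <= P -> continuous f -> continuous f1 -> continuous f2 ->
  (forall y : R, 0 < y < P -> is_derive y 1 f (f1 y)) -> (forall y : R, 0 < y < P -> is_derive y 1 f1 (f2 y)) ->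
  f1 0 = 0 -> f1 P = 0 -> sin (k * P) = 0 ->
  k ^+ 2 * Int 0 P (fun y => f y * cos (k * y)) = - Int 0 P (fun y => f2 y * cos (k * y)).
Proof.
move=> P0 cf cf1 cf2 d1' d2 f10 f1P skP.
have cF : continuous (fun y => f y * (k * sin (k * y)) + f1 y * cos (k * y)) by ctn.
have cF' : continuous (fun y => k ^+ 2 * (f y * cos (k * y)) + f2 y * cos (k * y)) by ctn.
have H (y : R) : 0 < y < P -> is_derive y 1 (fun y => f y * (k * sin (k * y)) + f1 y * cos (k * y))
    (k ^+ 2 * (f y * cos (k * y)) + f2 y * cos (k * y)).
  move=> yP; have h1 := d1' y yP; have h2 := d2 y yP.
  have s : is_derive y 1 (fun y : R => k * sin (k * y)) (k ^+ 2 * cos (k * y)) by der; ring.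
  have c : is_derive y 1 (fun y : R => cos (k * y)) (- k * sin (k * y)) by der; ring.
  by apply: (der_eq (derD (derM h1 s) (derM h2 c))); ring.
have := Int_FTC2 P0 cF' (continuous_subspaceT cF) H.
rewrite skP f10 f1P mulr0 sin0 !(mulr0, mul0r) addr0 subrr IntD; [|by ctn..].
rewrite IntZ; last by ctn.
by move/eqP; rewrite addr_eq0 => /eqP.
Qed.

Lemma cos_ibp1 (P k : R) (f f1 : R -> R) : 0 <= P -> continuous f -> continuous f1 ->
  (forall y : R, 0 < y < P -> is_derive y 1 f (f1 y)) -> sin (k * P) = 0 ->
  k * Int 0 P (fun y => f y * cos (k * y)) = - Int 0 P (fun y => f1 y * sin (k * y)).
Proof.
move=> P0 cf cf1 d1' skP.
have cF : continuous (fun y => f y * sin (k * y)) by ctn.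
have cF' : continuous (fun y => k * (f y * cos (k * y)) + f1 y * sin (k * y)) by ctn.
have H (y : R) : 0 < y < P -> is_derive y 1 (fun y => f y * sin (k * y))
    (k * (f y * cos (k * y)) + f1 y * sin (k * y)).
  move=> yP; have h1 := d1' y yP.
  have s : is_derive y 1 (fun y : R => sin (k * y)) (k * cos (k * y)) by der; ring.
  by apply: (der_eq (derM h1 s)); ring.
have := Int_FTC2 P0 cF' (continuous_subspaceT cF) H.
rewrite skP [k * 0]mulr0 sin0 !mulr0 subrr IntD; [|by ctn..].
rewrite IntZ; last by ctn.
by move/eqP; rewrite addr_eq0 => /eqP.
Qed.

Lemma sin_wavenum (P : R) n : 0 < P -> sin (wavenum P n * P) = 0.
Proof. by move=> P0; rewrite /wavenum -mulrA divfK ?gt_eqF// sin_natpi. Qed.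

(** Two integrations by parts in [y] and three in [x]. The boundary terms call for [B1] to vanish at
    the ends in [y] and [G1] at the ends in [x]; the third integration in [x] has only sine boundary
    terms, which are 0 there. *)
Lemma coeff2_decay (P : R) (B B1 B2 G1 G2 G3 : R -> R -> R) : 0 < P ->
  continuous (fun z : R * R => B z.1 z.2) -> continuous (fun z : R * R => B1 z.1 z.2) ->
  continuous (fun z : R * R => B2 z.1 z.2) -> continuous (fun z : R * R => G1 z.1 z.2) ->
  continuous (fun z : R * R => G2 z.1 z.2) -> continuous (fun z : R * R => G3 z.1 z.2) ->
  (forall x y : R, 0 < y -> is_derive y 1 (B x) (B1 x y)) ->
  (forall x y : R, 0 < y -> is_derive y 1 (B1 x) (B2 x y)) ->
  (forall x y : R, 0 <= y -> is_derive x 1 (B2^~ y) (G1 x y)) ->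
  (forall x y : R, 0 <= y -> is_derive x 1 (G1^~ y) (G2 x y)) ->
  (forall x y : R, 0 <= y -> is_derive x 1 (G2^~ y) (G3 x y)) ->
  (forall x, B1 x 0 = 0) -> (forall x, B1 x P = 0) ->
  (forall y, 0 <= y -> G1 0 y = 0) -> (forall y, 0 <= y -> G1 P y = 0) ->
  exists2 S : R, 0 <= S & forall m n,
    wavenum P n ^+ 2 * `|coeff2 P B m n| <= S /\
    wavenum P m ^+ 3 * (wavenum P n ^+ 2 * `|coeff2 P B m n|) <= S.
Proof.
move=> P0 kB kB1 kB2 kG1 kG2 kG3 dB1 dB2 dG1 dG2 dG3 B10 B1P G10 G1P.
have P0' := ltW P0.
have [S2 S20 HS2] := @cont_bound2 R B2 0 P 0 P kB2.
have [S3 S30 HS3] := @cont_bound2 R G3 0 P 0 P kG3.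
have w0 n : 0 <= wavenum P n by apply: mulr_ge0 => //; rewrite divr_ge0// pi_ge0.
exists ((S2 + S3) * P * P); first by rewrite !mulr_ge0// addr_ge0.
move=> m n; set k := wavenum P m; set b := wavenum P n.
have cB2k y : continuous (fun x => B2 x y) by clear -kB2; ctn.
have cG2k y : continuous (fun x => G2 x y) by clear -kG2; ctn.
have cG1k y : continuous (fun x => G1 x y) by clear -kG1; ctn.
have cG3k y : continuous (fun x => G3 x y) by clear -kG3; ctn.
have E1 : b ^+ 2 * coeff2 P B m n = - coeff2 P B2 m n.
  have contB : continuous (fun x => Int 0 P (fun y => B x y * cos (b * y))).
    by apply: (@cont_Int R _ (fun x y => B x y * cos (b * y))) => //; clear -kB; ctn.
  have cB2 : continuous (fun x => Int 0 P (fun y => B2 x y * cos (b * y))).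
    by apply: (@cont_Int R _ (fun x y => B2 x y * cos (b * y))) => //; clear -kB2; ctn.
  rewrite /coeff2 -IntZ; last by clear -contB; ctn.
  rewrite -IntN; last by clear -cB2; ctn.
  apply: eq_Int => x _; rewrite mulrA -mulNr; congr (_ * _).
  apply: (@cos_ibp2 P b (B x) (B1 x) (B2 x)) => //.
  - by clear -kB; ctn.
  - by clear -kB1; ctn.
  - by clear -kB2; ctn.
  - by move=> y /andP[y0 _]; exact: dB1.
  - by move=> y /andP[y0 _]; exact: dB2.
  - exact: sin_wavenum.
have E2 : coeff2 P B2 m n = Int 0 P (fun y => Int 0 P (fun x => B2 x y * cos (k * x)) * cos (b * y)).
  rewrite /coeff2.
  transitivity (Int 0 P (fun x => Int 0 P (fun y => B2 x y * cos (b * y) * cos (k * x)))).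
    apply: eq_Int => x _; rewrite mulrC -IntZ; last by clear -kB2; ctn.
    by apply: eq_Int => y _; rewrite mulrC.
  rewrite (@Int_swap R (fun x y => B2 x y * cos (b * y) * cos (k * x)))//; last by clear -kB2; ctn.
  apply: eq_Int => y _; rewrite [RHS]mulrC -IntZ; last by clear -kB2; ctn.
  by apply: eq_Int => x _; ring.
have cc (a : R) : `|cos a| <= 1 by rewrite ler_norml cos_geN1 cos_le1.
have ss (a : R) : `|sin a| <= 1 by rewrite ler_norml sin_geN1 sin_le1.
have bnd (f g : R -> R) S : continuous f -> continuous g -> (forall y, 0 <= y <= P -> `|f y| <= S) ->
    (forall y, `|g y| <= 1) -> `|Int 0 P (fun y => f y * g y)| <= S * P.
  move=> cf cg fS g1; rewrite -[X in _ * X]subr0; apply: Int_bound => //; first by ctn.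
  by move=> y yP; rewrite normrM -[leRHS]mulr1; apply: ler_pM => //; exact: fS.
have cck (a : R) : continuous (fun x : R => cos (a * x)) by ctn.
have csk (a : R) : continuous (fun x : R => sin (a * x)) by ctn.
have contI : continuous (fun y => Int 0 P (fun x => B2 x y * cos (k * x))).
  by apply: (@cont_Int R _ (fun y x => B2 x y * cos (k * x))) => //; clear -kB2; ctn.
have F1 : `|coeff2 P B2 m n| <= S2 * P * P.
  rewrite E2; apply: (@bnd) => // y yP; apply: (@bnd) => // x xP; exact: HS2.
have F2 : k ^+ 3 * `|coeff2 P B2 m n| <= S3 * P * P.
  have k3 : 0 <= k ^+ 3 by rewrite exprn_ge0// w0.
  rewrite -(ger0_norm k3) -normrM E2 -IntZ; last by clear -contI; ctn.
  rewrite (_ : Int _ _ _ = Int 0 P (fun y => (k ^+ 3 * Int 0 P (fun x => B2 x y * cos (k * x))) * cos (b * y))); last first.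
    by apply: eq_Int => y _; rewrite mulrA.
  apply: (@bnd) => //; first by clear -contI; ctn.
  move=> y yP; have y0 : 0 <= y by case/andP: yP.
  have -> : k ^+ 3 * Int 0 P (fun x => B2 x y * cos (k * x)) = Int 0 P (fun x => G3 x y * sin (k * x)).
    have q1 (x : R) : 0 < x < P -> is_derive x 1 (B2^~ y) (G1 x y) by move=> _; exact: dG1.
    have q2 (x : R) : 0 < x < P -> is_derive x 1 (G1^~ y) (G2 x y) by move=> _; exact: dG2.
    have q3 (x : R) : 0 < x < P -> is_derive x 1 (G2^~ y) (G3 x y) by move=> _; exact: dG3.
    have skP : sin (k * P) = 0 by exact: sin_wavenum.
    have e1 := cos_ibp2 P0' (cB2k y) (cG1k y) (cG2k y) q1 q2 (G10 y y0) (G1P y y0) skP.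
    have e2 := cos_ibp1 P0' (cG2k y) (cG3k y) q3 skP.
    by rewrite exprS -mulrA e1 mulrN e2 opprK.
  by apply: (@bnd) => // x xP; exact: HS3.
have b2 : 0 <= b ^+ 2 by exact: sqr_ge0.
have -> : b ^+ 2 * `|coeff2 P B m n| = `|coeff2 P B2 m n|.
  by rewrite -{1}(ger0_norm b2) -normrM E1 normrN.
have PP : 0 <= P * P by rewrite mulr_ge0.
have h3 : 0 <= S3 * P * P by rewrite -mulrA mulr_ge0.
have h2 : 0 <= S2 * P * P by rewrite -mulrA mulr_ge0.
by rewrite !mulrDl; split; [apply: (le_trans F1); rewrite lerDl|apply: (le_trans F2); rewrite lerDr].
Qed.

(** Of the three powers of [k], one pays for the factor [1 + k] and two for summability in [m]. For
    [m >= 1] the constant comes from [m + 1 <= 2 m] and [1 <= m]; the added 1 covers [m = 0]. *)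
Lemma maj_bound (P S K X : R) m n : 0 < P -> 0 <= S -> 0 <= X -> 4 * (1 + pi / P) / (pi / P) ^+ 3 + 1 <= K ->
  wavenum P n.+1 ^+ 2 * X <= S -> wavenum P m ^+ 3 * (wavenum P n.+1 ^+ 2 * X) <= S ->
  X * (1 + wavenum P m) <= 2 * K * S / (pi / P) ^+ 2 * maj m n.
Proof.
move=> P0 S0 X0; rewrite /wavenum /maj; have kp0 : 0 < pi / P by rewrite divr_gt0 ?pi_gt0.
move: (pi / P) kp0 => a a0 HK; set Y := _ ^+ 2 * X => h1 h2.
have XE : X = Y / (a ^+ 2) * (n.+1%:R ^+ 2)^-1.
  have aux (N : R) : N != 0 -> X = (N * a) ^+ 2 * X / (a ^+ 2) * (N ^+ 2)^-1.
    by move=> N0; field; rewrite N0 gt_eqF.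
  by apply: aux; rewrite pnatr_eq0.
have Y0 : 0 <= Y by rewrite mulr_ge0// sqr_ge0.
have K0 : 0 <= K by apply: le_trans HK; rewrite addr_ge0// divr_ge0// ?exprn_ge0 ?(ltW a0)// mulr_ge0//; lra.
have key : (1 + m%:R * a) * (m.+1%:R ^+ 2) <= K * (1 + (m%:R * a) ^+ 3).
  case: m {h1 h2} => [|m].
    rewrite !mul0r expr0n/= !addr0 expr1n !mulr1; apply: le_trans HK.
    by rewrite lerDr divr_ge0// ?exprn_ge0 ?(ltW a0)// mulr_ge0//; lra.
  have m1 : 1 <= m.+1%:R :> R by rewrite ler1n.
  rewrite -(natr1 m.+1); move: (m.+1%:R) m1 => x x1.
  apply: le_trans (_ : (4 * (1 + a) / a ^+ 3) * ((x * a) ^+ 3) <= _); last first.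
    have h : 0 <= 4 * (1 + a) / a ^+ 3 by rewrite divr_ge0// ?exprn_ge0 ?(ltW a0)// mulr_ge0//; lra.
    have h' : 0 <= (x * a) ^+ 3 by rewrite exprn_ge0// mulr_ge0; lra.
    apply: le_trans (_ : K * (x * a) ^+ 3 <= _); first by apply: ler_wpM2r => //; lra.
    by apply: ler_wpM2l => //; lra.
  have -> : 4 * (1 + a) / a ^+ 3 * (x * a) ^+ 3 = (x + x * a) * (2 * x) ^+ 2 by field; rewrite gt_eqF.
  apply: ler_pM; [|exact: sqr_ge0|lra|].
    by rewrite addr_ge0// mulr_ge0; lra.
  by apply: lerXn2r; rewrite ?nnegrE; lra.
have m0 : 0 < m.+1%:R ^+ 2 :> R by rewrite exprn_gt0.
have n0 : 0 < (n.+1%:R ^+ 2)^-1 :> R by rewrite invr_gt0 exprn_gt0.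
have a20 : 0 < a ^+ 2 by rewrite exprn_gt0.
have -> : 2 * K * S / a ^+ 2 * ((m.+1%:R ^+ 2)^-1 * (n.+1%:R ^+ 2)^-1) = (2 * S * K / m.+1%:R ^+ 2) / a ^+ 2 * (n.+1%:R ^+ 2)^-1.
  have aux (N N' : R) : N != 0 -> N' != 0 ->
      2 * K * S / a ^+ 2 * ((N ^+ 2)^-1 * (N' ^+ 2)^-1) = (2 * S * K / N ^+ 2) / a ^+ 2 * (N' ^+ 2)^-1.
    by move=> N0 N'0; field; rewrite N0 N'0 gt_eqF.
  by apply: aux; rewrite pnatr_eq0.
rewrite XE -[leLHS]mulrA (mulrC _ (1 + _)) mulrA ler_pM2r// mulrAC ler_pM2r ?invr_gt0//.
rewrite ler_pdivlMr//.
apply: le_trans (_ : Y * (K * (1 + (m%:R * a) ^+ 3)) <= _).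
  by rewrite -mulrA; apply: ler_wpM2l.
have h3 : Y * (1 + (m%:R * a) ^+ 3) <= 2 * S by move: h2; clear -h1; nra.
by move: h3; clear -K0; nra.
Qed.
End coefficient_decay.

(** * Locality and parity of the derivatives *)

Section locality.
Context {R : realType}.
Implicit Types (u v w : R -> R -> R -> R) (x y t a l : R).

Lemma dy_local u v a x y t : (forall y, 0 <= y < a -> u x y t = v x y t) -> 0 <= y < a ->
  Ck_half_space 1 u -> dy v x y t = dy u x y t.
Proof.
move=> uv /andP[y0 ya] cu; apply: is_dy_dy => //.
have [_ [g gu dg] _] := Ck_jet cu x t y0.
exists (fun z => if a <= z then v x z t else g z).
  by move=> z z0; have [//|za] := leP a z; rewrite gu// uv// z0.
apply: near_eq_is_derive dg; near=> z; rewrite leNgt ifF//; apply/negbTE; rewrite negbK.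
by near: z; exact: lt_nbhsl.
Unshelve. all: by end_near. Qed.

Lemma vanish_x w a : Ck_half_space 1 w -> (forall x y t, 0 <= y -> a < x -> w x y t = 0) ->
  forall x y t, 0 <= y -> a < x -> dx w x y t = 0 /\ dy w x y t = 0.
Proof.
move=> cw w0 x y t y0 ax; split.
  have [H _ _] := Ck_jet cw x t y0; apply: (is_derive_uniq H).
  have D : is_derive x 1 (fun _ : R => 0 : R) 0 by exact: derC.
  apply: near_eq_is_derive D; near=> z; rewrite w0//; near: z; exact: lt_nbhsr.
apply: is_dy_dy => //; exists (fun=> 0); last exact: derC.
by move=> z z0; rewrite w0.
Unshelve. all: by end_near. Qed.

Lemma vanish_y w a : 0 <= a -> Ck_half_space 1 w -> (forall x y t, a < y -> w x y t = 0) ->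
  forall x y t, a < y -> dx w x y t = 0 /\ dy w x y t = 0.
Proof.
move=> a0 cw w0 x y t ay; have y0 : 0 < y by exact: le_lt_trans ay.
have [Hx Hy _] := Ck_jet cw x t (ltW y0); split.
  apply: (is_derive_uniq Hx); rewrite (_ : (fun _ => _) = fun=> 0); first exact: derC.
  by apply/funext => z; rewrite w0.
apply: (is_derive_uniq (is_dy_int y0 Hy)).
have D : is_derive y 1 (fun _ : R => 0 : R) 0 by exact: derC.
apply: near_eq_is_derive D; near=> z; rewrite w0//; near: z; exact: lt_nbhsr.
Unshelve. all: by end_near. Qed.

Lemma even_dy w : Ck_half_space 1 w -> (forall x y t, 0 <= y -> w (- x) y t = w x y t) ->
  forall x y t, 0 <= y -> dy w (- x) y t = dy w x y t.
Proof.
move=> cw we x y t y0; apply: is_dy_dy => //.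
have [_ [g gw dg] _] := Ck_jet cw x t y0; exists g => // z z0; rewrite gw// we//.
Qed.

Lemma even_dx w : Ck_half_space 1 w -> (forall x y t, 0 <= y -> w (- x) y t = w x y t) ->
  forall y t, 0 <= y -> dx w 0 y t = 0.
Proof.
move=> cw we y t y0; have [H _ _] := Ck_jet cw 0 t y0.
have H' : is_derive (- (0 : R)) 1 (fun x => w x y t) (dx w 0 y t) by rewrite oppr0.
have N : is_derive (0 : R) 1 (fun x : R => - x) (- 1) by der; ring.
have D := @der_comp R (fun x => w x y t) (fun x => - x) 0 _ _ H' N.
have : dx w 0 y t = dx w 0 y t * -1.
  apply: (is_derive_uniq H); rewrite (_ : (fun x => w x y t) = (fun x => w (- x) y t))//.
  by apply/funext => z; rewrite we.
lra.
Qed.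
End locality.

(** * Cutoff of the initial value *)

Section cutoff.
Context {R : realType}.
Implicit Types (v : R -> R -> R -> R) (x y t M : R).

(** Equal to 1 for [|x| <= M + 1] and to 0 beyond [M + 2]. The exponent 8 gives class [C^7];
    [cutoff_data] consumes six derivatives, one for [B] and five for the decay of its
    coefficients. *)
Definition bump M x : R := pospow 8 (1 - pospow 8 (x ^+ 2 - (M + 1) ^+ 2)).

Lemma bump1 M x : 0 <= M -> `|x| <= M + 1 -> bump M x = 1.
Proof.
move=> M0 xM; rewrite /bump (@pospow_eq0 _ 8 (x ^+ 2 - (M + 1) ^+ 2))//; last first.
  rewrite subr_le0 -(real_normK (num_real x)); apply: lerXn2r; rewrite ?nnegrE//; lra.
by rewrite subr0 /pospow max_r ?expr1n.
Qed.

Lemma bump0 M x : 0 <= M -> M + 2 < x -> bump M x = 0.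
Proof.
move=> M0 xM; rewrite /bump pospow_eq0// subr_le0.
have h : 1 <= x ^+ 2 - (M + 1) ^+ 2 by nra.
by rewrite /pospow max_r ?exprn_ege1//; exact: le_trans h.
Qed.

Lemma bumpN M x : bump M (- x) = bump M x.
Proof. by rewrite /bump sqrrN. Qed.

Lemma Ck_bump M k (f : R -> R -> R -> R) : (k < 8)%N -> Ck_half_space k f ->
  Ck_half_space k (fun x y t => bump M (f x y t)).
Proof.
move=> k8 Hf; rewrite /bump.
apply: (Ck_pospow k8).
apply: Ck_add; first exact: Ck_cst.
apply: (@Ck_ext _ _ (fun x y t => -1 * pospow 8 (f x y t * f x y t + - (M + 1) ^+ 2))).
  by move=> x y t _; rewrite mulN1r expr2.
apply: Ck_scale; apply: (Ck_pospow k8); apply: Ck_add; last exact: Ck_cst.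
exact: Ck_mul.
Qed.

Lemma Ck_dx k (w : R -> R -> R -> R) : Ck_half_space k.+1 w -> Ck_half_space k (dx w).
Proof. by move=> [_ []]. Qed.

Lemma Ck_dy k (w : R -> R -> R -> R) : Ck_half_space k.+1 w -> Ck_half_space k (dy w).
Proof. by move=> [_ []]. Qed.

(** The cutoff acts on [v] and not on its [y]-derivative: [B] is then the [y]-derivative of a
    function vanishing at both ends, hence has mean 0 in [y]. The odd derivatives needed for the
    decay vanish at [P] by support, at [x = 0] by evenness and at [y = 0] by the equation. *)
Lemma cutoff_data v M : 0 <= M -> smooth_half_space v -> wave v ->
  (forall x y t, v (- x) y t = v x y t) ->
  exists B : R -> R -> R, [/\ continuous (fun z : R * R => B z.1 z.2),
    forall x y, B (- x) y = B x y,
    forall x y, `|x| <= M -> 0 <= y <= M -> B x y = dy v x y 0,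
    forall x, Int 0 (M + 3) (B x) = 0 &
    exists2 C : R, 0 <= C & forall m n,
      `|cos_coeff (M + 3) B m n| * (1 + wavenum (M + 3) m) <= C * maj m n].
Proof.
move=> M0 sv wv ve; set P := M + 3.
have P0 : 0 < P by rewrite /P; lra.
pose W x y t := bump M x * bump M y * v x y t.
have cW : Ck_half_space 6 W.
  apply: (Ck_mul _ (sv 6)); apply: Ck_mul; first exact: (Ck_bump M _ (Ck_coord_x 6)).
  exact: (Ck_bump M _ (Ck_coord_y 6)).
have contB := Ck_dy cW; have cB1 := Ck_dy contB; have cB2 := Ck_dy cB1.
have cG1 := Ck_dx cB2; have cG2 := Ck_dx cG1; have cG3 := Ck_dx cG2.
have le1 k (w : R -> R -> R -> R) : Ck_half_space k.+1 w -> Ck_half_space 1 w by exact: Ck_le.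
have cl k (w : R -> R -> R -> R) : Ck_half_space k w -> continuous (fun z : R * R => clamp w z.1 z.2 0).
  move=> /Ck_cont /continuous_half_spaceP c.
  by apply: (@cont_comp3 _ _ _ _ _ (clamp w)) => //; ctn.
have W0 x y t : 0 <= y -> M + 2 < x -> W x y t = 0 by move=> _ h; rewrite /W bump0// !mul0r.
have W0' x y t : M + 2 < y -> W x y t = 0 by move=> h; rewrite /W (bump0 M0 h) mulr0 mul0r.
have We x y t : 0 <= y -> W (- x) y t = W x y t by move=> _; rewrite /W bumpN ve.
have vx1 x y t (hy : 0 <= y) (h : M + 2 < x) := (vanish_x (le1 5%N _ cW) W0 t hy h).2.
have vx2 x y t (hy : 0 <= y) (h : M + 2 < x) := (vanish_x (le1 4%N _ contB) vx1 t hy h).2.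
have vx3 x y t (hy : 0 <= y) (h : M + 2 < x) := (vanish_x (le1 3%N _ cB1) vx2 t hy h).2.
have vx4 x y t (hy : 0 <= y) (h : M + 2 < x) := (vanish_x (le1 2%N _ cB2) vx3 t hy h).1.
have M2 : 0 <= M + 2 by lra.
have vy1 x y t (h : M + 2 < y) := (vanish_y M2 (le1 5%N _ cW) W0' x t h).2.
have vy2 x y t (h : M + 2 < y) := (vanish_y M2 (le1 4%N _ contB) vy1 x t h).2.
have e1 := even_dy (le1 5%N _ cW) We.
have e2 := even_dy (le1 4%N _ contB) e1.
have e3 := even_dy (le1 3%N _ cB1) e2.
have e4 := even_dx (le1 2%N _ cB2) e3.
have cvx : Ck_half_space 2 (fun x y t => bump M x * v x y t).
  by apply: (Ck_mul (Ck_bump M _ (Ck_coord_x 2)) (sv 2%N)).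
have cvxy := Ck_dy cvx.
have loc x y t : 0 <= y < M + 1 -> (bump M x * v x y t) = W x y t.
  by move=> /andP[y0 yM]; rewrite /W (@bump1 M y)//; [rewrite mulr1|rewrite ger0_norm// ltW].
have j := Ck_jet (sv 1%N); have svy := Ck_dy (sv 2%N).
have jy := Ck_jet svy.
have bj x y t : 0 <= y -> dy (fun x y t => bump M x * v x y t) x y t = bump M x * dy v x y t.
  move=> y0; apply: is_dy_dy => //; have [_ [g gv dg] _] := j x y t y0.
  exists (fun y => bump M x * g y); first by move=> z z0; rewrite gv.
  by apply: (der_eq (derM (derC y (bump M x)) dg)); ring.
have bjj x t : dy (dy (fun x y t => bump M x * v x y t)) x 0 t = bump M x * dy (dy v) x 0 t.
  apply: is_dy_dy => //; have [_ [g gv dg] _] := jy x 0 t (lexx 0).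
  exists (fun y => bump M x * g y); first by move=> z z0; rewrite bj// gv.
  by apply: (der_eq (derM (derC 0 (bump M x)) dg)); ring.
have BE x y t : 0 <= y < M + 1 -> dy W x y t = bump M x * dy v x y t.
  move=> yM; rewrite -bj; last by case/andP: yM.
  by apply: (dy_local _ yM (Ck_S cvx)) => z zM; exact: loc.
have M1 : 0 <= (0 : R) < M + 1 by rewrite lexx; lra.
(* On [y = 0] the tangential derivatives of [v] vanish, so the wave equation leaves [v_yy = 0]. Near
   the boundary the cutoff in [y] is 1, and the same follows for [W]. *)
have vyy x t : dy (dy v) x 0 t = 0.
  have [_ wv0 vb] := wv; have := wv0 x 0 t (lexx 0); rewrite /wave_op.
  have jv x' t' : dx v x' 0 t' = 0 /\ dt v x' 0 t' = 0.
    have [Hx _ Ht] := j x' 0 t' (lexx 0); split.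
      by apply: (is_derive_uniq Hx); rewrite (_ : (fun _ => _) = fun=> 0); [exact: derC|apply/funext => z; exact: vb].
    by apply: (is_derive_uniq Ht); rewrite (_ : (fun _ => _) = fun=> 0); [exact: derC|apply/funext => z; exact: vb].
  have [_ [_ svx _ svt]] := sv 2%N.
  have jx := @Ck_jet _ 0 _ svx; have jt := @Ck_jet _ 0 _ svt.
  have [Hx _ _] := jx x 0 t (lexx 0); have [_ _ Ht] := jt x 0 t (lexx 0).
  have -> : dx (dx v) x 0 t = 0.
    by apply: (is_derive_uniq Hx); rewrite (_ : (fun _ => _) = fun=> 0); [exact: derC|apply/funext => z; exact: (jv _ _).1].
  have -> : dt (dt v) x 0 t = 0.
    by apply: (is_derive_uniq Ht); rewrite (_ : (fun _ => _) = fun=> 0); [exact: derC|apply/funext => z; exact: (jv _ _).2].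
  by rewrite subrr sub0r => /eqP; rewrite oppr_eq0 => /eqP.
have B10 x : dy (dy W) x 0 0 = 0.
  rewrite (@dy_local _ (dy (fun x y t => bump M x * v x y t)) _ (M + 1) x 0 0 _ M1 cvxy).
    by rewrite bjj vyy mulr0.
  by move=> z /andP[z0 zM]; rewrite bj// BE// z0.
exists (fun x y => clamp (dy W) x y 0); split.
- exact: cl contB.
- by move=> x y; rewrite /clamp e1// le_max lexx orbT.
- move=> x y xM /andP[y0 yM]; rewrite clampE// BE; last by rewrite y0; lra.
  by rewrite bump1 ?mul1r//; lra.
- move=> x; have cBx : continuous (fun y => clamp (dy W) x y 0).
    by apply: (@cont_comp2 _ _ _ _ (fun x y => clamp (dy W) x y 0)) => //; [exact: (cl _ _ contB)|ctn|ctn].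
  have cWx : continuous (fun y => clamp W x y 0).
    by apply: (@cont_comp2 _ _ _ _ (fun x y => clamp W x y 0)) => //; [exact: (cl _ _ cW)|ctn|ctn].
  have H (y : R) : 0 < y < P -> is_derive y 1 (fun y => clamp W x y 0) (clamp (dy W) x y 0).
    move=> /andP[y0 _]; rewrite (clampE _ _ _ (ltW y0)).
    have [_ Hy _] := Ck_jet (le1 5%N _ cW) x 0 (ltW y0).
    apply: near_eq_is_derive (is_dy_int y0 Hy); near=> z; rewrite clampE//; apply: ltW; near: z; exact: lt_nbhsr.
  rewrite (Int_FTC2 (ltW P0) cBx (continuous_subspaceT cWx) H) !clampE ?(ltW P0)//.
  rewrite W0' ?/P; last lra.
  by have [_ _ vb] := wv; rewrite /W vb mulr0 subrr.
have dcy w x y : 0 < y -> Ck_half_space 1 w -> is_derive y 1 (fun y => clamp w x y 0) (clamp (dy w) x y 0).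
  move=> y0 cw; rewrite (clampE _ _ _ (ltW y0)); have [_ Hy _] := Ck_jet cw x 0 (ltW y0).
  apply: near_eq_is_derive (is_dy_int y0 Hy); near=> z; rewrite clampE//; apply: ltW; near: z; exact: lt_nbhsr.
have dcx w x y : 0 <= y -> Ck_half_space 1 w -> is_derive x 1 (fun x => clamp w x y 0) (clamp (dx w) x y 0).
  by move=> y0 cw; have [Hx _ _] := Ck_jet cw x 0 y0; rewrite /clamp max_l.
have [|||||||||S S0 HS] := @coeff2_decay R P (fun x y => clamp (dy W) x y 0) (fun x y => clamp (dy (dy W)) x y 0)
  (fun x y => clamp (dy (dy (dy W))) x y 0) (fun x y => clamp (dx (dy (dy (dy W)))) x y 0)
  (fun x y => clamp (dx (dx (dy (dy (dy W))))) x y 0) (fun x y => clamp (dx (dx (dx (dy (dy (dy W)))))) x y 0)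
  P0 (cl _ _ contB) (cl _ _ cB1) (cl _ _ cB2) (cl _ _ cG1) (cl _ _ cG2) (cl _ _ cG3) .
- by move=> x y y0; exact: dcy y0 (le1 4%N _ contB).
- by move=> x y y0; exact: dcy y0 (le1 3%N _ cB1).
- by move=> x y y0; exact: dcx y0 (le1 2%N _ cB2).
- by move=> x y y0; exact: dcx y0 (le1 1%N _ cG1).
- by move=> x y y0; exact: dcx y0 (le1 0%N _ cG2).
- by move=> x; rewrite (clampE _ _ _ (lexx 0)); exact: B10.
- move=> x; rewrite (clampE _ _ _ (ltW P0)); apply: vy2; rewrite /P; lra.
- by move=> y y0; rewrite (clampE _ _ _ y0); exact: e4.
- move=> y y0; rewrite (clampE _ _ _ y0); apply: vx4 => //; rewrite /P; lra.
pose K := 4 * (1 + pi / P) / (pi / P) ^+ 3 + 1.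
have kp0 : 0 < pi / P by rewrite divr_gt0 ?pi_gt0.
exists ((2 / P) * (2 / P) * (2 * K * S / (pi / P) ^+ 2)).
  have K0 : 0 <= K by rewrite addr_ge0// divr_ge0// ?exprn_ge0 ?(ltW kp0)// mulr_ge0//; lra.
  have h1 : 0 <= 2 / P by rewrite divr_ge0// ltW.
  have h2 : 0 <= 2 * K * S / (pi / P) ^+ 2 by rewrite divr_ge0 ?sqr_ge0// mulr_ge0// mulr_ge0.
  by apply: mulr_ge0 => //; apply: mulr_ge0.
move=> m n; rewrite /cos_coeff; have [h1 h2] := HS m n.+1.
have h3 := @maj_bound R P S K _ m n P0 S0 (normr_ge0 _) (lexx _) h1 h2.
have h1P : 0 <= 2 / P by rewrite divr_ge0// ltW.
rewrite normrM -[leLHS]mulrA -[leRHS]mulrA.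
apply: ler_pM h3 => //.
  by rewrite mulr_ge0// addr_ge0// /wavenum mulr_ge0// ltW.
rewrite normrM (ger0_norm h1P); apply: ler_wpM2r => //.
case: ifP => _; last by rewrite ger0_norm.
by rewrite ger0_norm ?invr_ge0 ?(ltW P0)// ler_peMl ?invr_ge0 ?(ltW P0)//; lra.
Unshelve. all: by end_near. Qed.
End cutoff.

(** * Expansion of the solution in modes *)

Section representation.
Context {R : realType}.
Implicit Types (u v : R -> R -> R -> R) (x y t : R) (m n N : nat).

Lemma jet_sum (I : Type) (r : seq I) (F Fx Fy Ft : I -> R -> R -> R -> R) :
  (forall i, jet (F i) (Fx i) (Fy i) (Ft i)) ->
  jet (fun x y t => \sum_(i <- r) F i x y t) (fun x y t => \sum_(i <- r) Fx i x y t)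
    (fun x y t => \sum_(i <- r) Fy i x y t) (fun x y t => \sum_(i <- r) Ft i x y t).
Proof.
have E (f : I -> R -> R -> R -> R) s (j : I) : (fun x y t => \sum_(i <- j :: s) f i x y t) =
    (fun x y t => f j x y t + \sum_(i <- s) f i x y t).
  by apply/funext => x; apply/funext => y; apply/funext => t; rewrite big_cons.
have E0 (f : I -> R -> R -> R -> R) : (fun x y t => \sum_(i <- [::]) f i x y t) = (fun _ _ _ => 0).
  by apply/funext => x; apply/funext => y; apply/funext => t; rewrite big_nil.
move=> HF; elim: r => [|j r IH].
  by rewrite !E0 => x y t y0; split; [exact: derC|apply: is_dy_section; exact: derC|exact: derC].
by rewrite !E; exact: jet_add.
Qed.

Lemma tau_zero (tau : nat -> R) (K z : R) : tau N @[N --> \oo] --> 0 ->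
  (forall N, `|z| <= K * tau N) -> z = 0.
Proof.
move=> t0 H; apply/eqP; rewrite -normr_le0.
have Kt : K * tau N @[N --> \oo] --> 0.
  by rewrite -(mulr0 K); apply: cvgM => //; exact: cvg_cst.
rewrite -(cvg_lim _ Kt)//; apply: limr_ge; first by apply/cvg_ex; eexists; exact: Kt.
by exists 0%N => // N _; exact: H.
Qed.

Lemma Int_zero_primitive (h : R -> R) a b : a < b -> continuous h ->
  (forall x, a <= x <= b -> Int a x h = 0) -> forall x, a <= x <= b -> h x = 0.
Proof.
move=> ab ch H; apply: (zero_closure ab ch) => x /andP[ax xb].
apply: (is_derive_uniq (Int_FTC1 ch ax)).
have D : is_derive x 1 (fun _ : R => 0 : R) 0 by exact: derC.
apply: near_eq_is_derive D; near=> z; rewrite H//; apply/andP; split; apply: ltW; near: z.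
  exact: lt_nbhsr.
exact: lt_nbhsl.
Unshelve. all: by end_near. Qed.

(** Differentiation of a uniform limit, by integration: the integrals of [f'] and [X] from [a]
    differ by a multiple of [tau N] for every [N], hence agree. *)
Lemma deriv_limit (f f' X : R -> R) (g g' : nat -> R -> R) (tau : nat -> R) (K a b : R) : a < b ->
  tau N @[N --> \oo] --> 0 -> continuous f' -> continuous X -> (forall N, continuous (g' N)) ->
  (forall x : R, is_derive x 1 f (f' x)) -> (forall N (x : R), is_derive x 1 (g N) (g' N x)) ->
  (forall N x, a <= x <= b -> `|f x - g N x| <= K * tau N) ->
  (forall N x, a <= x <= b -> `|X x - g' N x| <= K * tau N) ->
  forall x, a <= x <= b -> f' x = X x.
Proof.
move=> ab t0 cf' contX cg' df dg Hf HX x xab; apply/eqP; rewrite -subr_eq0; apply/eqP.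
have ch : continuous (fun x => f' x - X x) by ctn.
apply: (Int_zero_primitive ab ch _ xab) => z zab; have /andP[az zb] := zab.
apply: (@tau_zero tau (K + K + K * (z - a))) t0 _ => N.
have cgX : continuous (fun x => g' N x - X x) by have := cg' N => cgN; ctn.
have cgN := cg' N.
have -> : Int a z (fun x => f' x - X x) = (f z - g N z) - (f a - g N a) + Int a z (fun x => g' N x - X x).
  have df' (y : R) : a <= y <= z -> is_derive y 1 f (f' y) by move=> _.
  have dg' (y : R) : a <= y <= z -> is_derive y 1 (g N) (g' N y) by move=> _.
  by rewrite !IntB// (Int_FTC az cf' df') (Int_FTC az cgN dg'); ring.
have h1 := Hf N z zab; have h2 := Hf N a; rewrite lexx (ltW ab) in h2; have {}h2 := h2 isT.
have h3 : `|Int a z (fun x => g' N x - X x)| <= K * tau N * (z - a).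
  apply: Int_bound => // y /andP[ay yz]; rewrite distrC; apply: HX; rewrite ay; exact: le_trans zb.
apply: le_trans (ler_normD _ _) _; have := ler_normB (f z - g N z) (f a - g N a).
rewrite !mulrDl; lra.
Qed.

Definition freq (P : R) m n : R := Num.sqrt (wavenum P n.+1 ^+ 2 + wavenum P m ^+ 2).

(** Division by the wave number in [y] makes the [y]-derivative at [t = 0] equal to the cosine
    partial sum with coefficients [c]. *)
Definition mode_sum (P : R) (c : nat -> nat -> R) N x y t : R :=
  sq N (fun m n => c m n / wavenum P n.+1 * mode (wavenum P m) (wavenum P n.+1) (freq P m n) x y t).

Definition mode_sum_x (P : R) (c : nat -> nat -> R) N x y t : R :=
  sq N (fun m n => c m n / wavenum P n.+1 * (- wavenum P m *
    (sin (wavenum P m * x) * sin (wavenum P n.+1 * y) * cos (freq P m n * t)))).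

Definition mode_sum_y (P : R) (c : nat -> nat -> R) N x y t : R :=
  sq N (fun m n => c m n * (cos (wavenum P m * x) * cos (wavenum P n.+1 * y) * cos (freq P m n * t))).

Definition mode_sum_t (P : R) (c : nat -> nat -> R) N x y t : R :=
  sq N (fun m n => c m n / wavenum P n.+1 * (- freq P m n *
    (cos (wavenum P m * x) * sin (wavenum P n.+1 * y) * sin (freq P m n * t)))).

Section sums.
Variables (P : R) (c : nat -> nat -> R).
Hypothesis P0 : 0 < P.

Lemma wavenum_gt0 n : 0 < wavenum P n.+1.
Proof. by rewrite /wavenum mulr_gt0// divr_gt0 ?pi_gt0. Qed.

Lemma wavenum_ge0 n : 0 <= wavenum P n.
Proof. by rewrite /wavenum mulr_ge0// divr_ge0 ?pi_ge0// ltW. Qed.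

Lemma mode_sum_wave N : wave (mode_sum P c N).
Proof.
rewrite /mode_sum /sq.
apply: (@wave_sum R _ _ (fun (m : 'I_N) x y t => \sum_(n < N) c m n / wavenum P n.+1 * mode (wavenum P m) (wavenum P n.+1) (freq P m n) x y t)) => m.
apply: (@wave_sum R _ _ (fun (n : 'I_N) x y t => c m n / wavenum P n.+1 * mode (wavenum P m) (wavenum P n.+1) (freq P m n) x y t)) => n.
apply: wave_scale; apply: mode_wave.
by rewrite /freq sqr_sqrtr// addr_ge0// sqr_ge0.
Qed.

Lemma mode_sum_jet N : jet (mode_sum P c N) (mode_sum_x P c N) (mode_sum_y P c N) (mode_sum_t P c N).
Proof.
rewrite /mode_sum /mode_sum_x /mode_sum_y /mode_sum_t /sq.
apply: (@jet_sum _ _ (fun (m : 'I_N) x y t => \sum_(n < N) c m n / wavenum P n.+1 * mode (wavenum P m) (wavenum P n.+1) (freq P m n) x y t)) => m.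
apply: (@jet_sum _ _ (fun (n : 'I_N) x y t => c m n / wavenum P n.+1 * mode (wavenum P m) (wavenum P n.+1) (freq P m n) x y t)) => n.
have := jet_scale (c m n / wavenum P n.+1) (fun x y t => @mode_partials R (wavenum P m) (wavenum P n.+1) (freq P m n) x y t).
congr jet; apply/funext => x; apply/funext => y; apply/funext => t.
by rewrite mulrA divfK// gt_eqF// wavenum_gt0.
Qed.

Lemma mode_sum_t0 N x y : mode_sum_t P c N x y 0 = 0.
Proof.
by rewrite /mode_sum_t /sq big1// => m _; rewrite big1// => n _; rewrite mulr0 sin0 !mulr0.
Qed.

Lemma mode_sum_y0 N x y : mode_sum_y P c N x y 0 = cos_partial P c N x y.
Proof. by apply: eq_sq => m n; rewrite mulr0 cos0 mulr1. Qed.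

Lemma mode_sum_x_cont N : continuous (fun z : R * R * R => mode_sum_x P c N z.1.1 z.1.2 z.2).
Proof.
rewrite /mode_sum_x /sq.
apply: (cont_sum (F := fun (m : 'I_N) (z : R * R * R) => \sum_(n < N) c m n / wavenum P n.+1 * (- wavenum P m *
    (sin (wavenum P m * z.1.1) * sin (wavenum P n.+1 * z.1.2) * cos (freq P m n * z.2))))) => m.
by apply: (cont_sum (F := fun (n : 'I_N) (z : R * R * R) => c m n / wavenum P n.+1 * (- wavenum P m *
    (sin (wavenum P m * z.1.1) * sin (wavenum P n.+1 * z.1.2) * cos (freq P m n * z.2))))) => n; ctn.
Qed.

Lemma mode_sum_y_cont N : continuous (fun z : R * R * R => mode_sum_y P c N z.1.1 z.1.2 z.2).
Proof.
rewrite /mode_sum_y /sq.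
apply: (cont_sum (F := fun (m : 'I_N) (z : R * R * R) => \sum_(n < N) c m n *
    (cos (wavenum P m * z.1.1) * cos (wavenum P n.+1 * z.1.2) * cos (freq P m n * z.2)))) => m.
by apply: (cont_sum (F := fun (n : 'I_N) (z : R * R * R) => c m n *
    (cos (wavenum P m * z.1.1) * cos (wavenum P n.+1 * z.1.2) * cos (freq P m n * z.2)))) => n; ctn.
Qed.

Variable C : R.
Hypotheses (C0 : 0 <= C) (cC' : forall m n, `|c m n| * (1 + wavenum P m) <= C * maj m n).

Lemma coeff_le m n : `|c m n| <= C * maj m n.
Proof.
apply: le_trans (cC' m n); rewrite mulrDr mulr1 lerDl mulr_ge0//; exact: wavenum_ge0.
Qed.

Let cc (a : R) : `|cos a| <= 1. Proof. by rewrite ler_norml cos_geN1 cos_le1. Qed.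
Let ss (a : R) : `|sin a| <= 1. Proof. by rewrite ler_norml sin_geN1 sin_le1. Qed.

Let prod3 (a b d : R) : `|a| <= 1 -> `|b| <= 1 -> `|d| <= 1 -> `|a * b * d| <= 1.
Proof.
move=> a1 b1 d1; rewrite !normrM; apply: mulr_ile1 => //.
exact: mulr_ile1.
Qed.

Lemma mode_sum_y_tail (tau : nat -> R) : (forall N N', (N <= N')%N -> sq N' maj - sq N maj <= tau N) ->
  forall N N' x y t, (N <= N')%N -> `|mode_sum_y P c N' x y t - mode_sum_y P c N x y t| <= C * tau N.
Proof.
move=> Ht N N' x y t NN.
apply: le_trans (@sq_diff R _ (fun m n => C * maj m n) N N' NN _) _ => [m n|].
  by rewrite normrM -[leRHS]mulr1; apply: ler_pM => //; [exact: coeff_le|exact: prod3].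
by rewrite !sqZ -mulrBr ler_wpM2l// Ht.
Qed.

(** The [x]-derivative costs a factor [k], which the weight [1 + k] in the coefficient bound pays
    for; the division by the wave number in [y] costs at most [P / pi]. *)
Lemma mode_sum_x_tail (tau : nat -> R) : (forall N N', (N <= N')%N -> sq N' maj - sq N maj <= tau N) ->
  forall N N' x y t, (N <= N')%N -> `|mode_sum_x P c N' x y t - mode_sum_x P c N x y t| <= C / (pi / P) * tau N.
Proof.
move=> Ht N N' x y t NN; have kp0 : 0 < pi / P by rewrite divr_gt0 ?pi_gt0.
apply: le_trans (@sq_diff R _ (fun m n => C / (pi / P) * maj m n) N N' NN _) _ => [m n|].
  have b0 := wavenum_gt0 n; have k0 := wavenum_ge0 m.
  have bk : pi / P <= wavenum P n.+1 by rewrite /wavenum ler_peMl// ?(ltW kp0)// ler1n.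
  have ck : `|c m n| * wavenum P m <= C * maj m n.
    by apply: le_trans (cC' m n); rewrite ler_wpM2l// lerDr.
  rewrite mulrA normrM -[leRHS]mulr1; apply: ler_pM => //; last exact: prod3.
  rewrite normrM normrN (ger0_norm k0) normrM normfV (gtr0_norm b0) mulrAC (mulrAC C).
  apply: ler_pM => //; [exact: mulr_ge0|by rewrite invr_ge0 ltW|].
  by rewrite lef_pV2.
rewrite !sqZ -mulrBr ler_wpM2l// ?Ht// divr_ge0// ltW//.
Qed.
End sums.

Lemma cone_weight_le M x y t : 0 <= t <= M -> pospow 2 (cone M x y t) <= (M ^+ 2) ^+ 2.
Proof.
move=> /andP[t0 tM]; have M0 : 0 <= M by exact: le_trans tM.
apply: lerXn2r; rewrite ?nnegrE ?sqr_ge0// ?le_max ?lexx//.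
rewrite ge_max sqr_ge0/= /cone.
have : (M - t) ^+ 2 <= M ^+ 2 by apply: lerXn2r; rewrite ?nnegrE//; lra.
by have := sqr_ge0 x; have := sqr_ge0 y; lra.
Qed.

Lemma Int2_bound (f : R -> R -> R) a b a' b' k : a <= b -> a' <= b' ->
  continuous (fun z : R * R => f z.1 z.2) ->
  (forall x y, a <= x <= b -> a' <= y <= b' -> `|f x y| <= k) ->
  `|Int a b (fun x => Int a' b' (f x))| <= k * (b' - a') * (b - a).
Proof.
move=> ab ab' cf H; apply: Int_bound => //; first by apply: (@cont_Int R _ f).
by move=> x xab; apply: Int_bound => //; [ctn|move=> y yab; exact: H].
Qed.

(* The energy in the weighted cone controls the [y]-derivative of the error down to the boundary. *)
Lemma boundary_value (M t : R) (q F : R -> R -> R) (dq : nat -> R -> R -> R)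
   (tau : nat -> R) (K : R) :
  0 < M -> 0 <= t <= M -> tau N @[N --> \oo] --> 0 ->
  continuous (fun z : R * R => q z.1 z.2) -> continuous (fun z : R * R => F z.1 z.2) ->
  (forall N, continuous (fun z : R * R => dq N z.1 z.2)) ->
  (forall N x y, 0 <= y -> `|F x y - (q x y - dq N x y)| <= K * tau N) ->
  (forall N, Int 0 M (fun y => Int (- M) M (fun x => pospow 2 (cone M x y t) * dq N x y ^+ 2)) <= K * tau N ^+ 2) ->
  forall x, `|x| < M - t -> q x 0 = F x 0.
Proof.
move=> M0 tM t0 cq cF cdq HF HE x xM; have /andP[t00 tM'] := tM.
pose w x y := pospow 2 (cone M x y t).
have cw : continuous (fun z : R * R => w z.1 z.2).
  by apply: (@cont_comp3 _ _ _ _ _ (fun x y t => pospow 2 (cone M x y t))); [exact: cone_cont|ctn..].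
have w0 x' y' : 0 <= w x' y' by exact: pospow_ge0.
have wM x' y' : w x' y' <= (M ^+ 2) ^+ 2 by exact: cone_weight_le.
have wx : 0 < w x 0.
  rewrite /w /pospow exprn_gt0// lt_max; apply/orP; right; rewrite /cone expr0n/= subr0 subr_gt0.
  by rewrite -(real_normK (num_real x)); apply: ltrXn2r; rewrite ?nnegrE//; exact: le_trans (ltW xM).
have HE' N : Int 0 M (fun y => Int (- M) M (fun x => w x y * dq N x y ^+ 2)) <= K * tau N ^+ 2 by exact: HE.
clear HE; clearbody w.
have M0' := ltW M0; have MM : - M <= M by lra.
pose h y x := w x y * (q x y - F x y) ^+ 2.
have ch : continuous (fun z : R * R => h z.1 z.2) by rewrite /h; ctn.
have h0 y' x' : 0 <= h y' x' by rewrite /h mulr_ge0// sqr_ge0.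
have cH : continuous (fun y => Int (- M) M (h y)) by apply: (@cont_Int R _ h).
have H0 : Int 0 M (fun y => Int (- M) M (h y)) = 0.
  have t20 : tau N ^+ 2 @[N --> \oo] --> 0.
    rewrite (_ : 0 = 0 * 0 :> R); last by rewrite mulr0.
    by under eq_fun do rewrite expr2; exact: cvgM.
  apply: (@tau_zero _ (2 * K + 2 * ((M ^+ 2) ^+ 2 * K ^+ 2 * (M + M) * M)) _ t20) => N.
  have cdqN := cdq N.
  pose g1 y x := w x y * dq N x y ^+ 2.
  pose g2 y x := w x y * (F x y - (q x y - dq N x y)) ^+ 2.
  have cg1 : continuous (fun z : R * R => g1 z.1 z.2) by rewrite /g1; ctn.
  have cg2 : continuous (fun z : R * R => g2 z.1 z.2) by rewrite /g2; ctn.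
  have cG1 : continuous (fun y => Int (- M) M (g1 y)) by apply: (@cont_Int R _ g1).
  have cG2 : continuous (fun y => Int (- M) M (g2 y)) by apply: (@cont_Int R _ g2).
  have i2 : `|Int 0 M (fun y => Int (- M) M (g2 y))| <= (M ^+ 2) ^+ 2 * (K * tau N) ^+ 2 * (M - - M) * (M - 0).
    apply: Int2_bound => // y' x' /andP[y'0 _] _; rewrite /g2 normrM; apply: ler_pM => //.
      by rewrite ger0_norm.
    rewrite normrX; apply: lerXn2r; rewrite ?nnegrE//; last exact: HF.
    exact: le_trans (normr_ge0 _) (HF N x' y' y'0).
  have i1 := HE' N.
  have hg y' x' : h y' x' <= 2 * g1 y' x' + 2 * g2 y' x'.
    rewrite /h /g1 /g2; have := w0 x' y'; move: (w x' y') (q x' y') (F x' y') (dq N x' y') => a b d e a0.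
    have : 0 <= a * (2 * e - (b - d)) ^+ 2 by rewrite mulr_ge0// sqr_ge0.
    by nra.
  have hi : Int 0 M (fun y => Int (- M) M (h y)) <=
      Int 0 M (fun y => 2 * Int (- M) M (g1 y) + 2 * Int (- M) M (g2 y)).
    apply: le_Int => //; first by clear -cG1 cG2; ctn.
    move=> y' _; have c1' : continuous (g1 y') by clear -cg1; ctn.
    have c2' : continuous (g2 y') by clear -cg2; ctn.
    rewrite -!IntZ// -IntD; [|by ctn..].
    by apply: le_Int; [clear -ch; ctn|ctn|move=> x' _; exact: hg].
  rewrite ger0_norm; last by apply: Int_ge0 => y' _; apply: Int_ge0 => x' _.
  apply: le_trans hi _; rewrite IntD; [|by clear -cG1 cG2; ctn..].
  rewrite !IntZ//; move: i1 i2; rewrite ler_norml opprK subr0 exprMn => i1 /andP[_ i2].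
  move: i1 i2; rewrite /g1; set A := Int _ _ _; set B := Int _ _ _; clearbody A B.
  by clear; nra.
(* The inner integral vanishes for [0 < y < M] first; its continuity adds [y = 0], where the value
   is wanted. *)
have HH : forall y, 0 <= y <= M -> Int (- M) M (h y) = 0.
  apply: (zero_closure M0 cH); apply: (Int_pos_zero cH) H0 => y _.
  by apply: Int_ge0.
have h00 : h 0 x = 0.
  have c0 : continuous (h 0) by clear -ch; ctn.
  apply: (Int_pos_zero c0 (fun z _ => h0 0 z) (HH 0 _)); first by rewrite lexx.
  by move: xM; rewrite ltr_norml => /andP[]; lra.
move: h00; rewrite /h => /eqP; rewrite mulf_eq0 (gt_eqF wx)/= sqrf_eq0 subr_eq0 => /eqP //.
Qed.
End representation.

(** * Error of the modal expansion *)

Section representation_theorem.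
Context {R : realType}.
Implicit Types (u v d : R -> R -> R -> R) (x y t : R) (m n N : nat).

Lemma clamp_cont k u : Ck_half_space k u -> continuous (fun z : R * R * R => clamp u z.1.1 z.1.2 z.2).
Proof. by move=> /Ck_cont /continuous_half_spaceP. Qed.

Lemma clamp_cont2 k u t : Ck_half_space k u -> continuous (fun z : R * R => clamp u z.1 z.2 t).
Proof. by move=> /clamp_cont c; apply: (@cont_comp3 _ _ _ _ _ (clamp u)) => //; ctn. Qed.

Arguments clamp_cont2 [k u] t _.

Lemma energy_ge (M t : R) (p q r : R -> R -> R -> R) : 0 <= M ->
  continuous (fun z : R * R * R => p z.1.1 z.1.2 z.2) -> continuous (fun z : R * R * R => q z.1.1 z.1.2 z.2) ->
  continuous (fun z : R * R * R => r z.1.1 z.1.2 z.2) ->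
  Int 0 M (fun y => Int (- M) M (fun x => pospow 2 (cone M x y t) * q x y t ^+ 2)) <= energy M p q r t.
Proof.
move=> M0 kp kq kr; suff H (w : R -> R -> R -> R) : (forall x y t, 0 <= w x y t) ->
    continuous (fun z : R * R * R => w z.1.1 z.1.2 z.2) ->
    Int 0 M (fun y => Int (- M) M (fun x => w x y t * q x y t ^+ 2)) <=
    Int 0 M (fun y => Int (- M) M (fun x => w x y t * (p x y t ^+ 2 + q x y t ^+ 2 + r x y t ^+ 2))).
  apply: (H (fun x y t => pospow 2 (cone M x y t))); last exact: cone_cont.
  by move=> *; exact: pospow_ge0.
move=> w0 kw; have MM : - M <= M by lra.
have c1' : continuous (fun z : R * R => w z.2 z.1 t * q z.2 z.1 t ^+ 2) by clear -kw kq; ctn.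
have c2' : continuous (fun z : R * R => w z.2 z.1 t * (p z.2 z.1 t ^+ 2 + q z.2 z.1 t ^+ 2 + r z.2 z.1 t ^+ 2)).
  by clear -kw kp kq kr; ctn.
apply: le_Int.
- exact: (@cont_Int R R (fun y x => w x y t * q x y t ^+ 2) _ _ MM c1').
- exact: (@cont_Int R R (fun y x => w x y t * (p x y t ^+ 2 + q x y t ^+ 2 + r x y t ^+ 2)) _ _ MM c2').
move=> y _; apply: le_Int.
- by clear -kw kq; ctn.
- by clear -kw kp kq kr; ctn.
move=> x _; apply: ler_wpM2l => //; have := sqr_ge0 (p x y t); have := sqr_ge0 (r x y t); lra.
Qed.

Lemma wave_primitive d x y t : wave d -> 0 <= y ->
  d x y t = Int 0 y (fun y => clamp (dy d) x y t).
Proof.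
move=> [cd _ bd] y0.
have c' := clamp_cont2 t (Ck_dy cd); have c := clamp_cont2 t cd.
have cdy : continuous (fun y => clamp (dy d) x y t).
  by apply: (@cont_comp2 _ _ _ _ (fun x y => clamp (dy d) x y t)) => //; ctn.
have cdd : continuous (fun y => clamp d x y t).
  by apply: (@cont_comp2 _ _ _ _ (fun x y => clamp d x y t)) => //; ctn.
have H (z : R) : 0 < z < y -> is_derive z 1 (fun y => clamp d x y t) (clamp (dy d) x z t).
  move=> /andP[z0 _]; rewrite (clampE _ _ _ (ltW z0)); have [_ Hy _] := Ck_jet cd x t (ltW z0).
  apply: near_eq_is_derive (is_dy_int z0 Hy); near=> s; rewrite clampE//; apply: ltW; near: s; exact: lt_nbhsr.
by rewrite (Int_FTC2 y0 cdy (continuous_subspaceT cdd) H) !clampE// bd subr0.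
Unshelve. all: by end_near. Qed.

Lemma cos_partialN (P : R) c N x y : cos_partial P c N (- x) y = cos_partial P c N x y.
Proof. by apply: eq_sq => m n; rewrite mulrN cosN. Qed.

Section energy_estimate.
Variables (v : R -> R -> R -> R) (M P C : R) (B : R -> R -> R) (tau : nat -> R).
Hypotheses (M0 : 0 < M) (sv : smooth_half_space v) (wv : wave v)
  (vet : forall x y t, v x y (- t) = v x y t)
  (P0 : 0 < P) (MP : M <= P) (C0 : 0 <= C)
  (contB : continuous (fun z : R * R => B z.1 z.2)) (eB : forall x y, B (- x) y = B x y)
  (vB : forall x y, `|x| <= M -> 0 <= y <= M -> B x y = dy v x y 0)
  (B0 : forall x, Int 0 P (B x) = 0) (tau0 : tau N @[N --> \oo] --> 0)
  (Htau : forall N N', (N <= N')%N -> sq N' maj - sq N maj <= tau N).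
Let c := cos_coeff P B.
Hypothesis cle : forall m n, `|c m n| * (1 + wavenum P m) <= C * maj m n.

Let tau_ge0 N : 0 <= tau N.
Proof. by have := @Htau N N (leqnn N); rewrite subrr. Qed.

Let err N : R -> R -> R -> R := fun x y t => v x y t + -1 * mode_sum P c N x y t.

Let err_wave N : wave (err N).
Proof. exact: (wave_add wv (wave_scale (-1) (@mode_sum_wave R P c N))). Qed.

Let err_jet N : jet (err N) (fun x y t => dx v x y t + -1 * mode_sum_x P c N x y t)
  (fun x y t => dy v x y t + -1 * mode_sum_y P c N x y t)
  (fun x y t => dt v x y t + -1 * mode_sum_t P c N x y t).
Proof. exact: (jet_add (Ck_jet (sv 1)) (jet_scale (-1) (mode_sum_jet c P0 N))). Qed.

(** For [x >= 0] this is the cosine expansion of the cut off data; evenness covers negative [x]. *)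
Let err_y0 N x y : `|x| <= M -> 0 <= y <= M -> `|clamp (dy (err N)) x y 0| <= C * tau N.
Proof.
move=> xM yM; have y0 : 0 <= y by case/andP: yM.
have [_ E _] := jetE x 0 (@err_jet N) y0.
rewrite clampE// E mode_sum_y0 mulN1r -(vB xM yM).
have H x' : 0 <= x' <= P -> `|B x' y - cos_partial P c N x' y| <= C * tau N.
  move=> x'P; apply: (cosine_expansion P0 contB C0 _ (fun x _ => B0 x) tau0 Htau N x'P).
    by move=> m n; exact: (coeff_le P0 cle).
  by case/andP: yM => -> /le_trans; apply.
move: xM; rewrite ler_norml => /andP[x1 x2]; have [h|h] := leP 0 x.
  by apply: H; rewrite h (le_trans x2).
by rewrite -eB -cos_partialN; apply: H; rewrite oppr_ge0 (ltW h) lerNl; apply: le_trans x1; rewrite lerN2.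
Qed.

(** The error of the [y]-derivative at time 0 is integrated from the boundary, where the Dirichlet
    condition makes the error itself vanish. *)
Lemma value_estimate N y : 0 <= y <= M ->
  `|v 0 y 0 - sq N (fun m n => c m n / wavenum P n.+1 * sin (wavenum P n.+1 * y))| <= C * tau N * y.
Proof.
move=> /andP[y0 yM].
have -> : v 0 y 0 - sq N (fun m n => c m n / wavenum P n.+1 * sin (wavenum P n.+1 * y)) = err N 0 y 0.
  rewrite /err mulN1r; congr (_ - _); apply: eq_sq => m n.
  by rewrite /mode !mulr0 cos0 mul1r mulr1.
rewrite (wave_primitive _ _ (err_wave N) y0) -[X in _ * X]subr0; apply: Int_bound => //.
  apply: (@cont_comp2 _ _ _ _ (fun x y => clamp (dy (err N)) x y 0)); [|by ctn..].
  by have [ce _ _] := err_wave N; exact: clamp_cont2 (Ck_dy ce).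
by move=> z /andP[z0 zy]; apply: err_y0; rewrite ?normr0 ?(ltW M0)// z0 (le_trans zy).
Qed.

Let kp : R := pi / P.

Let Hkp : 0 < kp. Proof. by rewrite divr_gt0 ?pi_gt0. Qed.

(** The differentiated series converges uniformly to some [X], and the partial sums converge to [v];
    by [deriv_limit] the function [X] is the [x]-derivative of [v]. *)
Let err_x0 N x y : `|x| <= M -> 0 <= y <= M ->
  `|clamp (dx (err N)) x y 0| <= (C * M + C / kp) * tau N.
Proof.
move=> xM yM; have y0 : 0 <= y by case/andP: yM.
have [|||X contX HX] := @uniform_limit R _ (fun N (z : R * R) => mode_sum_x P c N z.1 z.2 0) (fun N => C / kp * tau N).
- move=> N'; have cc := @mode_sum_x_cont R P c N'.
  by apply: (@cont_comp3 _ _ _ _ _ (fun x y t => mode_sum_x P c N' x y t)) => //; ctn.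
- by rewrite -(mulr0 (C / kp)); apply: cvgM => //; exact: cvg_cst.
- by move=> N1 N2 z NN; exact: mode_sum_x_tail.
have CM : 0 <= C * M by rewrite mulr_ge0// ltW.
have Ck : 0 <= C / kp by rewrite divr_ge0// ltW.
have le1 N' : C / kp * tau N' <= (C * M + C / kp) * tau N' by rewrite ler_wpM2r// lerDr.
have [E _ _] := jetE x 0 (@err_jet N) y0.
rewrite clampE// E mulN1r.
have -> : dx v x y 0 = X (x, y); last by apply: le_trans (HX N (x, y)) (le1 N).
have jv := Ck_jet (sv 1).
have MM : - M < M by rewrite gtrN.
have xM' : - M <= x <= M by rewrite -ler_norml.
have cXy : continuous (fun x => X (x, y)) by ctn.
apply: (@deriv_limit R (fun x => v x y 0) (fun x => dx v x y 0) (fun x => X (x, y))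
  (fun N x => mode_sum P c N x y 0) (fun N x => mode_sum_x P c N x y 0) tau (C * M + C / kp) _ _ MM tau0 _ cXy _ _ _ _ _ x xM').
- have cvx := clamp_cont2 0 (Ck_dx (sv 1)).
  have : continuous (fun x => clamp (dx v) x y 0) by apply: (@cont_comp2 _ _ _ _ (fun x y => clamp (dx v) x y 0)) => //; ctn.
  by rewrite /clamp max_l.
- move=> N'; have cc := @mode_sum_x_cont R P c N'.
  by apply: (@cont_comp3 _ _ _ _ _ (fun x y t => mode_sum_x P c N' x y t)) => //; ctn.
- by move=> z; have [H _ _] := jv z y 0 y0.
- by move=> N' z; have [H _ _] := mode_sum_jet c P0 N' z 0 y0.
- move=> N' z zM.
  have -> : v z y 0 - mode_sum P c N' z y 0 = err N' z y 0 by rewrite /err mulN1r.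
  rewrite (wave_primitive _ _ (err_wave N') y0).
  apply: le_trans (_ : C * tau N' * (y - 0) <= _).
    apply: Int_bound => //.
      apply: (@cont_comp2 _ _ _ _ (fun x y => clamp (dy (err N')) x y 0)); [|by ctn..].
      by have [ce _ _] := err_wave N'; exact: clamp_cont2 (Ck_dy ce).
    move=> s /andP[s0 sy]; apply: err_y0; first by rewrite ler_norml.
    by rewrite s0; case/andP: yM => _; exact: le_trans.
  rewrite subr0 mulrAC; apply: ler_wpM2r => //; rewrite -[leLHS]addr0; apply: lerD => //.
  by case/andP: yM => _ yM; rewrite ler_wpM2l.
- by move=> N' z zM; apply: le_trans (HX N' (z, y)) (le1 N').
Qed.

(** Evenness in time kills the initial velocity of [v], and the cosines in [t] kill that of the
    modes. *)
Let err_t0 N x y : 0 <= y -> clamp (dt (err N)) x y 0 = 0.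
Proof.
move=> y0; have [_ _ E] := jetE x 0 (@err_jet N) y0.
rewrite clampE// E mode_sum_t0 mulr0 addr0.
have [_ _ H] := Ck_jet (sv 1) x 0 y0.
have H' : is_derive (- (0 : R)) 1 (fun t => v x y t) (dt v x y 0) by rewrite oppr0.
have Ng : is_derive (0 : R) 1 (fun t : R => - t) (- 1) by der; ring.
have D := @der_comp R (fun t => v x y t) (fun t => - t) 0 _ _ H' Ng.
have : dt v x y 0 = dt v x y 0 * -1.
  apply: (is_derive_uniq H); rewrite (_ : (fun t => v x y t) = (fun t => v x y (- t)))//.
  by apply/funext => z; rewrite vet.
by rewrite mulrN1 => /eqP; rewrite eq_sym eqNr => /eqP.
Qed.

Let Kx := C * M + C / kp.
Let Ken := (M ^+ 2) ^+ 2 * (Kx ^+ 2 + C ^+ 2) * (M - - M) * (M - 0).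

Let err_energy N t : 0 <= t <= M ->
  energy M (clamp (dx (err N))) (clamp (dy (err N))) (clamp (dt (err N))) t <= Ken * tau N ^+ 2.
Proof.
move=> tM; apply: le_trans (energy_le (err_wave N) tM) _.
have [ce _ _] := err_wave N.
have M0' := ltW M0; have MM : - M <= M by rewrite ge0_cp.
apply: le_trans (ler_norm _) _.
have -> : Ken * tau N ^+ 2 = ((M ^+ 2) ^+ 2 * ((Kx * tau N) ^+ 2 + (C * tau N) ^+ 2)) * (M - - M) * (M - 0).
  by rewrite /Ken; ring.
rewrite /energy; apply: (@Int2_bound R (fun y x => pospow 2 (cone M x y 0) *
   (clamp (dx (err N)) x y 0 ^+ 2 + clamp (dy (err N)) x y 0 ^+ 2 + clamp (dt (err N)) x y 0 ^+ 2))) => //.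
  have k1 := clamp_cont2 0 (Ck_dx ce); have k2 := clamp_cont2 0 (Ck_dy ce).
  have k3 : continuous (fun z : R * R => clamp (dt (err N)) z.1 z.2 0).
    by apply: (@clamp_cont2 1); case: ce => _ [].
  have kc : continuous (fun z : R * R => pospow 2 (cone M z.2 z.1 0)).
    by apply: (@cont_comp3 _ _ _ _ _ (fun x y t => pospow 2 (cone M x y t))); [exact: cone_cont|ctn..].
  have sw (f : R -> R -> R) : continuous (fun z : R * R => f z.1 z.2) -> continuous (fun z : R * R => f z.2 z.1).
    by move=> cf; apply: (@cont_comp2 _ _ _ _ f) => //; ctn.
  move: k1 k2 k3 => /(sw (fun x y => clamp (dx (err N)) x y 0)) k1 /(sw (fun x y => clamp (dy (err N)) x y 0)) k2
    /(sw (fun x y => clamp (dt (err N)) x y 0)) k3.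
  exact: contM kc (contD (contD (contX (n := 2) k1) (contX (n := 2) k2)) (contX (n := 2) k3)).
move=> y x yM; rewrite -ler_norml => xM; rewrite normrM; apply: ler_pM => //.
  rewrite ger0_norm ?pospow_ge0//; apply: cone_weight_le; by rewrite lexx.
rewrite err_t0; last by case/andP: yM.
rewrite expr0n/= addr0 ger0_norm; last by rewrite addr_ge0// sqr_ge0.
have sq_le (a b : R) : `|a| <= b -> a ^+ 2 <= b ^+ 2.
  by move=> ab; rewrite -(real_normK (num_real a)); apply: lerXn2r; rewrite ?nnegrE// (le_trans _ ab).
by apply: lerD; apply: sq_le; [exact: err_x0|exact: err_y0].
Qed.

(** The initial energy of the error is of order [tau N ^+ 2] and does not increase, so the
    [y]-derivatives of the partial sums tend to that of [v] in the weighted square mean. They also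
    converge uniformly to [F], whence equality on the boundary inside the cone. *)
Lemma boundary_estimate N x t : 0 <= t <= M -> `|x| < M - t ->
  `|dy v x 0 t - sq N (fun m n => c m n * (cos (wavenum P m * x) * cos (freq P m n * t)))| <= C * tau N.
Proof.
move=> tM xM.
have -> : sq N (fun m n => c m n * (cos (wavenum P m * x) * cos (freq P m n * t))) = mode_sum_y P c N x 0 t.
  by apply: eq_sq => m n; rewrite mulr0 cos0 mulr1.
have [|||F cF HF] := @uniform_limit R _ (fun N (z : R * R) => mode_sum_y P c N z.1 z.2 t) (fun N => C * tau N).
- move=> N'; have cc := @mode_sum_y_cont R P c N'.
  by apply: (@cont_comp3 _ _ _ _ _ (fun x y t => mode_sum_y P c N' x y t)) => //; ctn.
- by rewrite -(mulr0 C); apply: cvgM => //; exact: cvg_cst.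
- move=> N1 N2 z NN; exact: (mode_sum_y_tail P0 C0 cle Htau).
have -> : dy v x 0 t = F (x, 0); last exact: (HF N (x, 0)).
have Ken0 : 0 <= Ken by rewrite /Ken; apply: mulr_ge0; rewrite ?opprK ?subr0 ?addr_ge0 ?(ltW M0)//; do 2!rewrite mulr_ge0 ?sqr_ge0 ?addr_ge0 ?sqr_ge0 ?(ltW M0)//.
have cF' : continuous (fun z : R * R => F (z.1, z.2)) by ctn.
have [_ [_ _ svy _]] := sv 1.
have cq := clamp_cont2 t (Ck_dy (sv 1)).
have := @boundary_value R M t (fun x y => clamp (dy v) x y t) (fun x y => F (x, y))
  (fun N x y => clamp (dy (err N)) x y t) tau (C + Ken) M0 tM tau0 cq cF' _ _ _ x xM.
rewrite (clampE _ _ _ (lexx 0)); apply.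
- by move=> N'; have [ce _ _] := err_wave N'; exact: clamp_cont2 (Ck_dy ce).
- move=> N' x' y' y'0; rewrite !(clampE _ _ _ y'0).
  have [_ E _] := jetE x' t (@err_jet N') y'0; rewrite E mulN1r subKr.
  apply: le_trans (HF N' (x', y')) _; rewrite mulrDl lerDl; exact: mulr_ge0.
- move=> N'; apply: le_trans (_ : Ken * tau N' ^+ 2 <= _); last first.
    by rewrite mulrDl lerDr mulr_ge0// sqr_ge0.
  apply: le_trans (err_energy N' tM).
  have [ce _ _] := err_wave N'.
  have ct : Ck_half_space 1 (dt (err N')) by case: ce => _ [].
  exact: (energy_ge t (ltW M0) (clamp_cont (Ck_dx ce)) (clamp_cont (Ck_dy ce)) (clamp_cont ct)).
Qed.
End energy_estimate.
End representation_theorem.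

(** * Passage to the limit *)

Section limit.
Context {R : realType}.
Implicit Types (x y t h : R) (m n N : nat).

Lemma common_delta (Q : nat -> R -> Prop) :
  (forall n, exists2 d : R, 0 < d & forall h : R, 0 < h < d -> Q n h) ->
  forall N, exists2 d : R, 0 < d & forall h : R, 0 < h < d -> forall n, (n < N)%N -> Q n h.
Proof.
move=> H; elim=> [|N [d d0 Hd]]; first by exists 1.
have [d' d'0 Hd'] := H N; exists (Num.min d d'); first by rewrite lt_min d0.
move=> h /andP[h0]; rewrite lt_min => /andP[hd hd'] n; rewrite ltnS leq_eqVlt => /predU1P[->|nN].
  by apply: Hd'; rewrite h0.
by apply: Hd => //; rewrite h0.
Qed.

Lemma tau_le (tau : nat -> R) (K b z : R) N : tau n @[n --> \oo] --> 0 ->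
  (forall n, (N <= n)%N -> z <= K * tau n + b) -> z <= b.
Proof.
move=> t0 H.
have l : K * tau n + b @[n --> \oo] --> b.
  by rewrite -[X in _ --> X]add0r -(mulr0 K); apply: cvgD; [apply: cvgM => //|]; exact: cvg_cst.
rewrite -(cvg_lim _ l)//; apply: limr_ge; first by apply/cvg_ex; eexists; exact: l.
by exists N.
Qed.

Lemma dist3_le (j s u v a b d : R) : `|j - s| <= a -> `|s - u| <= b -> `|v - u| <= d ->
  `|j - v| <= a + b + d.
Proof. by rewrite !ler_norml => /andP[? ?] /andP[? ?] /andP[? ?]; apply/andP; split; lra. Qed.

Section functional.
Variables (c y0 eps : R).
Hypotheses (c0 : 0 < c) (y00 : 0 < y0) (eps0 : 0 < eps).
Let L := y0 + eps.
Let L0 : 0 < L. Proof. exact: addr_gt0. Qed.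
Let LL : - L <= L. Proof. by rewrite ge0_cp// ltW. Qed.
Let yy : - y0 <= y0. Proof. by rewrite ge0_cp// ltW. Qed.

Definition Jint h (f : R -> R -> R) : R :=
  Int (- y0) y0 (fun t => Int (- L) L (fun x => Kr c y0 h x t * f x t)).

Let KrC h : 0 < h -> continuous (fun q : R * R => Kr c y0 h q.1 q.2) := @Kr_cont R c y0 c0 h.

Let KrC' h (f : R -> R -> R) : 0 < h -> continuous (fun q : R * R => f q.1 q.2) ->
  continuous (fun q : R * R => Kr c y0 h q.2 q.1 * f q.2 q.1).
Proof.
move=> h0 cf; have k := KrC h0.
apply: contM; first by apply: (@cont_comp2 _ _ _ _ (Kr c y0 h)) => //; ctn.
by apply: (@cont_comp2 _ _ _ _ f) => //; ctn.
Qed.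

Let inner_cont h (f : R -> R -> R) : 0 < h -> continuous (fun q : R * R => f q.1 q.2) ->
  continuous (fun t => Int (- L) L (fun x => Kr c y0 h x t * f x t)).
Proof. by move=> h0 cf; apply: (@cont_Int R R (fun t x => Kr c y0 h x t * f x t) _ _ LL); exact: KrC'. Qed.

Let slice h (f : R -> R -> R) t : 0 < h -> continuous (fun q : R * R => f q.1 q.2) ->
  continuous (fun x => Kr c y0 h x t * f x t).
Proof. by move=> h0 cf; apply: (@cont_comp2 _ _ _ _ (fun t x => Kr c y0 h x t * f x t)); [exact: KrC'|ctn|ctn]. Qed.

Lemma JintD h (f g : R -> R -> R) : 0 < h -> continuous (fun q : R * R => f q.1 q.2) ->
  continuous (fun q : R * R => g q.1 q.2) -> Jint h (fun x t => f x t + g x t) = Jint h f + Jint h g.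
Proof.
move=> h0 cf cg; rewrite /Jint -IntD; [|exact: inner_cont..].
apply: eq_Int => t _; rewrite -IntD; [|exact: slice..].
by apply: eq_Int => x _; rewrite mulrDr.
Qed.

Lemma JintZ h (k : R) (f : R -> R -> R) : 0 < h -> continuous (fun q : R * R => f q.1 q.2) ->
  Jint h (fun x t => k * f x t) = k * Jint h f.
Proof.
move=> h0 cf; rewrite /Jint -IntZ; last exact: inner_cont.
apply: eq_Int => t _; rewrite -IntZ; last exact: slice.
by apply: eq_Int => x _; rewrite mulrCA.
Qed.

Lemma Jint_sum h (I : Type) (r : seq I) (F : I -> R -> R -> R) : 0 < h ->
  (forall i, continuous (fun q : R * R => F i q.1 q.2)) ->
  Jint h (fun x t => \sum_(i <- r) F i x t) = \sum_(i <- r) Jint h (F i).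
Proof.
move=> h0 cF; elim: r => [|j r IH].
  rewrite big_nil /Jint; transitivity (Int (- y0) y0 (fun=> 0 : R)); last exact: Int0.
  apply: eq_Int => t _; rewrite -[RHS](Int0 (- L) L); apply: eq_Int => x _.
  by rewrite big_nil mulr0.
have cs : continuous (fun q : R * R => \sum_(i <- r) F i q.1 q.2).
  exact: (cont_sum (F := fun i (q : R * R) => F i q.1 q.2)).
rewrite big_cons -IH -(JintD h0 (cF j) cs).
by apply: eq_Int => t _; apply: eq_Int => x _; rewrite big_cons.
Qed.

Lemma Jint_mode h k w : 0 < h ->
  Jint h (fun x t => cos (k * x) * cos (w * t)) = Jmode c y0 eps h k w.
Proof.
move=> h0; have cc : continuous (fun q : R * R => cos (k * q.1)) by ctn.
rewrite /Jint /Jmode; apply: eq_Int => t _; rewrite [RHS]mulrC -IntZ; last first.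
  by have kk := KrC h0; ctn.
by apply: eq_Int => x _; ring.
Qed.

(** The constant depends on [h] and is not controlled as [h] tends to 0; its use is at fixed [h], to
    let the truncation go to infinity. *)
Lemma Jint_bound h : 0 < h -> exists2 A : R, 0 <= A &
  forall (f : R -> R -> R) k, continuous (fun q : R * R => f q.1 q.2) ->
    (forall x t, - L <= x <= L -> - y0 <= t <= y0 -> `|f x t| <= k) -> `|Jint h f| <= A * k.
Proof.
move=> h0; have [S S0 HS] := @cont_bound2 R (Kr c y0 h) (- L) L (- y0) y0 (KrC h0).
have l1 : 0 <= L - - L by rewrite subr_ge0.
have l2 : 0 <= y0 - - y0 by rewrite subr_ge0.
exists (S * (L - - L) * (y0 - - y0)); first by apply: mulr_ge0 => //; apply: mulr_ge0.
move=> f k cf fk; rewrite (_ : _ * k = S * k * (L - - L) * (y0 - - y0)); last by ring.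
apply: (@Int2_bound R (fun t x => Kr c y0 h x t * f x t)) => //; first exact: KrC'.
by move=> t x ht hx; rewrite normrM; apply: ler_pM => //; [exact: HS|exact: fk].
Qed.

(** The kernel is even in [x] and in [t], and both intervals are symmetric; each boolean encodes a
    sign. *)
Lemma Jint_flip h (f : R -> R -> R) (a b : bool) : 0 < h -> continuous (fun q : R * R => f q.1 q.2) ->
  Jint h (fun x t => f ((-1) ^+ a * x) ((-1) ^+ b * t)) = Jint h f.
Proof.
move=> h0 cf.
have KrN x t : Kr c y0 h (- x) t = Kr c y0 h x t.
  by rewrite /Kr; congr (_ * _); apply: eq_Int => s _; exact: kNr_even.
have KrN' x t : Kr c y0 h x (- t) = Kr c y0 h x t by rewrite /Kr sqrrN.
transitivity (Jint h (fun x t => f x ((-1) ^+ b * t))).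
  case: a; last by apply: eq_Int => t _; apply: eq_Int => x _; rewrite expr0 mul1r.
  apply: eq_Int => t _; rewrite -[RHS]Int_opp ?(ltW L0)//; last first.
    by apply: (slice (f := fun x t => f x ((-1) ^+ b * t))) => //; ctn.
  by apply: eq_Int => x _; rewrite expr1 mulN1r KrN.
case: b; last by apply: eq_Int => t _; apply: eq_Int => x _; rewrite expr0 mul1r.
have H := Int_opp (ltW y00) (inner_cont h0 cf).
by rewrite /Jint -H; apply: eq_Int => t _; apply: eq_Int => x _; rewrite expr1 mulN1r KrN'.
Qed.

Section convergence.
Variables (P C : R) (a : nat -> nat -> R) (tau : nat -> R) (f : R -> R -> R) (V : R).
Hypotheses (P0 : 0 < P) (C0 : 0 <= C) (tau0 : tau N @[N --> \oo] --> 0)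
  (Htau : forall N N', (N <= N')%N -> sq N' maj - sq N maj <= tau N)
  (ale : forall m n, `|a m n| <= C * maj m n)
  (cf : continuous (fun q : R * R => f q.1 q.2))
  (Hf : forall N x t, - L <= x <= L -> - y0 <= t <= y0 ->
     `|f x t - sq N (fun m n => a m n * (cos (wavenum P m * x) * cos (freq P m n * t)))| <= C * tau N)
  (HV : forall N, `|V - sq N (fun m n => a m n / wavenum P n.+1 * sin (wavenum P n.+1 * y0))| <= C * tau N * y0).

Let JM h m n := Jmode c y0 eps h (wavenum P m) (freq P m n).

Let modes_cont N : continuous (fun q : R * R =>
  sq N (fun m n => a m n * (cos (wavenum P m * q.1) * cos (freq P m n * q.2)))).
Proof.
rewrite /sq.
apply: (cont_sum (F := fun (m : 'I_N) (q : R * R) => \sum_(n < N) a m n * (cos (wavenum P m * q.1) * cos (freq P m n * q.2)))) => m.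
by apply: (cont_sum (F := fun (n : 'I_N) (q : R * R) => a m n * (cos (wavenum P m * q.1) * cos (freq P m n * q.2)))) => n; ctn.
Qed.

Let Jint_modes h N : 0 < h ->
  Jint h (fun x t => sq N (fun m n => a m n * (cos (wavenum P m * x) * cos (freq P m n * t)))) =
  sq N (fun m n => a m n * JM h m n).
Proof.
move=> h0; rewrite /sq.
rewrite (@Jint_sum h _ _ (fun (m : 'I_N) x t => \sum_(n < N) a m n * (cos (wavenum P m * x) * cos (freq P m n * t))))//; last first.
  by move=> m; apply: (cont_sum (F := fun (n : 'I_N) (q : R * R) => a m n * (cos (wavenum P m * q.1) * cos (freq P m n * q.2)))) => n; ctn.
apply: eq_bigr => m _.
rewrite (@Jint_sum h _ _ (fun (n : 'I_N) x t => a m n * (cos (wavenum P m * x) * cos (freq P m n * t))))//; last first.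
  by move=> n; ctn.
apply: eq_bigr => n _; rewrite (@JintZ h (a m n) (fun x t => cos (wavenum P m * x) * cos (freq P m n * t)))//; last by ctn.
by rewrite Jint_mode.
Qed.

Lemma Jint_cvg e : 0 < e -> exists2 d : R, 0 < d & forall h : R, 0 < h < d -> `|Jint h f - V| <= e.
Proof.
move=> e0.
have kp0 : 0 < pi / P by rewrite divr_gt0 ?pi_gt0.
have [CJ CJ0 HJ] := Jmode_bound c0 y00 eps0 kp0.
have wk m : wavenum P m = 0 \/ pi / P <= wavenum P m.
  case: m => [|m]; first by left; rewrite /wavenum mul0r.
  by right; rewrite /wavenum ler_peMl// ?(ltW kp0)// ler1n.
have HJM h m n : 0 < h <= 1 -> `|JM h m n| <= CJ.
  by move=> h01; apply: HJ => //; exact: wavenum_gt0.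
have tail h N : 0 < h <= 1 -> `|Jint h f - sq N (fun m n => a m n * JM h m n)| <= CJ * C * tau N.
  move=> h01; have h0 : 0 < h by case/andP: h01.
  have [A A0 HA] := Jint_bound h0.
  (* The uncontrolled constant [A] multiplies [tau N'], which disappears as [N'] grows; the constant
     [CJ], uniform in [h], is what remains. *)
  apply: (@tau_le tau (A * C) _ _ N tau0) => N' NN'.
  have H1 : `|Jint h f - sq N' (fun m n => a m n * JM h m n)| <= A * (C * tau N').
    rewrite -Jint_modes// -[X in _ - X]mul1r -mulNr -JintZ// -JintD//; last by apply: contM => //; ctn.
    apply: HA => [|x t xL ty]; first by apply: contD => //; apply: contM => //; ctn.
    by rewrite mulN1r; exact: Hf.
  have H2 : `|sq N' (fun m n => a m n * JM h m n) - sq N (fun m n => a m n * JM h m n)| <= CJ * C * tau N.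
    apply: le_trans (@sq_diff R _ (fun m n => CJ * C * maj m n) N N' NN' _) _ => [m n|].
      by rewrite normrM mulrC -mulrA; apply: ler_pM => //; exact: HJM.
    by rewrite !sqZ -mulrBr ler_wpM2l// ?Htau// mulr_ge0.
  rewrite -(subrKA (sq N' (fun m n => a m n * JM h m n))); apply: le_trans (ler_normD _ _) _.
  by rewrite -mulrA; exact: lerD.
pose Q := CJ * C + C * y0.
have Q0 : 0 <= Q by rewrite /Q addr_ge0// mulr_ge0// ltW.
have Qt : Q * tau N @[N --> \oo] --> 0 by rewrite -(mulr0 Q); apply: cvgM => //; exact: cvg_cst.
have e2 : 0 < e / 2 by rewrite divr_gt0.
have [N _ HN] := (cvgrPdist_lt _ _).1 Qt _ e2.
have tN : Q * tau N <= e / 2.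
  by have := HN N (leqnn N); rewrite /= sub0r normrN => /ltW; apply: le_trans; exact: ler_norm.
pose A := sq N (fun m n => `|a m n|).
have A0 : 0 <= A by apply: sumr_ge0 => m _; apply: sumr_ge0.
(* The tolerance per mode is half of [e] divided by the sum [A] of the moduli of the coefficients
   retained; adding 1 avoids a zero divisor. *)
have e3 : 0 < e / 2 / (A + 1) by rewrite divr_gt0// ltr_wpDl.
have Hm m : exists2 d : R, 0 < d & forall h : R, 0 < h < d -> forall n, (n < N)%N ->
    `|JM h m n - sin (wavenum P n.+1 * y0) / wavenum P n.+1| <= e / 2 / (A + 1).
  apply: (@common_delta (fun n h => `|JM h m n - sin (wavenum P n.+1 * y0) / wavenum P n.+1| <= e / 2 / (A + 1))).
  move=> n; apply: Jmode_cvg => //; [exact: wavenum_ge0|exact: wavenum_gt0].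
have [d d0 Hd] := common_delta Hm N.
exists (Num.min d 1); first by rewrite lt_min d0 ltr01.
move=> h /andP[h0]; rewrite lt_min => /andP[hd h1].
have h01 : 0 < h <= 1 by rewrite h0 ltW.
have H1 := tail h N h01.
have H2 : `|sq N (fun m n => a m n * JM h m n) - sq N (fun m n => a m n / wavenum P n.+1 * sin (wavenum P n.+1 * y0))| <= e / 2.
  apply: le_trans (_ : A * (e / 2 / (A + 1)) <= _); last first.
    by rewrite mulrA ler_pdivrMr ?ltr_wpDl// mulrC ler_pM2l// lerDl.
  rewrite /A /sq -sumrB mulr_suml; apply: le_trans (ler_norm_sum _ _ _) _; apply: ler_sum => m _.
  rewrite -sumrB mulr_suml; apply: le_trans (ler_norm_sum _ _ _) _; apply: ler_sum => n _.
  have -> : a m n * JM h m n - a m n / wavenum P n.+1 * sin (wavenum P n.+1 * y0) =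
     a m n * (JM h m n - sin (wavenum P n.+1 * y0) / wavenum P n.+1) by ring.
  by rewrite normrM; apply: ler_wpM2l => //; apply: Hd => //; rewrite h0.
apply: le_trans (dist3_le H1 H2 (HV N)) _.
rewrite (_ : _ + _ = Q * tau N + e / 2); last by rewrite /Q; ring.
by rewrite [leRHS]splitr lerD2r.
Qed.
End convergence.

Lemma D_le_id z : 0 <= z -> D c z <= z.
Proof.
move=> z0; rewrite /D -[leRHS]mulr1; apply: ler_wpM2l => //.
rewrite -[leRHS]sqrtr1; apply: ler_wsqrtr; rewrite ler_pdivrMr ?mul1r ?lerDl ?mulr_ge0//.
by rewrite ltr_pwDl// mulr_ge0.
Qed.

Lemma D_ge0 z : 0 <= z -> 0 <= D c z.
Proof. by move=> z0; rewrite /D mulr_ge0// sqrtr_ge0. Qed.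

(* [D] is chosen so that the exponent [x ^+ 2 * (c + 2 s) - c s ^+ 2] of the kernel vanishes on [x = D s]. *)
Lemma kernel_exponent x r s : 0 <= s <= r -> D c r + eps < `|x| ->
  c * eps ^+ 2 <= x ^+ 2 * (c + 2 * s) - s ^+ 2 * c.
Proof.
move=> /andP[s0 sr] Hx; have r0 : 0 <= r by exact: le_trans sr.
have cr : 0 < c + 2 * r by rewrite ltr_pwDl// mulr_ge0.
have D0 := D_ge0 r0.
have D2 : D c r ^+ 2 * (c + 2 * r) = r ^+ 2 * c.
  rewrite /D exprMn sqr_sqrtr; last by rewrite divr_ge0// ltW.
  by field; rewrite gt_eqF.
have x2 : D c r ^+ 2 + eps ^+ 2 <= x ^+ 2.
  rewrite -(real_normK (num_real x)).
  have : (D c r + eps) ^+ 2 <= `|x| ^+ 2 by apply: lerXn2r; rewrite ?nnegrE ?addr_ge0 ?(ltW eps0) ?(ltW Hx).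
  by apply: le_trans; rewrite sqrrD addrAC lerDl mulrn_wge0// mulr_ge0// ltW.
have key : s ^+ 2 * c <= D c r ^+ 2 * (c + 2 * s).
  rewrite -(ler_pM2r cr) [leRHS]mulrAC D2.
  have h1 : 0 <= c * ((r - s) * (r + s)) by rewrite mulr_ge0 ?(ltW c0)// mulr_ge0 ?subr_ge0 ?addr_ge0.
  have h2 : 0 <= 2 * r * s * (r - s) by rewrite mulr_ge0 ?subr_ge0// mulr_ge0// mulr_ge0.
  have h3 := mulr_ge0 (ltW c0) h1; have h4 := mulr_ge0 (ltW c0) h2.
  rewrite -subr_ge0 (_ : _ - _ = c * (c * ((r - s) * (r + s))) + c * (2 * r * s * (r - s))) ?addr_ge0//.
  by ring.
have cs : 0 <= c + 2 * s by rewrite addr_ge0 ?(ltW c0)// mulr_ge0.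
have h5 : (D c r ^+ 2 + eps ^+ 2) * (c + 2 * s) <= x ^+ 2 * (c + 2 * s) by exact: ler_wpM2r.
have h6 : 0 <= eps ^+ 2 * (2 * s) by rewrite mulr_ge0 ?sqr_ge0// mulr_ge0.
rewrite lerBrDr; apply: le_trans h5; rewrite mulrDl addrC; apply: lerD => //.
by rewrite mulrDr mulrC lerDl.
Qed.

(** Off [U] the numerator of the exponent is at least [c eps^2] for every [s] up to [rho], so the
    integrand is small pointwise. The factor 4 is generous and gives the bound the shape handled by
    [kdec_small]. *)
Lemma Kr_off_U h x t : 0 < h -> `|t| <= y0 -> `|x| <= L ->
  D c (Num.sqrt (y0 ^+ 2 - t ^+ 2)) + eps < `|x| ->
  `|Kr c y0 h x t| <= 4 * (kA h * kC0 c * expR (- (kdec c L eps / h))).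
Proof.
move=> h0 ty xL xD; set r := kA h * _ * _; set rho := Num.sqrt _ in xD *.
have rho0 : 0 <= rho by exact: sqrtr_ge0.
have p0 := pi_gt0 R.
have r0 : 0 <= r.
  by rewrite /r !mulr_ge0 ?expR_ge0// /kA invr_ge0 sqrtr_ge0.
have p2 : 0 <= pi / 2 :> R by rewrite divr_ge0// ltW.
have cr := kNr_cont c0 h0.
have B : `|Int 0 (pi / 2) (fun s => kNr c h x (rho * sin s))| <= r * (pi / 2 - 0).
  apply: Int_bound => //; first by ctn.
  move=> s /andP[s0 sp].
  have ss0 : 0 <= sin s by apply: sin_ge0_pi; rewrite s0 (le_trans sp)// ler_pdivrMr// ler_peMr ?ler1n// ltW.
  have srho : 0 <= rho * sin s <= rho by rewrite mulr_ge0//= ler_piMr// sin_le1.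
  have E := kernel_exponent srho xD.
  have W (z : R) : 0 < c ^+ 2 + z ^+ 2 by rewrite ltr_wpDr ?sqr_ge0// exprn_gt0.
  have xL2 : x ^+ 2 <= L ^+ 2.
    by rewrite -(real_normK (num_real x)); apply: lerXn2r; rewrite ?nnegrE ?(ltW L0).
  have [] := @kNr_le R c c0 h x (rho * sin s) (kdec c L eps / h) h0 _ => //.
  apply: le_trans E; rewrite /kdec.
  rewrite (_ : _ * _ = c * eps ^+ 2 * ((c ^+ 2 + x ^+ 2) / (c ^+ 2 + L ^+ 2))); last first.
    by field; rewrite !gt_eqF// mulr_gt0.
  rewrite -[leRHS]mulr1; apply: ler_wpM2l; first by rewrite mulr_ge0 ?sqr_ge0// ltW.
  by rewrite ler_pdivrMr// mul1r lerD2l.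
rewrite /Kr normrM normfV (gtr0_norm p0) ler_pdivrMl//; apply: le_trans B _.
rewrite (_ : r * (pi / 2 - 0) = (pi * r) * 2^-1); last by ring.
rewrite (_ : pi * (4 * r) = (pi * r) * 4); last by ring.
apply: ler_wpM2l; first by rewrite mulr_ge0// ltW.
by apply: le_trans (_ : 1 <= _); [rewrite invf_le1 ?ler1n|rewrite ler1n].
Qed.
End functional.
End limit.

(** * Symmetrization and assembly of the formula *)

Section conclusion.
Context {R : realType}.
Implicit Types (u v : R -> R -> R -> R) (x y t h : R).
Local Notation mu2 := (@lebesgue_measure R \x @lebesgue_measure R)%E.

Lemma Rintegral_subset_box (f : R * R -> R) (E : set (measurableTypeR R * measurableTypeR R)) a b a' b' k r :
  continuous f -> measurable E -> E `<=` box a b a' b' -> 0 <= r ->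
  (forall p, box a b a' b' p -> `|f p| <= k) ->
  (forall p, box a b a' b' p -> ~ E p -> `|f p| <= r) ->
  `|\int[mu2]_(p in E) f p - \int[mu2]_(p in box a b a' b') f p| <= r * fine (mu2 (box a b a' b')).
Proof.
move=> cf mE EB r0 fk fr; set Bx := box a b a' b' in EB fk fr *.
have mB : measurable Bx := measurable_box a b a' b'.
have mD : measurable (Bx `\` E) by exact: measurableD.
have DB : Bx `\` E `<=` Bx by move=> p [].
have mf X := measurable_funTS (D := X) (cont_measurable2 cf).
have iB := bounded_integrable2 mB (@subset_refl _ _) (mf _) fk.
have iD := bounded_integrable2 mD DB (mf _) (fun p Dp => fk p (DB p Dp)).
have EU : Bx = E `|` (Bx `\` E) by rewrite setDUK.
have -> : \int[mu2]_(p in Bx) f p = \int[mu2]_(p in E) f p + \int[mu2]_(p in Bx `\` E) f p.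
  rewrite {1}EU; apply: Rintegral_setU => //; first by rewrite -EU.
  by rewrite disj_set2E setDIK.
rewrite opprD addrA subrr sub0r normrN.
have iN : mu2.-integrable (Bx `\` E) (EFin \o (fun p => `|f p|)).
  apply: (@bounded_integrable2 R (fun p => `|f p|) _ a b a' b' k mD DB); last by move=> p /DB /fk; rewrite normr_id.
  by apply: measurable_funTS; apply: cont_measurable2; exact: cont_norm.
have iC : mu2.-integrable (Bx `\` E) (EFin \o (fun p => r)).
  apply: (@bounded_integrable2 R (fun p => r) _ a b a' b' r mD DB); last by move=> p _; rewrite ger0_norm.
  exact: measurable_cst.
apply: le_trans (le_normr_Rintegral mD iD) _.
apply: le_trans (le_Rintegral mD iN iC _) _; first by move=> p [Bp Ep]; exact: fr.
rewrite Rintegral_cst//; apply: ler_wpM2l => //.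
have fB : (mu2 Bx < +oo)%E by exact: box_measure.
apply: fine_le; last by rewrite le_measure ?inE.
- by rewrite ge0_fin_numE//; apply: le_lt_trans fB; rewrite le_measure ?inE.
- by rewrite ge0_fin_numE.
Qed.

Lemma measurable_U c eps x0 y0 t0 : 0 < c ->
  measurable (U c eps x0 y0 t0 : set (measurableTypeR R * measurableTypeR R)).
Proof.
move=> c0.
pose g1 (p : R * R) := `|p.2 - t0|.
pose g2 (p : R * R) := `|p.1 - x0| - (D c (Num.sqrt (y0 ^+ 2 - (p.2 - t0) ^+ 2)) + eps).
have c1' : continuous g1 by rewrite /g1; ctn.
have c2' : continuous g2.
  rewrite /g2 /D; ctn => p; apply: lt0r_neq0; rewrite ltr_pwDl// mulr_ge0// sqrtr_ge0.
have mg g (b : R) : continuous g -> measurable (g @^-1` `]-oo, b] : set (measurableTypeR R * measurableTypeR R)).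
  move=> cg; rewrite -[X in measurable X]setTI; exact: (cont_measurable2 cg measurableT).
have -> : U c eps x0 y0 t0 = (g1 @^-1` `]-oo, y0]) `&` (g2 @^-1` `]-oo, 0]).
  by apply/seteqP; split => p; rewrite /U /g1 /g2 /= !in_itv/= subr_le0.
by apply: measurableI; exact: mg.
Qed.

(** Even part about [(x0, t0)] in both variables, moved to the origin. The factors 1 and -1 are
    written out so that every term has the form treated by [Ck_affine] and [wave_affine]. *)
Definition symmetrize u x0 t0 x y t : R :=
  1 / 4 * (u (x0 + 1 * x) y (t0 + 1 * t) + u (x0 + -1 * x) y (t0 + 1 * t) +
           u (x0 + 1 * x) y (t0 + -1 * t) + u (x0 + -1 * x) y (t0 + -1 * t)).

Lemma symmetrize_smooth u x0 t0 : smooth_half_space u -> smooth_half_space (symmetrize u x0 t0).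
Proof.
move=> su k; have A a b := Ck_affine x0 a t0 b (su k).
exact: Ck_scale (Ck_add (Ck_add (Ck_add (A 1 1) (A (-1) 1)) (A 1 (-1))) (A (-1) (-1))).
Qed.

Lemma symmetrize_wave u x0 t0 : wave u -> wave (symmetrize u x0 t0).
Proof.
move=> wu; have q1 : (1 : R) ^+ 2 = 1 by rewrite expr1n.
have q2 : (-1 : R) ^+ 2 = 1 by rewrite sqrrN expr1n.
exact: wave_scale (wave_add (wave_add (wave_add (wave_affine x0 t0 q1 q1 wu) (wave_affine x0 t0 q2 q1 wu))
  (wave_affine x0 t0 q1 q2 wu)) (wave_affine x0 t0 q2 q2 wu)).
Qed.

Lemma symmetrize_dy u x0 t0 x t : Ck_half_space 1 u ->
  dy (symmetrize u x0 t0) x 0 t = 1 / 4 * (dy u (x0 + 1 * x) 0 (t0 + 1 * t) + dy u (x0 + -1 * x) 0 (t0 + 1 * t) +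
           dy u (x0 + 1 * x) 0 (t0 + -1 * t) + dy u (x0 + -1 * x) 0 (t0 + -1 * t)).
Proof.
move=> cu; have A a b := jet_affine x0 a t0 b (Ck_jet cu).
by have [_ -> _] := jetE x t (jet_scale (1 / 4) (jet_add (jet_add (jet_add (A 1 1) (A (-1) 1)) (A 1 (-1))) (A (-1) (-1)))) (lexx 0).
Qed.

Lemma symmetrizeNx u x0 t0 x y t : symmetrize u x0 t0 (- x) y t = symmetrize u x0 t0 x y t.
Proof. by rewrite /symmetrize !mul1r !mulN1r !opprK; congr (_ * _); ring. Qed.

Lemma symmetrizeNt u x0 t0 x y t : symmetrize u x0 t0 x y (- t) = symmetrize u x0 t0 x y t.
Proof. by rewrite /symmetrize !mul1r !mulN1r !opprK; congr (_ * _); ring. Qed.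

Lemma Jint_symmetrize c y0 eps u x0 t0 h : 0 < c -> 0 < y0 -> 0 < eps -> 0 < h -> Ck_half_space 1 u ->
  continuous (fun q : R * R => dy u q.1 0 q.2) ->
  Jint c y0 eps h (fun x t => dy (symmetrize u x0 t0) x 0 t) =
  Jint c y0 eps h (fun x t => dy u (x0 + x) 0 (t0 + t)).
Proof.
move=> c0 y00 eps0 h0 cu cdy; pose w x t := dy u (x0 + x) 0 (t0 + t).
have cw : continuous (fun q : R * R => w q.1 q.2).
  by apply: (@cont_comp2 _ _ _ _ (fun x t => dy u x 0 t)) => //; ctn.
pose W (a b : bool) x t := w ((-1) ^+ a * x) ((-1) ^+ b * t).
have cW a b : continuous (fun q : R * R => W a b q.1 q.2) by rewrite /W; ctn.
have E : (fun x t => dy (symmetrize u x0 t0) x 0 t) =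
    (fun x t => 1 / 4 * (W false false x t + W true false x t + W false true x t + W true true x t)).
  by apply/funext => x; apply/funext => t; rewrite symmetrize_dy// /W /w !expr0 !expr1.
have cA : continuous (fun q : R * R => W false false q.1 q.2 + W true false q.1 q.2) by exact: contD.
have cA' : continuous (fun q : R * R => W false false q.1 q.2 + W true false q.1 q.2 + W false true q.1 q.2) by exact: contD.
have cA'' : continuous (fun q : R * R => W false false q.1 q.2 + W true false q.1 q.2 + W false true q.1 q.2 + W true true q.1 q.2) by exact: contD.
have F a b : Jint c y0 eps h (W a b) = Jint c y0 eps h w by exact: (Jint_flip c0 y00 eps0 a b h0 cw).
rewrite E.
rewrite (@JintZ R c y0 eps c0 y00 eps0 h (1 / 4) (fun x t => W false false x t + W true false x t + W false true x t + W true true x t) h0 cA'').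
rewrite (@JintD R c y0 eps c0 y00 eps0 h (fun x t => W false false x t + W true false x t + W false true x t) _ h0 cA' (cW _ _)).
rewrite (@JintD R c y0 eps c0 y00 eps0 h (fun x t => W false false x t + W true false x t) _ h0 cA (cW _ _)).
rewrite (@JintD R c y0 eps c0 y00 eps0 h _ _ h0 (cW false false) (cW true false)).
rewrite (F false false) (F true false) (F false true) (F true true).
by move: (Jint _ _ _ _ w) => j; field.
Qed.

Lemma Jint_limit c y0 eps v e : 0 < c -> 0 < y0 -> 0 < eps -> 0 < e ->
  smooth_half_space v -> wave v ->
  (forall x y t, v (- x) y t = v x y t) -> (forall x y t, v x y (- t) = v x y t) ->
  exists2 d : R, 0 < d & forall h : R, 0 < h < d ->
    `|Jint c y0 eps h (fun x t => dy v x 0 t) - v 0 y0 0| <= e.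
Proof.
move=> c0 y00 eps0 e0 sv wv vex vet.
(* For [t <= y0] this gives [M - t >= y0 + eps + 1], so the part of the rectangle with [t >= 0] lies
   in the domain of [boundary_estimate]. *)
pose M := y0 + eps + y0 + 1.
have M0 : 0 < M by rewrite /M; lra.
have [B [contB eB vB B0 [C C0 HC]]] := cutoff_data (ltW M0) sv wv vex.
have P0 : 0 < M + 3 by lra.
have MP : M <= M + 3 by lra.
have [tau tau0 Htau] := @tails R.
have cdy : continuous (fun q : R * R => dy v q.1 0 q.2).
  have := clamp_cont (Ck_dy (sv 1)) => k.
  have := (@cont_comp3 _ _ _ _ _ (clamp (dy v)) (fun q : R * R => q.1) (fun=> 0) (fun q : R * R => q.2) k) .
  rewrite /clamp maxxx; apply; ctn.
have yM : 0 <= y0 <= M by rewrite (ltW y00) /M; lra.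
apply: (@Jint_cvg R c y0 eps c0 y00 eps0 (M + 3) C (cos_coeff (M + 3) B) tau) => //.
- by move=> m n; exact: (coeff_le P0 HC).
- have pos N x t : - (y0 + eps) <= x <= y0 + eps -> 0 <= t <= y0 ->
     `|dy v x 0 t - sq N (fun m n => cos_coeff (M + 3) B m n * (cos (wavenum (M + 3) m * x) * cos (freq (M + 3) m n * t)))| <= C * tau N.
    move=> xL /andP[t0 ty].
    have tM : 0 <= t <= M by rewrite t0 (le_trans ty)//; case/andP: yM.
    have xM : `|x| < M - t.
      by apply: (@le_lt_trans _ _ (y0 + eps)); [rewrite ler_norml|rewrite /M; lra].
    have := boundary_estimate M0 sv wv vet P0 MP C0 contB eB vB B0 tau0 Htau HC N tM xM.
    exact.
  (* The energy argument runs forward in time; negative times follow from evenness of [v] and of the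
     cosines. *)
  move=> N x t xL /andP[t1 t2]; have [t0|t0] := leP 0 t; first by apply: pos; rewrite ?t0.
  have -> : dy v x 0 t = dy v x 0 (- t).
    by rewrite /dy; congr (if _ then _ else _); rewrite (_ : (fun y' => v x y' t) = (fun y' => v x y' (- t)))//;
      apply/funext => z; rewrite vet.
  have -> : sq N (fun m n => cos_coeff (M + 3) B m n * (cos (wavenum (M + 3) m * x) * cos (freq (M + 3) m n * t))) =
     sq N (fun m n => cos_coeff (M + 3) B m n * (cos (wavenum (M + 3) m * x) * cos (freq (M + 3) m n * - t))).
    by apply: eq_sq => m n; rewrite mulrN cosN.
  by apply: pos => //; apply/andP; split; lra.
- by move=> N; apply: (value_estimate M0 sv wv P0 MP C0 contB eB vB B0 tau0 Htau HC).
Qed.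
End conclusion.

Theorem mainTheorem1 (R : realType) (x0 y0 t0 c eps : R)
    (u : R -> R -> R -> R) :
  0 < y0 -> 0 < c -> 0 < eps ->
  smooth_half_space u ->
  (forall x y t : R, 0 < y ->
    dt (dt u) x y t - dx (dx u) x y t - dy (dy u) x y t = 0) ->
  (forall x t : R, u x 0 t = 0) ->
  (\int[(lebesgue_measure \x lebesgue_measure)%E]_(p in U c eps x0 y0 t0)
     (K c h (p.1 - x0) y0 (p.2 - t0) * dy u p.1 0 p.2))
    @[h --> 0^'+] --> u x0 y0 t0.
Proof.
move=> y00 c0 eps0 su wu bu.
have Wu : wave u by split; [exact: su|exact: (wave_op_boundary (su 2%N) wu)|].
have cdy : continuous (fun q : R * R => dy u q.1 0 q.2).
  have := clamp_cont (Ck_dy (su 1)) => k.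
  have := (@cont_comp3 _ _ _ _ _ (clamp (dy u)) (fun q : R * R => q.1) (fun=> 0) (fun q : R * R => q.2) k) .
  rewrite /clamp maxxx; apply; ctn.
pose L := y0 + eps.
have L0 : 0 < L by exact: addr_gt0.
pose Bx := box (x0 - L) (x0 + L) (t0 - y0) (t0 + y0).
have bxE p : Bx p <-> `|p.1 - x0| <= L /\ `|p.2 - t0| <= y0.
  rewrite /Bx /box /= !in_itv/= !ler_distl; split => -[].
    by move=> /andP[-> ->] /andP[-> ->].
  by move=> /andP[-> ->] /andP[-> ->].
have UB : U c eps x0 y0 t0 `<=` Bx.
  move=> p [h1 h2]; apply/bxE; split => //; apply: le_trans h2 _; rewrite lerD2r.
  apply: le_trans (D_le_id c0 (sqrtr_ge0 _)) _.
  rewrite -[leRHS](ger0_norm (ltW y00)) -sqrtr_sqr; apply: ler_wsqrtr.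
  by rewrite gerBl sqr_ge0.
have mU := measurable_U eps x0 y0 t0 c0.
have xL : x0 - L <= x0 + L by rewrite lerD2l ge0_cp// ltW.
have ty : t0 - y0 <= t0 + y0 by rewrite lerD2l ge0_cp// ltW.
have LL : - L <= L by rewrite ge0_cp// ltW.
have yy : - y0 <= y0 by rewrite ge0_cp// ltW.
have [G G0 HG] := @cont_bound2 R (fun x t => dy u x 0 t) (x0 - L) (x0 + L) (t0 - y0) (t0 + y0) cdy.
have [Cd Cd0 HCd] := kdec_small L c0 eps0.
pose A : R := fine ((@lebesgue_measure R \x @lebesgue_measure R)%E Bx).
have A0 : 0 <= A by exact: fine_ge0.
apply/cvgrPdist_le => e e0; have e2 : 0 < e / 2 by rewrite divr_gt0.
have [d d0 Hd] := Jint_limit c0 y00 eps0 e2 (symmetrize_smooth x0 t0 su) (symmetrize_wave x0 t0 Wu)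
  (symmetrizeNx u x0 t0) (symmetrizeNt u x0 t0).
have S0 : symmetrize u x0 t0 0 y0 0 = u x0 y0 t0.
  by rewrite /symmetrize !mulr0 !addr0; field.
(* For [h <= 1] the contribution of the rectangle minus [U] is at most [Cd * h * G * A]; below this
   threshold for [h] it is at most half of [e]. *)
have q0 : 0 < e / 2 / (Cd * G * A + 1).
  by rewrite divr_gt0// ltr_wpDl// !mulr_ge0.
near=> h.
have h0 : 0 < h by near: h; exact: nbhs_right_gt.
have hd : h < d by near: h; exact: nbhs_right_lt.
have h1 : h <= 1 by near: h; apply: nbhs_right_le.
have hq : h < e / 2 / (Cd * G * A + 1) by near: h; exact: nbhs_right_lt.
pose g (p : R * R) := Kr c y0 h (p.1 - x0) (p.2 - t0) * dy u p.1 0 p.2.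
have -> : (fun p : R * R => K c h (p.1 - x0) y0 (p.2 - t0) * dy u p.1 0 p.2) = g.
  by apply/funext => p; rewrite /g K_Kr.
have kr := @Kr_cont R c y0 c0 h h0.
have cg : continuous g.
  rewrite /g; apply: contM; last by [].
  by apply: (@cont_comp2 _ _ _ _ (Kr c y0 h)) => //; ctn.
have cg' : continuous (fun q : R * R => (fun x t => g (x, t)) q.1 q.2).
  by rewrite (_ : (fun q : R * R => _) = g)//; apply/funext => -[].
have [k k0 Hk] := @cont_bound2 R (fun x t => g (x, t)) (x0 - L) (x0 + L) (t0 - y0) (t0 + y0) cg'.
have gk p : Bx p -> `|g p| <= k.
  by case: p => x t [/=]; rewrite !in_itv/=; exact: Hk.
pose r := Cd * h * Num.sqrt h * G.
have sh : 0 <= Cd * h * Num.sqrt h by rewrite !mulr_ge0 ?sqrtr_ge0// ltW.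
have r0 : 0 <= r by rewrite /r mulr_ge0.
have gr p : Bx p -> ~ U c eps x0 y0 t0 p -> `|g p| <= r.
  move=> Bp NU; have [px pt] := (bxE p).1 Bp.
  rewrite /g normrM; apply: ler_pM => //; last first.
    by case: p Bp {NU px pt} => x t [/=]; rewrite !in_itv/=; exact: HG.
  apply: le_trans (HCd h h0); apply: Kr_off_U => //.
  by rewrite ltNge; apply/negP => H; exact: NU.
have H1 := Rintegral_subset_box cg mU UB r0 gk gr.
have H2 : \int[(lebesgue_measure \x lebesgue_measure)%E]_(p in Bx) g p =
    Jint c y0 eps h (fun x t => dy u (x0 + x) 0 (t0 + t)).
  rewrite (Rintegral_box cg gk xL ty).2.
  have contI : continuous (fun t => Int (x0 - L) (x0 + L) (fun x => g (x, t))).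
    by apply: (@cont_Int R R (fun t x => g (x, t))) => //; ctn.
  rewrite -(Int_shift t0 yy contI) /Jint; apply: eq_Int => t _.
  have cgt : continuous (fun x => g (x, t0 + t)) by ctn.
  rewrite -(Int_shift x0 LL cgt); apply: eq_Int => x _.
  by rewrite /g /= (addrC x0) addrK (addrC t0) addrK.
have H3 := Hd h; rewrite h0 hd S0 (Jint_symmetrize x0 t0 c0 y00 eps0 h0 (su 1%N) cdy) in H3.
have {}H3 := H3 isT.
rewrite H2 in H1; rewrite distrC.
have H4 : r * A <= e / 2.
  apply: le_trans (_ : h * (Cd * G * A) <= _).
    have -> : h * (Cd * G * A) = Cd * h * 1 * G * A by ring.
    rewrite /r; apply: ler_wpM2r => //; apply: ler_wpM2r => //; apply: ler_wpM2l; first by rewrite mulr_ge0// ltW.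
    by rewrite -[leRHS]sqrtr1; exact: ler_wsqrtr.
  apply: le_trans (_ : h * (Cd * G * A + 1) <= _); first by rewrite ler_pM2l// lerDl.
  by rewrite -ler_pdivlMr ?(ltW hq)// ltr_wpDl// !mulr_ge0.
have := ler_distD (Jint c y0 eps h (fun x t => dy u (x0 + x) 0 (t0 + t))) (\int[(lebesgue_measure \x lebesgue_measure)%E]_(p in U c eps x0 y0 t0) g p) (u x0 y0 t0).
move=> /le_trans; apply; rewrite (splitr e); apply: lerD => //.
exact: le_trans H1 H4.
Unshelve. all: by end_near. Qed.
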